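(* The two-parameter Ringel-Hall algebra $H_{r,s}(A_\infty)$ can be presented as an iterated skew polynomial ring. That is, there is an enumeration $b_1,b_2,b_3,\dots$ of $\Phi^+$ such that, with $H_0=\mathbb{Q}(r,s)$ and $H_j$ the $\mathbb{Q}(r,s)$-subalgebra of $H_{r,s}(A_\infty)$ generated by $X_{b_1},\dots,X_{b_j}$, one has $H_{r,s}(A_\infty)=\bigcup_{j\ge0}H_j$ and, for every $j\ge1$, $H_j=H_{j-1}[X_{b_j};l_j,\delta_j]$ is a skew polynomial (Ore) extension for some $\mathbb{Q}(r,s)$-algebra automorphism $l_j$ of $H_{j-1}$ and some $l_j$-derivation $\delta_j$ of $H_{j-1}$.
   Context: $\mathbb{Q}(r,s)$ is the field of rational functions in two independent variables $r,s$. $A_\infty$ is the infinite linear quiver $1\to2\to3\to\cdots$. For $i\le j$ let $M_{ij}$ be the indecomposable finite dimensional representation with top the simple $S_i$ and length $j-i+1$ (composition factors $S_i,\dots,S_j$), corresponding to the positive root $\alpha_{ij}=\alpha_i+\dots+\alpha_j$; $\Phi^+$ is the set of these roots. The set $\mathcal{P}$ of isomorphism classes of finite dimensional representations of $A_\infty$ is identified, independently of the field $k$, with the finitely supported maps $\lambda:\Phi^+\to\mathbb{Z}_{\ge0}$, via $M_k(\lambda)=\bigoplus_{a\in\Phi^+}\lambda(a)M_k(a)$. For $\alpha,\beta\in\mathcal{P}$, $\langle\alpha,\beta\rangle=\dim_k\mathrm{Hom}(M_k(\alpha),M_k(\beta))-\dim_k\mathrm{Ext}^1(M_k(\alpha),M_k(\beta))$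 (depends only on dimension vectors). $F^\lambda_{\alpha\beta}(x)\in\mathbb{Z}[x]$ is the Hall polynomial: for every finite field $k$ with $q$ elements, $F^\lambda_{\alpha\beta}(q)$ is the number of subrepresentations $N$ of $M_k(\lambda)$ with $N\cong M_k(\beta)$ and $M_k(\lambda)/N\cong M_k(\alpha)$. $H_{r,s}(A_\infty)$ is the $\mathbb{Q}(r,s)$-algebra with basis $\{u_\alpha\mid\alpha\in\mathcal{P}\}$ and product $u_\alpha u_\beta=\sum_{\lambda}s^{-\langle\alpha,\beta\rangle}F^\lambda_{\alpha\beta}(rs^{-1})u_\lambda$. For $a\in\Phi^+$ put $X_a=s^{\dim_kM(a)-\dim_k\mathrm{End}(M(a))}u_a$, where $u_a$ is the basis element of the indecomposable $M(a)$. Skew polynomial ring $R[X;l,\delta]$: free left $R$-module on the powers of $X$, with $Xx=l(x)X+\delta(x)$ for $x\in R$, where $\delta(xy)=l(x)\delta(y)+\delta(x)y$. *)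

(* Defs.v *)
From HB Require Import structures.
From mathcomp Require Import all_boot all_order all_algebra.
From mathcomp Require Import finmap multiset.
From mathcomp Require Import classical_sets functions cardinality fsbigop.
From mathcomp Require Import monalg.

Set Implicit Arguments.
Unset Strict Implicit.
Unset Printing Implicit Defensive.

Import GRing.Theory.

Local Open Scope ring_scope.
Local Open Scope classical_set_scope.
Local Open Scope card_scope.

(* The vertices 1, 2, 3, ... of A_oo are numbered 0, 1, 2, ... here, with
   arrows i -> i.+1; the pair (i, j) stands for alpha_(i+1, j+1). *)
Definition posroot := {p : nat * nat | (p.1 <= p.2)%N}.
HB.instance Definition _ := Countable.on posroot.

Local Notation P := ({mset posroot})%mset.

Section Representations.
Variable k : fieldType.

(* M_i = k^(rdim i), written as row vectors: the arrow i -> i.+1 acts by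
   v |-> v *m rmap i. *)
Record rep := Rep {
  rdim : nat -> nat;
  rmap : forall i, 'M[k]_(rdim i, rdim i.+1);
  rbound : nat;
  rdim_eq0 : forall i, (rbound <= i)%N -> rdim i = 0%N }.

Lemma rep0_subproof (i : nat) : (0 <= i)%N -> 0%N = 0%N.
Proof. by []. Qed.

Definition rep0 : rep := Rep (fun i => 0) rep0_subproof.

Lemma dsum_subproof (M N : rep) (i : nat) :
  (maxn (rbound M) (rbound N) <= i)%N -> (rdim M i + rdim N i)%N = 0%N.
Proof. by rewrite geq_max => /andP[Mi Ni]; rewrite !rdim_eq0. Qed.

Definition dsum (M N : rep) : rep :=
  Rep (fun i => block_mx (rmap M i) 0 0 (rmap N i)) (@dsum_subproof M N).

Lemma indec_subproof (a : posroot) (i : nat) :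
  ((val a).2.+1 <= i)%N -> ((val a).1 <= i <= (val a).2)%N = 0%N :> nat.
Proof. by move=> ai; rewrite [(i <= _)%N]leqNgt ai andbF. Qed.

(* One-dimensional at the vertices of the interval a, with identity maps
   between them; the remaining matrices have no entries. *)
Definition indec (a : posroot) : rep :=
  @Rep (fun i => nat_of_bool ((val a).1 <= i <= (val a).2)%N)
    (fun i => const_mx 1) _ (@indec_subproof a).

Definition Mrep (l : P) : rep := foldr dsum rep0 [seq indec a | a <- l].

Definition rtotal (M : rep) : nat := (\sum_(i < rbound M) rdim M i)%N.

(* The complex  prod_i Hom(M_i, N_i) -> prod_i Hom(M_i, N_i.+1),
   (h_i)_i |-> (h_i *m rmap N i - rmap M i *m h_i.+1)_i,
   truncated at rbound M, beyond which all the factors vanish. A family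
   (c_i)_i on the right is the extension of M by N with underlying spaces
   M_i (+) N_i and arrows block_mx (rmap M i) c_i 0 (rmap N i), and two families
   give equivalent extensions iff they differ by the image of a family (h_i)_i.
   Hence the kernel is Hom(M, N) and the cokernel is Ext^1(M, N). *)
Definition coboundary (M N : rep) (n := rbound M)
    (c : 'rV[k]_(\sum_(i < n.+1) rdim M i * rdim N i)) :
    'rV[k]_(\sum_(i < n) rdim M i * rdim N i.+1) :=
  let h (i : 'I_n.+1) : 'M[k]_(rdim M i, rdim N i) := vec_mx (submxrow c i) in
  \mxrow_(i < n)
    mxvec (h (@Ordinal n.+1 i (ltnW (ltn_ord i))) *m rmap N i
           - rmap M i *m h (@Ordinal n.+1 i.+1 (ltn_ord i))).

Definition dim_Hom (M N : rep) : nat := \rank (kermx (lin1_mx (@coboundary M N))).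

Definition dim_Ext1 (M N : rep) : nat :=
  \rank (cokermx (lin1_mx (@coboundary M N))).

Definition rep_hom (M N : rep) (h : forall i, 'M[k]_(rdim M i, rdim N i)) :=
  forall i, h i *m rmap N i = rmap M i *m h i.+1.

Definition is_subrep (M : rep) (U : forall i, {vspace 'rV[k]_(rdim M i)}) :=
  forall i v, v \in U i -> v *m rmap M i \in U i.+1.

Definition subrep_isom (M : rep) (U : forall i, {vspace 'rV[k]_(rdim M i)})
    (N : rep) :=
  exists h : forall i, 'M[k]_(rdim N i, rdim M i),
    [/\ rep_hom h, forall i, row_free (h i) &
        forall i v, v \in U i <-> exists w, v = w *m h i].

(* M / U is isomorphic to Q: there is an epimorphism M -> Q with kernel U. *)
Definition quotient_isom (M : rep) (U : forall i, {vspace 'rV[k]_(rdim M i)})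
    (Q : rep) :=
  exists h : forall i, 'M[k]_(rdim M i, rdim Q i),
    [/\ rep_hom h, forall i, row_full (h i) &
        forall i v, v \in U i <-> v *m h i = 0].

End Representations.

Definition is_hall_poly (a b l : P) (F : {poly int}) :=
  forall k : finFieldType, exists2 n : nat, F.[#|k|%:R] = n%:R &
    [set U | [/\ @is_subrep k (Mrep k l) U, subrep_isom U (Mrep k b)
               & quotient_isom U (Mrep k a)]] #= `I_n.

(* At most one polynomial qualifies, as there are infinitely many finite
   cardinals q. *)
Definition hall_poly (a b l : P) : {poly int} :=
  xget 0 [set F | is_hall_poly a b l F].

Notation Qrs := {fraction {poly {poly rat}}}.
Definition rvar : Qrs := tofrac ('X%:P).
Definition svar : Qrs := tofrac 'X.

(* The numbers dim Hom and dim Ext^1 involved here do not depend on k. *)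
Section HallAlgebra.
Variable k : fieldType.

Definition euler (a b : P) : int :=
  (dim_Hom (Mrep k a) (Mrep k b))%:Z - (dim_Ext1 (Mrep k a) (Mrep k b))%:Z.

Definition hall_alg := {malg Qrs[P]}.

Definition u (a : P) : hall_alg := << a >>.

Definition hall_mul (x y : hall_alg) : hall_alg :=
  \sum_(a <- msupp x) \sum_(b <- msupp y) (x@_a * y@_b) *:
    (\sum_(l \in [set: P])
       (svar ^ (- euler a b)
        * (map_poly intr (hall_poly a b l)).[rvar / svar]) *: u l).

Definition hall_one : hall_alg := u mset0.

Definition X (a : posroot) : hall_alg :=
  svar ^ ((rtotal (indec k a))%:Z - (dim_Hom (indec k a) (indec k a))%:Z)
    *: u [mset a]%mset.

End HallAlgebra.

(* Algebras given by a bilinear product and a unit on a K-module. *)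
Section Ore.
Variables (K : fieldType) (V : lmodType K) (mul : V -> V -> V) (one : V).

Definition is_algebra :=
  [/\ associative mul, left_id one mul, right_id one mul,
      forall c x y z, mul (c *: x + y) z = c *: mul x z + mul y z &
      forall c x y z, mul z (c *: x + y) = c *: mul z x + mul z y].

Definition subalgebra (A : set V) :=
  [/\ A one, forall c x y, A x -> A y -> A (c *: x + y) &
      forall x y, A x -> A y -> A (mul x y)].

Definition generated (G : set V) : set V := smallest subalgebra G.

Definition alg_automorphism (A : set V) (l : V -> V) :=
  [/\ set_bij A A l, l one = one,
      forall c x y, A x -> A y -> l (c *: x + y) = c *: l x + l y &
      forall x y, A x -> A y -> l (mul x y) = mul (l x) (l y)].

Definition skew_derivation (A : set V) (l d : V -> V) :=
  [/\ forall x, A x -> A (d x),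
      forall c x y, A x -> A y -> d (c *: x + y) = c *: d x + d y &
      forall x y, A x -> A y -> d (mul x y) = mul (l x) (d y) + mul (d x) y].

Definition lcomb (n : nat) (c : nat -> V) (x : V) : V :=
  \sum_(i < n) mul (c i) (iter i (mul x) one).

(* B = A[x; l, d]: the last two clauses say that B is the free left A-module on
   the powers of x. *)
Definition ore_extension (A B : set V) (x : V) (l d : V -> V) :=
  [/\ alg_automorphism A l, skew_derivation A l d,
      forall a, A a -> mul x a = mul (l a) x + d a,
      forall y, B y <-> exists n c, (forall i, A (c i)) /\ y = lcomb n c x &
      forall n c, (forall i, A (c i)) -> lcomb n c x = 0 ->
        forall i, (i < n)%N -> c i = 0].

End Ore.

Definition stage (k : fieldType) (b : nat -> posroot) (j : nat) :
    set hall_alg :=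
  generated (hall_mul k) hall_one [set X k (b i) | i in `I_j].

(* Main.v *)
(* A representation M of A_oo is determined up to isomorphism by the ranks of the maps M_p -> M_q,
   since the vectors at the lowest vertex generate direct summands. A Hall number therefore counts
   the families of subspaces U_p with prescribed ranks on U and on M / U.

   Order the roots [i, j] lexicographically by (j, i). If b is at least all the roots of m, then
   u_b u_m = [m(b) + 1] s^* u_(b + m); if x < b, then u_b u_x is a multiple of u_x u_b up to a
   combination of u_l with all the roots of l smaller than b; and the roots of l stay below b if
   those of both factors do. All of this follows by counting the functionals that define a
   surjection onto an indecomposable representation.

   For simple tops the same count gives polynomials; u_[i, j] is the difference of the two products
   of u_[i, i] and u_[i + 1, j], and the general case follows by splitting off the largest root and
   dividing by the monic polynomial [m(b) + 1]. Counting flags gives associativity for every q,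
   hence for the Hall polynomials, hence after the substitution x = r / s.

   The subalgebra generated by the X_a, a < b, is thus spanned by the u_m with all roots of m below
   b. Scaling u_m by a character chi of the dimension vector is an automorphism l for which
   d = (y |-> X_b y - l(y) X_b) preserves this subalgebra. The powers of X_b are independent over it
   because their products with the u_m have distinct leading terms, first on the right and, as l is
   invertible, then on the left. *)
Require Import Defs.
From HB Require Import structures.
From mathcomp Require Import all_boot all_order all_algebra.
From mathcomp Require Import finmap multiset.
From mathcomp Require Import boolp classical_sets functions cardinality fsbigop.
From mathcomp Require Import monalg.
From mathcomp Require Import zify.

Set Implicit Arguments.
Unset Strict Implicit.
Unset Printing Implicit Defensive.

Import GRing.Theory.

Local Open Scope ring_scope.

Local Notation P := ({mset posroot})%mset.

(** * Ranks of compositions of arrows *)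

(** Ordering the roots first by their last vertex makes the decisive products exact. If b = [i, j]
    is at least every root of m, an extension of M(b) by M(m) vanishes past j, its ranks are those
    of the direct sum, and u_b u_m is a multiple of one basis element without lower terms. This is
    why inductions on types remove a largest root and why independence is tested with the powers of
    X_b on the left of the coefficients.

    Hall polynomials are picked by [xget] with default 0, so nothing is known about [hall_poly]
    until existence is proved for all triples; counts over finite fields, and their dependence on
    the cardinality alone, are settled before the algebra appears. As r / s is not the cardinality
    of a field, a fact about counts reaches the algebra only through Z[x], where prime fields
    suffice as test points.

    The character chi has values of the Euler form as exponents. This works because the Hall
    polynomial of a split pair x < b is the power of the variable with exponent <b, x>; bilinearity
    then turns relations between two roots into an automorphism of the whole algebra. *)

Section Paths.
Variable k : fieldType.
Implicit Types M N : rep k.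

(* pid_mx is the identity when p = q, without a cast between 'M_(p, p) and 'M_(p, q). *)
Fixpoint pth M p q : 'M[k]_(rdim M p, rdim M q) :=
  if p == q then pid_mx (rdim M p) else
  match q return 'M[k]_(rdim M p, rdim M q) with
  | 0 => 0
  | q'.+1 => pth M p q' *m rmap M q'
  end.

Lemma pth_id M p : pth M p p = 1%:M.
Proof. by case: p => [|p] /=; rewrite ?eqxx pid_mx_1. Qed.

Lemma pthS M p q : (p <= q)%N -> pth M p q.+1 = pth M p q *m rmap M q.
Proof. by move=> pq /=; rewrite ltn_eqF. Qed.

Lemma pth_gt M p q : (q < p)%N -> pth M p q = 0.
Proof.
elim: q => [|q IHq] qp /=; rewrite gtn_eqF //.
by rewrite IHq ?mul0mx // ltnW.
Qed.

Lemma pth1 M p : pth M p p.+1 = rmap M p.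
Proof. by rewrite pthS // pth_id mul1mx. Qed.

Lemma pthM M p q t : (p <= q)%N -> (q <= t)%N ->
  pth M p q *m pth M q t = pth M p t.
Proof.
move=> pq; elim: t => [|t IHt].
  by rewrite leqn0 => /eqP q0; subst q; rewrite pth_id mulmx1.
rewrite leq_eqVlt => /orP[/eqP <-|qt]; first by rewrite pth_id mulmx1.
by rewrite !pthS ?(leq_trans pq) // mulmxA IHt.
Qed.

Lemma pthSl M p q : (p < q)%N -> rmap M p *m pth M p.+1 q = pth M p q.
Proof. by move=> pq; rewrite -pth1 pthM. Qed.

Lemma hom_pth M N (h : forall p, 'M[k]_(rdim M p, rdim N p)) p q :
  rep_hom h -> h p *m pth N p q = pth M p q *m h q.
Proof.
move=> hh; case: (leqP p q) => [|qp]; last by rewrite !pth_gt // mulmx0 mul0mx.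
elim: q => [|q IHq].
  by rewrite leqn0 => /eqP p0; subst p; rewrite !pth_id mulmx1 mul1mx.
rewrite leq_eqVlt => /orP[/eqP <-|pq]; first by rewrite !pth_id mulmx1 mul1mx.
by rewrite !pthS // mulmxA IHq // -!mulmxA hh.
Qed.

Definition rk M p q := \rank (pth M p q).

Lemma rk_id M p : rk M p p = rdim M p.
Proof. by rewrite /rk pth_id mxrank1. Qed.

Lemma rk_gt M p q : (q < p)%N -> rk M p q = 0%N.
Proof. by move=> qp; rewrite /rk pth_gt // mxrank0. Qed.


Lemma pth_rep0 p q : pth (rep0 k) p q = 0.
Proof. by apply/matrixP => -[]. Qed.

Lemma pth_dsum M N p q :
  pth (dsum M N) p q = block_mx (pth M p q) 0 0 (pth N p q).
Proof.
case: (leqP p q) => [|qp]; last by rewrite !pth_gt // block_mx0.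
elim: q => [|q IHq].
  by rewrite leqn0 => /eqP p0; subst p; rewrite !pth_id scalar_mx_block.
rewrite leq_eqVlt => /orP[/eqP <-|pq]; first by rewrite !pth_id scalar_mx_block.
rewrite !pthS // IHq //= mulmx_block.
by rewrite !mulmx0 !mul0mx !addr0 !add0r.
Qed.

Lemma rk_dsum M N p q : rk (dsum M N) p q = (rk M p q + rk N p q)%N.
Proof. by rewrite /rk pth_dsum rank_diag_block_mx. Qed.

Definition spans (a : posroot) p q :=
  [&& ((val a).1 <= p)%N, (p <= q)%N & (q <= (val a).2)%N].

Lemma rk_indec a p q : rk (indec k a) p q = spans a p q.
Proof.
rewrite /rk /spans; case: (leqP p q) => [pq|qp]; last first.
  by rewrite pth_gt // mxrank0 andbF.
have -> : pth (indec k a) p q = const_mx 1.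
  elim: q pq => [|q IHq].
    rewrite leqn0 => /eqP p0; subst p; rewrite pth_id; apply/matrixP => /=.
    by case: (_ && _) => -[[]//= ?] [[]//= ?]; rewrite !mxE.
  rewrite leq_eqVlt => /orP[/eqP <-|pq].
    rewrite pth_id; apply/matrixP => /=.
    by case: (_ && _) => -[[]//= ?] [[]//= ?]; rewrite !mxE.
  rewrite pthS // IHq //=; apply/matrixP => /= x y; rewrite !mxE.
  (* The indices [x] and [y] exist only if the dimensions at p and q.+1 are 1. Then q lies in the
     interval too, and the sum over the middle index has a single term. *)
  have ap : ((val a).1 <= p)%N by case: x => /=; case: (leqP _ p).
  have qa : (q <= (val a).2)%N.
    by apply: ltnW; case: y => /=; case: (leqP q.+1 _); rewrite ?andbF.
  rewrite (eq_bigr (fun=> 1)) => [|i _]; last by rewrite !mxE mulr1.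
  by rewrite sumr_const card_ord qa (leq_trans ap).
set A : 'M[k]_(_, _) := const_mx 1.
have le1 : (\rank A <= ((val a).1 <= p <= (val a).2))%N := rank_leq_row A.
have le2 : (\rank A <= ((val a).1 <= q <= (val a).2))%N := rank_leq_col A.
have ge : ((val a).1 <= p)%N -> (q <= (val a).2)%N -> (0 < \rank A)%N.
  move=> ap qa.
  have p0 : (0 < ((val a).1 <= p <= (val a).2))%N by rewrite ap (leq_trans pq).
  have q0 : (0 < ((val a).1 <= q <= (val a).2))%N by rewrite qa (leq_trans ap).
  rewrite lt0n mxrank_eq0; apply/negP => /eqP/matrixP/(_ (Ordinal p0) (Ordinal q0)).
  by rewrite !mxE => /eqP; rewrite oner_eq0.
move: le1 le2 ge; move: (\rank A) => r le1 le2 ge.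
by case: (leqP (val a).1 p) le1 ge => ?; case: (leqP q (val a).2) le2 => ? /=;
  rewrite ?andbF; lia.
Qed.

(** The rank from p to q of the representation of type s, the same over every field; for p = q it is
    the dimension at p. *)
Definition R (s : seq posroot) p q := count (fun a => spans a p q) s.

Lemma rk_seq (s : seq posroot) p q :
  rk (foldr (@dsum k) (rep0 k) [seq indec k a | a <- s]) p q = R s p q.
Proof.
elim: s => [|a s IHs]; first by rewrite /rk pth_rep0 mxrank0.
by rewrite [LHS]rk_dsum rk_indec IHs.
Qed.

Lemma rk_Mrep (l : P) p q : rk (Mrep k l) p q = R l p q.
Proof. exact: rk_seq. Qed.

End Paths.

(** * Classification of representations by ranks *)

Section Splitting.
Variable k : fieldType.
Implicit Types M N : rep k.

(* A vector v at the lowest vertex i of M generates a direct summand [i, j]: the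
   functionals e p = pth p j *m phi, with phi dual to v *m pth i j, split off the
   string w p = v *m pth i p. *)
Lemma split_string M i j : (forall p, (p < i)%N -> rdim M p = 0%N) ->
  (0 < rk M i j)%N -> rk M i j.+1 = 0%N ->
  exists (e : forall p, 'cV[k]_(rdim M p)) (w : forall p, 'rV[k]_(rdim M p)),
  [/\ forall p, (i <= p)%N -> w p *m rmap M p = w p.+1,
      forall p, (p < j)%N -> rmap M p *m e p.+1 = e p,
      forall p, (j < p)%N -> w p = 0,
      forall p, (j < p)%N -> e p = 0 &
      forall p, (i <= p)%N -> (p <= j)%N -> w p *m e p = 1%:M].
Proof.
move=> dM rij rij1.
have [x Px] : exists x, row x (pth M i j) != 0.
  apply/existsP; apply: contraTT rij => /existsPn P0.
  rewrite -leqNgt leqn0 mxrank_eq0; apply/eqP/row_matrixP => x.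
  by rewrite row0; apply/eqP; move: (P0 x); rewrite negbK.
have [y Py] : exists y, row x (pth M i j) 0 y != 0 by apply/rV0Pn.
have ij : (i <= j)%N by rewrite leqNgt; apply: contraTN rij => ?; rewrite rk_gt.
set c := row x (pth M i j) 0 y in Py.
pose phi : 'cV[k]_(rdim M j) := c^-1 *: delta_mx y 0.
pose v : 'rV[k]_(rdim M i) := delta_mx 0 x.
have vphi : v *m pth M i j *m phi = 1%:M.
  rewrite -rowE -scalemxAr -colE; apply/matrixP => a b.
  have cE : pth M i j x y = c by rewrite /c mxE.
  by rewrite !ord1 !mxE cE mulVf.
have P0 p : (j < p)%N -> pth M i p = 0.
  move=> jp; rewrite -(@pthM _ M i j.+1 p) // ?(leqW ij) //.
  have -> : pth M i j.+1 = 0 by apply/eqP; rewrite -mxrank_eq0 -/(rk _ _ _) rij1.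
  by rewrite mul0mx.
exists (fun p => pth M p j *m phi), (fun p => v *m pth M i p); split.
- by move=> p ip; rewrite -mulmxA pthS.
- by move=> p pj; rewrite mulmxA pthSl.
- by move=> p /P0 ->; rewrite mulmx0.
- by move=> p jp; rewrite pth_gt // mul0mx.
- by move=> p ip pj; rewrite !mulmxA -(mulmxA v) pthM.
Qed.

(** The complement of the string is the image of the idempotents [pr p = 1 - e p *m w p]. These
    commute with the arrows even at the end p = j of the string, where both corrections vanish
    because [w p.+1 = 0]. A full rank factorization [pr = ro *m io] gives N its coordinates. *)
Lemma split_rep M i j : (forall p, (p < i)%N -> rdim M p = 0%N) ->
  (0 < rk M i j)%N -> rk M i j.+1 = 0%N ->
  exists (N : rep k)
    (io : forall p, 'M[k]_(rdim N p, rdim M p))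
    (ro : forall p, 'M[k]_(rdim M p, rdim N p))
    (e : forall p, 'cV[k]_(rdim M p)) (w : forall p, 'rV[k]_(rdim M p)),
  [/\ rep_hom io, rep_hom ro, forall p, io p *m ro p = 1%:M,
      forall p, ro p *m io p + e p *m w p = 1%:M &
      forall p, io p *m e p = 0 /\ w p *m ro p = 0] /\
  [/\ forall p, (i <= p)%N -> w p *m rmap M p = w p.+1,
      forall p, (p < j)%N -> rmap M p *m e p.+1 = e p,
      forall p, (j < p)%N -> w p = 0,
      forall p, (j < p)%N -> e p = 0 &
      forall p, (i <= p)%N -> (p <= j)%N -> w p *m e p = 1%:M].
Proof.
move=> dM rij rij1; have [e [w [wS eS w0 e0 we]]] := split_string dM rij rij1.
pose pr p : 'M[k]_(rdim M p) := 1%:M - e p *m w p.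
have ewP p : (p < i)%N \/ (j < p)%N \/ (i <= p <= j)%N by lia.
have pre p : pr p *m e p = 0.
  rewrite mulmxBl mul1mx -mulmxA.
  case: (ewP p) => [/dM dp|[jp|/andP[ip pj]]].
  - by apply/matrixP => -[x xp]; exfalso; move: xp; rewrite dp.
  - by rewrite e0 // mul0mx subrr.
  - by rewrite we // mulmx1 subrr.
have wpr p : w p *m pr p = 0.
  rewrite mulmxBr mulmx1 mulmxA.
  case: (ewP p) => [/dM dp|[jp|/andP[ip pj]]].
  - by apply/matrixP => ? -[x xp]; exfalso; move: xp; rewrite dp.
  - by rewrite w0 // mulmx0 subrr.
  - by rewrite we // mul1mx subrr.
have prpr p : pr p *m pr p = pr p by rewrite {2}/pr mulmxBr mulmx1 mulmxA pre mul0mx subr0.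
have prx p : pr p *m rmap M p = rmap M p *m pr p.+1.
  rewrite mulmxBl mulmxBr mul1mx mulmx1; congr (_ - _).
  rewrite -(mulmxA (e p)) [RHS]mulmxA.
  case: (ltnP p i) => [/dM dp|ip].
    by apply/matrixP => -[x xp]; exfalso; move: xp; rewrite dp.
  rewrite wS //; case: (ltnP p j) => pj; first by rewrite eS.
  by rewrite w0 // !mulmx0.
pose io p := row_base (pr p); pose ro p := col_base (pr p).
have roio p : ro p *m io p = pr p by rewrite mulmx_base.
have ioro p : io p *m ro p = 1%:M.
  apply: (row_full_inj (col_base_full (pr p))).
  apply: (row_free_inj (row_base_free (pr p))).
  by rewrite -/(io p) -/(ro p) mulmx1 mulmxA roio -mulmxA roio prpr.
have iopr p : io p *m pr p = io p.
  by rewrite -[RHS]mul1mx -(ioro p) -[RHS]mulmxA roio.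
have prro p : pr p *m ro p = ro p.
  by rewrite -[RHS]mulmx1 -(ioro p) [RHS]mulmxA roio.
clearbody io ro.
have N0 p : (rbound M <= p)%N -> \rank (pr p) = 0%N.
  move=> /rdim_eq0 dp; apply/eqP; rewrite -leqn0.
  by rewrite -[X in (_ <= X)%N]dp; apply: rank_leq_row.
pose N := Rep (fun p => io p *m rmap M p *m ro p.+1) N0.
exists N, io, ro, e, w; split; split=> //.
- by move=> p /=; rewrite -[RHS]mulmxA roio -[RHS]mulmxA -prx [RHS]mulmxA iopr.
- by move=> p /=; rewrite !mulmxA roio prx -[LHS]mulmxA prro.
- by move=> p; rewrite roio subrK.
- by move=> p; rewrite -(iopr p) -(prro p) -mulmxA pre mulmx0 mulmxA wpr mul0mx.
Qed.

End Splitting.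

Section Classification.
Variable k : fieldType.
Implicit Types M N : rep k.

(** For i <= p the splitting writes [pth M p q] as [ro p *m pth N p q *m io q + e p *m w q]. If
    [p, q] lies in [i, j], the outer factors assemble into invertible matrices around a diagonal
    block matrix with an extra 1; if q > j, the second term is zero. *)
Lemma split_rk M N i j (io : forall p, 'M[k]_(rdim N p, rdim M p))
    (ro : forall p, 'M[k]_(rdim M p, rdim N p))
    (e : forall p, 'cV[k]_(rdim M p)) (w : forall p, 'rV[k]_(rdim M p)) :
  (forall p, (p < i)%N -> rdim M p = 0%N) ->
  rep_hom io -> rep_hom ro -> (forall p, io p *m ro p = 1%:M) ->
  (forall p, ro p *m io p + e p *m w p = 1%:M) ->
  (forall p, io p *m e p = 0 /\ w p *m ro p = 0) ->
  (forall p, (i <= p)%N -> w p *m rmap M p = w p.+1) ->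
  (forall p, (j < p)%N -> e p = 0) ->
  (forall p, (i <= p)%N -> (p <= j)%N -> w p *m e p = 1%:M) ->
  forall p q, (p <= q)%N -> rk M p q = (rk N p q + ((i <= p) && (q <= j)))%N.
Proof.
move=> dM hio hro ioro roio ort wS e0 we p q pq.
have wp : (i <= p)%N -> w p *m pth M p q = w q.
  move=> ip; elim: q pq => [|q IHq].
    by rewrite leqn0 => /eqP p0; subst p; rewrite pth_id mulmx1.
  rewrite leq_eqVlt => /orP[/eqP <-|pq]; first by rewrite pth_id mulmx1.
  by rewrite pthS // mulmxA IHq // wS // (leq_trans ip).
have rofull t : row_full (ro t) by apply/row_fullP; exists (io t).
have iofree t : row_free (io t) by apply/row_freeP; exists (ro t).
have rkN : rk N p q = \rank (ro p *m pth N p q *m io q).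
  by rewrite mxrankMfree // (eqmxMfull _ (rofull p)).
have PE : pth M p q = ro p *m pth N p q *m io q + e p *m (w p *m pth M p q).
  by rewrite -mulmxA -hom_pth // !mulmxA -mulmxDl roio mul1mx.
case: (ltnP p i) => [pi|ip].
  rewrite addn0 rkN /rk; congr (\rank _); apply/matrixP => -[x xp].
  by exfalso; move: xp; rewrite dM.
case: (leqP q j) => qj; last first.
  rewrite addn0 rkN /rk PE wp //.
  have -> : w q = 0.
    rewrite -[w q]mulmx1 -roio mulmxDr !mulmxA (ort q).2 mul0mx add0r.
    by rewrite e0 ?mulmx0 ?mul0mx.
  by rewrite mulmx0 addr0.
rewrite /rk.
have -> : pth M p q = row_mx (ro p) (e p) *m block_mx (pth N p q) 0 0 1%:M
    *m col_mx (io q) (w q) :> 'M[k]_(rdim M p, rdim M q).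
  rewrite mul_row_block mul_row_col !mulmx0 addr0 add0r mulmx1.
  by rewrite [LHS]PE wp.
have F1 : row_full (row_mx (ro p) (e p)).
  apply/row_fullP; exists (col_mx (io p) (w p)).
  rewrite mul_col_row ioro (ort p).1 (ort p).2 we ?(leq_trans pq) //.
  by rewrite -scalar_mx_block.
have F2 : row_free (col_mx (io q) (w q)).
  apply/row_freeP; exists (row_mx (ro q) (e q)).
  rewrite mul_col_row ioro (ort q).1 (ort q).2 we ?(leq_trans ip) //.
  by rewrite -scalar_mx_block.
by rewrite mxrankMfree // (eqmxMfull _ F1) rank_diag_block_mx mxrank1.
Qed.

Definition isoM M N := exists (h : forall p, 'M[k]_(rdim M p, rdim N p))
    (g : forall p, 'M[k]_(rdim N p, rdim M p)),
  [/\ rep_hom h, rep_hom g, forall p, h p *m g p = 1%:M &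
      forall p, g p *m h p = 1%:M].


Lemma rdim_gt0 M p : (0 < rdim M p)%N -> (p < rbound M)%N.
Proof. by move=> d0; rewrite ltnNge; apply: contraL d0 => /rdim_eq0 ->. Qed.

Lemma rtotal_lt M N : (forall p, rdim N p <= rdim M p)%N ->
  (exists i, rdim N i < rdim M i)%N -> (rtotal N < rtotal M)%N.
Proof.
move=> le [i lt]; rewrite /rtotal.
have rE (L : rep k) n : (rbound L <= n)%N ->
    (\sum_(p < rbound L) rdim L p = \sum_(p < n) rdim L p)%N.
  move=> Ln; rewrite -!(big_mkord xpredT (fun p => rdim L p)) [RHS](@big_cat_nat _ _ _ (rbound L)) //=.
  rewrite [X in (_ + X)%N]big1_seq ?addn0 // => p /andP[_].
  by rewrite mem_index_iota => /andP[/rdim_eq0].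
rewrite (rE N _ (leq_maxr (rbound M) _)) (rE M _ (leq_maxl _ (rbound N))).
have iM : (i < maxn (rbound M) (rbound N))%N.
  by rewrite leq_max rdim_gt0 // (leq_trans _ lt).
rewrite (bigD1 (Ordinal iM)) //= [X in (_ < X)%N](bigD1 (Ordinal iM)) //= -addSn.
by apply: leq_add => //; apply: leq_sum.
Qed.

(** The data for splitting off [i, j]: the lowest vertex i of the support and the last vertex j that
    M_i reaches by a nonzero map. *)
Lemma corner M : (exists p, 0 < rdim M p)%N -> exists i j,
  [/\ forall p, (p < i)%N -> rdim M p = 0%N, (0 < rk M i j)%N,
      rk M i j.+1 = 0%N & (i <= j)%N].
Proof.
move=> ex; case: (ex_minnP ex) => i di mini.
have exj : exists j, (0 < rk M i j)%N by exists i; rewrite rk_id.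
have ub j : (0 < rk M i j)%N -> (j <= rbound M)%N.
  by move=> r0; apply/ltnW/rdim_gt0/(leq_trans r0)/rank_leq_col.
case: (ex_maxnP exj ub) => j rj maxj; exists i, j; split=> //.
- move=> p pi; apply/eqP; rewrite -leqn0 leqNgt; apply: contraTN pi => /mini.
  by rewrite -leqNgt.
- by apply/eqP; rewrite -leqn0 leqNgt; apply/negP => /maxj; rewrite ltnn.
- by rewrite leqNgt; apply: contraTN rj => ?; rewrite rk_gt.
Qed.

(** Induction on the total dimension. Equal ranks give both representations the same corner; both
    lose the same string, and the complements again have equal ranks. The isomorphism joins the one
    between the complements with [e p *m w' p] between the strings. *)
Lemma iso_rk M N : (forall p q, (p <= q)%N -> rk M p q = rk N p q) -> isoM M N.
Proof.
have [n] := ubnP (rtotal M); elim: n M N => // n IHn M N; rewrite ltnS => Mn rMN.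
have dMN p : rdim M p = rdim N p by rewrite -!rk_id rMN.
case: (pselect (exists p, 0 < rdim M p)%N) => [ex|M0]; last first.
  have d0 p : rdim M p = 0%N.
    by apply/eqP; rewrite -leqn0 leqNgt; apply/negP => ?; apply: M0; exists p.
  have z m m' (A B : 'M[k]_(m, m')) : m = 0%N -> A = B.
    by move=> m0; apply/matrixP => -[x xm]; exfalso; move: xm; rewrite m0.
  by exists (fun p => 0), (fun p => 0); split=> p; apply: z; rewrite -?dMN d0.
have [i [j [dM rij rij1 ij]]] := corner ex.
have dN p : (p < i)%N -> rdim N p = 0%N by rewrite -dMN; apply: dM.
have [M' [io [ro [e [w [[hio hro ioro roio ort] [wS eS w0 e0 we]]]]]]] :=
  split_rep dM rij rij1.
rewrite !rMN ?(leqW ij) // in rij rij1.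
have [N' [io' [ro' [e' [w' [[hio' hro' ioro' roio' ort'] [wS' eS' w0' e0' we']]]]]]] :=
  split_rep dN rij rij1.
have rM' := split_rk dM hio hro ioro roio ort wS e0 we.
have rN' := split_rk dN hio' hro' ioro' roio' ort' wS' e0' we'.
have [||g [g' [hg hg' gK gK']]] := IHn M' N'.
- apply: leq_trans Mn; apply: rtotal_lt.
    by move=> p; rewrite -!rk_id rM' // leq_addr.
  by exists i; rewrite -!rk_id rM' // leqnn ij addn1.
- by move=> p q pq; apply/eqP; rewrite -(eqn_add2r ((i <= p) && (q <= j))%N) -rM' // -rN' // rMN.
have ewP p : (p < i)%N \/ (j < p)%N \/ (i <= p <= j)%N by lia.
have hom (L L' K K' : rep k) (ro1 : forall p, 'M[k]_(rdim L p, rdim K p))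
   (io1 : forall p, 'M[k]_(rdim K' p, rdim L' p)) (g1 : forall p, 'M[k]_(rdim K p, rdim K' p))
   (e1 : forall p, 'cV[k]_(rdim L p)) (w1 : forall p, 'rV[k]_(rdim L' p)) :
   (forall p, (p < i)%N -> rdim L p = 0%N) ->
   rep_hom ro1 -> rep_hom io1 -> rep_hom g1 ->
   (forall p, (p < j)%N -> rmap L p *m e1 p.+1 = e1 p) ->
   (forall p, (i <= p)%N -> w1 p *m rmap L' p = w1 p.+1) ->
   (forall p, (j < p)%N -> w1 p = 0) ->
   rep_hom (fun p => ro1 p *m g1 p *m io1 p + e1 p *m w1 p).
  move=> dL hro1 hio1 hg1 eS1 wS1 w01 p.
  rewrite mulmxDl mulmxDr -[X in X + _]mulmxA hio1 -[X in X + _]mulmxA.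
  rewrite [g1 p *m _]mulmxA hg1 !mulmxA hro1; congr (_ + _).
  case: (ltnP p i) => [/dL dp|ip].
    by apply/matrixP => -[x xp]; exfalso; move: xp; rewrite dp.
  rewrite -mulmxA wS1 //; case: (ltnP p j) => pj; first by rewrite eS1.
  by rewrite w01 // !mulmx0.
exists (fun p => ro p *m g p *m io' p + e p *m w' p).
exists (fun p => ro' p *m g' p *m io p + e' p *m w p).
have inv (L L' K K' : rep k) (ro1 : forall p, 'M[k]_(rdim L p, rdim K p))
   (io1 : forall p, 'M[k]_(rdim K p, rdim L p))
   (ro2 : forall p, 'M[k]_(rdim L' p, rdim K' p))
   (io2 : forall p, 'M[k]_(rdim K' p, rdim L' p))
   (g1 : forall p, 'M[k]_(rdim K p, rdim K' p))
   (g2 : forall p, 'M[k]_(rdim K' p, rdim K p))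
   (e1 : forall p, 'cV[k]_(rdim L p)) (w1 : forall p, 'rV[k]_(rdim L p))
   (e2 : forall p, 'cV[k]_(rdim L' p)) (w2 : forall p, 'rV[k]_(rdim L' p)) :
   (forall p, (p < i)%N -> rdim L p = 0%N) ->
   (forall p, ro1 p *m io1 p + e1 p *m w1 p = 1%:M) ->
   (forall p, io2 p *m ro2 p = 1%:M) ->
   (forall p, io2 p *m e2 p = 0 /\ w2 p *m ro2 p = 0) ->
   (forall p, (j < p)%N -> e1 p = 0) ->
   (forall p, (i <= p)%N -> (p <= j)%N -> w2 p *m e2 p = 1%:M) ->
   (forall p, g1 p *m g2 p = 1%:M) ->
   forall p, (ro1 p *m g1 p *m io2 p + e1 p *m w2 p) *m
             (ro2 p *m g2 p *m io1 p + e2 p *m w1 p) = 1%:M.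
  move=> dL roio1 ioro2 ort2 e01 we2 gg p.
  rewrite mulmxDl !mulmxDr -roio1 !mulmxA.
  rewrite -(mulmxA _ (io2 p) (ro2 p)) ioro2 mulmx1 -(mulmxA _ (g1 p)) gg mulmx1.
  rewrite -(mulmxA _ (io2 p) (e2 p)) (ort2 p).1 mulmx0 mul0mx addr0.
  rewrite -(mulmxA _ (w2 p) (ro2 p)) (ort2 p).2 mulmx0 !mul0mx add0r; congr (_ + _).
  case: (ewP p) => [/dL dp|[jp|/andP[ip pj]]].
  - by apply/matrixP => -[x xp]; exfalso; move: xp; rewrite dp.
  - by rewrite e01 // !mul0mx.
  - by rewrite -(mulmxA _ (w2 p) (e2 p)) we2 // mulmx1.
split; first exact: hom; first exact: hom; exact: inv.
Qed.

Lemma rk_realized M : exists l : P, forall p q, (p <= q)%N -> rk M p q = R l p q.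
Proof.
suff [s sP] : exists s, forall p q, (p <= q)%N -> rk M p q = R s p q.
  exists (seq_mset s) => p q pq; rewrite sP // /R.
  by apply/esym; move: (perm_eq_seq_mset s) => /permP ->.
have [n] := ubnP (rtotal M); elim: n M => // n IHn M; rewrite ltnS => Mn.
case: (pselect (exists p, 0 < rdim M p)%N) => [ex|M0]; last first.
  exists [::] => p q _; apply/eqP; rewrite -leqn0; apply: leq_trans (rank_leq_row _) _.
  by rewrite leqNgt; apply/negP => ?; apply: M0; exists p.
have [i [j [dM rij rij1 ij]]] := corner ex.
have [M' [io [ro [e [w [[hio hro ioro roio ort] [wS eS w0 e0 we]]]]]]] :=
  split_rep dM rij rij1.
have rM' := split_rk dM hio hro ioro roio ort wS e0 we.
have [|s sP] := IHn M'.
  apply: leq_trans Mn; apply: rtotal_lt.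
    by move=> p; rewrite -!rk_id rM' // leq_addr.
  by exists i; rewrite -!rk_id rM' // leqnn ij addn1.
pose a : posroot := exist (fun x => (x.1 <= x.2)%N) (i, j) ij.
exists (a :: s) => p q pq.
rewrite rM' // sP // addnC.
by rewrite -[RHS]/(nat_of_bool (spans a p q) + R s p q)%N /spans pq.
Qed.

End Classification.

(** * Subrepresentations and rank functions *)

Section RowMaps.
Variable k : fieldType.

Definition mulv m n (A : 'M[k]_(m, n)) : 'Hom('rV[k]_m, 'rV[k]_n) :=
  linfun (mulmxr A).

Lemma mulvE m n (A : 'M[k]_(m, n)) v : mulv A v = v *m A.
Proof. by rewrite lfunE. Qed.

Lemma mulv_comp m n p (A : 'M[k]_(m, n)) (B : 'M[k]_(n, p)) :
  mulv (A *m B) = (mulv B \o mulv A)%VF.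
Proof. by apply/lfunP => v; rewrite comp_lfunE !mulvE mulmxA. Qed.

Lemma mulv_free m n (A : 'M[k]_(m, n)) : row_free A -> lker (mulv A) = 0%VS.
Proof.
move=> fA; apply/eqP/lker0P => u v; rewrite !mulvE; exact: row_free_inj.
Qed.

Lemma mulv_full m n (A : 'M[k]_(m, n)) : row_full A -> limg (mulv A) = fullv.
Proof.
move=> fA; apply/vspaceP => v; rewrite memvf; apply/memv_imgP.
by exists (v *m pinvmx A); rewrite ?memvf // mulvE -mulmxA mulVpmx ?mulmx1.
Qed.

Lemma dim_mulv m n (A : 'M[k]_(m, n)) : \dim (limg (mulv A)) = \rank A.
Proof.
rewrite -{1}(mulmx_base A) mulv_comp limg_comp mulv_full ?col_base_full //.
rewrite limg_dim_eq ?mulv_free ?row_base_free ?capv0 //.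
by rewrite dimvf /dim /= mul1n.
Qed.

Definition vmx n (U : {vspace 'rV[k]_n}) : 'M[k]_(\dim U, n) :=
  \matrix_i (vbasis U)`_i.

Lemma vmxP n (U : {vspace 'rV[k]_n}) v :
  reflect (exists w, v = w *m vmx U) (v \in U).
Proof.
apply: (iffP idP) => [vU|[w ->]].
  exists (\row_i coord (vbasis U) i v); rewrite mulmx_sum_row [LHS](coord_vbasis vU).
  by apply: eq_bigr => i _; rewrite rowK mxE.
rewrite mulmx_sum_row; apply: memv_suml => i _; rewrite rowK memvZ //.
by rewrite vbasis_mem // mem_nth // size_tuple.
Qed.

Lemma vmx_free n (U : {vspace 'rV[k]_n}) : row_free (vmx U).
Proof.
apply/row_freeP; exists (pinvmx (vmx U)); rewrite mulmxVp // -kermx_eq0.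
apply/rowV0P => w /sub_kermxP; rewrite mulmx_sum_row => w0.
apply/rowP => i; rewrite mxE; have /freeP := basis_free (vbasisP U).
move=> /(_ (fun i => w 0 i)); apply; rewrite -[RHS]w0.
by apply: eq_bigr => j _; rewrite rowK.
Qed.

End RowMaps.

Section Families.
Variable k : fieldType.
Implicit Types M N Q : rep k.

Definition fam M := forall p, {vspace 'rV[k]_(rdim M p)}.
Definition zfam M : fam M := fun=> 0%VS.
Definition ffam M : fam M := fun=> fullv.

Definition T M p q := mulv (pth M p q).

Definition stable M (U : fam M) := forall p q, (T M p q @: U p <= U q)%VS.

Lemma stableP M (U : fam M) : is_subrep U <-> stable U.
Proof.
split=> [sU p q|sU p v vU]; last first.
  apply: (subvP (sU p p.+1)); apply/memv_imgP; exists v => //.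
  by rewrite mulvE pth1.
apply/subvP => _ /memv_imgP[v vU ->]; rewrite mulvE.
case: (leqP p q) => [|qp]; last by rewrite pth_gt // mulmx0 mem0v.
elim: q => [|q IHq].
  by rewrite leqn0 => /eqP p0; subst p; rewrite pth_id mulmx1.
rewrite leq_eqVlt => /orP[/eqP <-|pq]; first by rewrite pth_id mulmx1.
by rewrite pthS // mulmxA; apply/sU/IHq.
Qed.

(* The rank function of the subquotient U / V. *)
Definition rkS M (U V : fam M) p q :=
  (\dim (T M p q @: U p + V q) - \dim (V q))%N.

Lemma rkS_full M p q : rkS (@ffam M) (@zfam M) p q = rk M p q.
Proof. by rewrite /rkS addv0 dimv0 subn0 dim_mulv. Qed.

Definition rhom M N (h : forall p, 'Hom('rV[k]_(rdim M p), 'rV[k]_(rdim N p))) :=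
  forall p q v, h q (T M p q v) = T N p q (h p v).

Lemma rhom_mulv M N (h : forall p, 'M[k]_(rdim M p, rdim N p)) :
  rep_hom h -> rhom (fun p => mulv (h p)).
Proof.
by move=> hh p q v; rewrite !mulvE -!mulmxA hom_pth.
Qed.

Definition imf M N (h : forall p, 'Hom('rV[k]_(rdim M p), 'rV[k]_(rdim N p)))
  (U : fam M) : fam N := fun p => (h p @: U p)%VS.

Lemma imf_T M N h (U : fam M) p q : @rhom M N h ->
  (T N p q @: imf h U p = h q @: (T M p q @: U p))%VS.
Proof.
move=> hh; rewrite /imf -!limg_comp; congr (_ @: _)%VS; apply/lfunP => v.
by rewrite !comp_lfunE hh.
Qed.

Lemma dim_img_ker (aT rT : vectType k) (f : 'Hom(aT, rT)) (U : {vspace aT}) :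
  (lker f <= U)%VS -> (\dim (f @: U) + \dim (lker f) = \dim U)%N.
Proof. by move=> /capv_idPr fU; rewrite -(limg_ker_dim f U) fU addnC. Qed.

(** Both dimensions drop by that of the kernel of [h q], since [V q] contains it. *)
Lemma rkS_imf M N h (U V : fam M) p q : @rhom M N h ->
  (lker (h q) <= V q)%VS -> rkS (imf h U) (imf h V) p q = rkS U V p q.
Proof.
move=> hh kV; rewrite /rkS imf_T // -limgD -(dim_img_ker kV).
rewrite -(@dim_img_ker _ _ (h q) (_ + _)%VS); last by rewrite (subv_trans kV) ?addvSr.
by rewrite subnDr.
Qed.

Lemma subrep_isomE M (U : fam M) N : subrep_isom U N -> exists2 h,
  @rhom N M h & (forall p, lker (h p) = 0%VS) /\ forall p, U p = imf h (@ffam N) p.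
Proof.
move=> [h [hh fh Uh]]; exists (fun p => mulv (h p)); first exact: rhom_mulv.
split=> p; first exact: mulv_free.
apply/vspaceP => v; apply/idP/memv_imgP => [/Uh[w ->]|[w _ ->]].
  by exists w; rewrite ?memvf ?mulvE.
by apply/Uh; exists w; rewrite mulvE.
Qed.

Lemma quotient_isomE M (U : fam M) Q : quotient_isom U Q -> exists2 h,
  @rhom M Q h & (forall p, limg (h p) = fullv) /\ forall p, U p = lker (h p).
Proof.
move=> [h [hh fh Uh]]; exists (fun p => mulv (h p)); first exact: rhom_mulv.
split=> p; first exact: mulv_full.
apply/vspaceP => v; rewrite memv_ker mulvE.
by apply/idP/eqP => [/Uh|/Uh].
Qed.

Lemma eq_rkS M (U U' V V' : fam M) p q : U p = U' p -> V q = V' q ->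
  rkS U V p q = rkS U' V' p q.
Proof. by rewrite /rkS => -> ->. Qed.

Lemma subrep_isom_rk M (U : fam M) N : subrep_isom U N ->
  forall p q, rkS U (@zfam M) p q = rk N p q.
Proof.
move=> /subrep_isomE[h hh [kh Uh]] p q.
rewrite -rkS_full -(rkS_imf _ _ hh) ?kh ?sub0v //.
by apply: eq_rkS; rewrite ?Uh // /imf limg0.
Qed.

Lemma quotient_isom_rk M (U : fam M) Q : quotient_isom U Q ->
  forall p q, rkS (@ffam M) U p q = rk Q p q.
Proof.
move=> /quotient_isomE[h hh [fh Uh]] p q.
rewrite -rkS_full -(rkS_imf _ _ hh) ?Uh //.
apply: eq_rkS; first exact: fh.
by rewrite /imf Uh; apply/eqP; rewrite -lkerE.
Qed.

Lemma sub_ex M (U : fam M) : stable U -> exists N, subrep_isom U N.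
Proof.
move=> sU; pose B p := vmx (U p).
have N0 p : (rbound M <= p)%N -> \dim (U p) = 0%N.
  move=> /rdim_eq0 dp; apply/eqP; rewrite -leqn0.
  by apply: leq_trans (dimvS (subvf (U p))) _; rewrite dimvf /dim /= dp muln0.
exists (Rep (fun p => B p *m rmap M p *m pinvmx (B p.+1)) N0), B; split.
- move=> p /=; rewrite mulmxKpV //; apply/row_subP => i; rewrite row_mul.
  apply/submxP; apply/vmxP; apply: (subvP (sU p p.+1)).
  apply/memv_imgP; exists (row i (B p)); last by rewrite mulvE pth1.
  by apply/vmxP; exists (delta_mx 0 i); rewrite -rowE.
- by move=> p; apply: vmx_free.
- by move=> p v; split=> /vmxP.
Qed.

Lemma quo_ex M (U : fam M) : stable U -> exists Q, quotient_isom U Q.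
Proof.
move=> sU; pose C p := cokermx (vmx (U p)); pose h p := col_base (C p).
have hU p v : v \in U p <-> v *m h p = 0.
  have -> : v \in U p = (v <= vmx (U p))%MS by apply/vmxP/submxP.
  rewrite submxE -/(C p) -{1}(mulmx_base (C p)) mulmxA mulmx_free_eq0 ?row_base_free //.
  by split=> /eqP.
have N0 p : (rbound M <= p)%N -> \rank (C p) = 0%N.
  by move=> /rdim_eq0 dp; apply/eqP; rewrite -leqn0 -[X in (_ <= X)%N]dp rank_leq_row.
have fh p : row_full (h p) by apply: col_base_full.
pose g p := pinvmx (h p).
have gh p : g p *m h p = 1%:M by apply: mulVpmx.
clearbody g h.
exists (Rep (fun p => g p *m rmap M p *m h p.+1) N0), h; split=> //.
move=> p /=; rewrite !mulmxA; apply/eqP; rewrite -subr_eq0; apply/eqP.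
(* The rows of [h p *m g p - 1] lie in [U p], which the arrow carries into [U p.+1], the kernel of
   [h p.+1]. *)
rewrite -!mulmxBl -{2}[rmap M p]mul1mx -mulmxBl.
apply/row_matrixP => i; rewrite row0 row_mul; apply/hU.
apply: (subvP (sU p p.+1)); apply/memv_imgP.
exists (row i (h p *m g p - 1%:M)); last by rewrite row_mul mulvE pth1.
apply/hU; rewrite -row_mul mulmxBl mul1mx -mulmxA gh.
by rewrite mulmx1 subrr row0.
Qed.

(** Since ranks classify representations, the isomorphism conditions in a Hall number become
    numerical conditions on U, here for the subrepresentation and in [quotientP] for the
    quotient. *)
Lemma subrepP M (U : fam M) N : stable U ->
  subrep_isom U N <-> (forall p q, (p <= q)%N -> rkS U (@zfam M) p q = rk N p q).
Proof.
move=> sU; split=> [/subrep_isom_rk r p q _ //|r].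
have [N' iN'] := sub_ex sU; have rN' := subrep_isom_rk iN'.
have [|g [g' [hg hg' gK gK']]] := @iso_rk _ N N'.
  by move=> p q pq; rewrite -r // rN'.
have [h [hh fh Uh]] := iN'; exists (fun p => g p *m h p); split.
- by move=> p; rewrite -mulmxA hh !mulmxA hg.
- move=> p; rewrite -row_leq_rank mxrankMfree // row_leq_rank.
  by apply/row_freeP; exists (g' p).
- move=> p v; split=> [/Uh[w ->]|[w ->]]; last by apply/Uh; exists (w *m g p); rewrite mulmxA.
  by exists (w *m g' p); rewrite !mulmxA -(mulmxA w) gK' mulmx1.
Qed.

Lemma quotientP M (U : fam M) Q : stable U ->
  quotient_isom U Q <-> (forall p q, (p <= q)%N -> rkS (@ffam M) U p q = rk Q p q).
Proof.
move=> sU; split=> [/quotient_isom_rk r p q _ //|r].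
have [Q' iQ'] := quo_ex sU; have rQ' := quotient_isom_rk iQ'.
have [|g [g' [hg hg' gK gK']]] := @iso_rk _ Q' Q.
  by move=> p q pq; rewrite -r // rQ'.
have [h [hh fh Uh]] := iQ'; exists (fun p => h p *m g p); split.
- by move=> p; rewrite -mulmxA hg !mulmxA hh.
- move=> p; rewrite -col_leq_rank (eqmxMfull _ (fh p)) col_leq_rank.
  by apply/row_fullP; exists (g' p).
- move=> p v; split=> [/Uh|]; first by rewrite mulmxA => ->; rewrite mul0mx.
  rewrite mulmxA => /(congr1 (mulmx^~ (g' p))) /=; rewrite -[LHS]mulmxA gK mulmx1 mul0mx.
  by move/Uh.
Qed.

End Families.

(** Inclusion and exclusion: the intervals equal to [i, j] are those containing [i, j] but extending
    neither to i - 1 nor to j + 1. The identity is arranged without subtraction, and the factor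
    [(0 < i)] removes the terms of a vertex that does not exist. *)
Lemma count_root (a : posroot) (s : seq posroot) :
  let i := (val a).1 in let j := (val a).2 in
  (count_mem a s + ((0 < i) * R s i.-1 j + R s i j.+1) =
   R s i j + (0 < i) * R s i.-1 j.+1)%N.
Proof.
case: a => -[i j] /= ij; elim: s => [|[[p q] /= pq] s IHs].
  by rewrite /R /= !muln0.
rewrite /R /= -/(R s i.-1 j) -/(R s i j) -/(R s i.-1 j.+1) -/(R s i j.+1).
have -> : (exist (fun x => (x.1 <= x.2)%N) (p, q) pq == exist _ (i, j) ij :> posroot)
    = (p == i) && (q == j) by [].
rewrite /spans /=.
suff : ((p == i) && (q == j) + ((0 < i) * [&& p <= i.-1, i.-1 <= j & j <= q]
    + [&& p <= i, i <= j.+1 & j.+1 <= q])%N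
  = [&& p <= i, i <= j & j <= q] + (0 < i) * [&& p <= i.-1, i.-1 <= j.+1 & j.+1 <= q])%N.
  by rewrite !mulnDr; lia.
case: i ij {IHs} => [|i] ij /=; rewrite ?mul0n ?mul1n; lia.
Qed.

Lemma R_inj (l m : P) :
  (forall p q, (p <= q)%N -> R l p q = R m p q) -> l = m.
Proof.
move=> lm; apply/msetP => a; rewrite -!count_mem_mset.
have := count_root a l; have := count_root a m; case: a => -[i j] /= ij.
rewrite !lm ?(leqW ij) ?(leq_trans (leq_pred i)) ?(leqW ij) //.
by move=> E1 E2; apply: (@addIn ((0 < i) * R m i.-1 j + R m i j.+1)%N); rewrite [LHS]E2 [RHS]E1.
Qed.

Lemma R_msetD (l m : P) p q : R (l `+` m)%mset p q = (R l p q + R m p q)%N.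
Proof.
rewrite /R -count_cat; apply/permP/allP => a _ /=.
rewrite count_cat !count_mem_mset; apply/eqP.
by rewrite msetE2.
Qed.

Lemma R_mset0 p q : R (mset0 : P) p q = 0%N.
Proof. by rewrite enum_mset0. Qed.

Lemma R_mset1 a p q : R ([mset a] : P)%mset p q = spans a p q.
Proof. by rewrite enum_msetn /R /= addn0. Qed.

(** * Counting families of subspaces over a finite field *)

Section Counting.
Variable k : finFieldType.
Implicit Types M N Q : rep k.

Section FiniteVspace.
Import VectorInternalTheory.
HB.instance Definition _ (vT : vectType k) := [Countable of {vspace vT} by <:].
HB.instance Definition _ (vT : vectType k) := [Finite of {vspace vT} by <:].
End FiniteVspace.

(** All spaces beyond [rbound M] are zero, so a family is determined by finitely many members. This
    finite type is what is actually counted; [ext] and [res] are inverse bijections. *)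
Definition bfam M := {dffun forall p : 'I_(rbound M), {vspace 'rV[k]_(rdim M p)}}.

Definition ext M (F : bfam M) : fam M := fun p =>
  match decP (@idP (p < rbound M)%N) with
  | left pM => F (Ordinal pM)
  | right _ => 0%VS
  end.

Definition res M (U : fam M) : bfam M := [ffun p : 'I_(rbound M) => U p].

Lemma resK M (U : fam M) : ext (res U) = U.
Proof.
apply: functional_extensionality_dep => p; rewrite /ext.
case: (decP (@idP (p < rbound M)%N)) => [pM|]; first by rewrite ffunE.
move=> /negP; rewrite -leqNgt => /rdim_eq0 dp.
apply/vspaceP => v; suff -> : v = 0 by rewrite !mem0v.
by apply/rowP => -[x xp]; exfalso; move: xp; rewrite dp.
Qed.

Lemma extK M : cancel (@ext M) (@res M).
Proof.
move=> F; apply/ffunP => p; rewrite ffunE /ext.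
case: (decP (@idP (p < rbound M)%N)) => [pM|nP]; last by case: nP; apply: ltn_ord.
by case: p pM => p pp pM; rewrite (bool_irrelevance pM pp).
Qed.

Definition cnt M (A : fam M -> Prop) : nat :=
  #|[set F : bfam M | `[< A (ext F) >]]|.

Lemma cnt_le M N (A : fam M -> Prop) (B : fam N -> Prop) (f : fam M -> fam N)
    (g : fam N -> fam M) :
  (forall U, A U -> B (f U)) -> (forall U, A U -> g (f U) = U) ->
  (cnt A <= cnt B)%N.
Proof.
move=> AB fK; rewrite /cnt.
rewrite -(@card_in_imset _ _ (fun F => res (f (ext F)))) => [|F G].
  apply: subset_leq_card; apply/fintype.subsetP => _ /imsetP[F FA ->].
  by move: FA; rewrite !inE resK; apply: AB.
rewrite !inE => AF AG /(congr1 (@ext N)).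
by rewrite !resK => /(congr1 g); rewrite (fK _ AF) (fK _ AG) => /(can_inj (@extK M)).
Qed.

Lemma cnt_bij M N (A : fam M -> Prop) (B : fam N -> Prop) f g :
  (forall U, A U -> B (f U)) -> (forall V, B V -> A (g V)) ->
  (forall U, A U -> g (f U) = U) -> (forall V, B V -> f (g V) = V) ->
  cnt A = cnt B.
Proof.
move=> AB BA fK gK; apply/eqP; rewrite eqn_leq.
by rewrite (cnt_le AB fK) (cnt_le BA gK).
Qed.

Lemma eq_cnt M (A B : fam M -> Prop) : (forall U, A U <-> B U) -> cnt A = cnt B.
Proof. by move=> AB; apply: (@cnt_bij _ _ _ _ id id) => // U /AB. Qed.

Lemma cnt0 M (A : fam M -> Prop) : (forall U, ~ A U) -> cnt A = 0%N.
Proof.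
by move=> A0; apply: eq_card0 => F; rewrite inE; apply/asboolP/A0.
Qed.

Lemma cnt1 M (A : fam M -> Prop) U : A U -> (forall V, A V -> V = U) -> cnt A = 1%N.
Proof.
move=> AU A1; apply/eqP/cards1P; exists (res U); apply/setP => F.
rewrite !inE; apply/asboolP/eqP => [/A1 <-|->]; first by rewrite extK.
by rewrite resK.
Qed.

Lemma cnt_sum M (A : fam M -> Prop) :
  cnt A = (\sum_(F : bfam M) `[< A (ext F) >])%N.
Proof. by rewrite /cnt cardsE -sum1_card big_mkcond; apply: eq_bigr. Qed.

Lemma cnt_exchange M N (A : fam M -> fam N -> Prop) :
  (\sum_(F : bfam M) cnt (A (ext F)) =
   \sum_(G : bfam N) cnt (fun U => A U (ext G)))%N.
Proof.
under eq_bigr => F _ do rewrite cnt_sum.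
by rewrite exchange_big; apply: eq_bigr => G _; rewrite cnt_sum.
Qed.

(** Sorts the families in X by type; the weight of a family depends on its type only, and S has to
    contain every type that occurs. *)
Lemma cnt_types M (S : seq P) (X : fam M -> Prop) (ty : fam M -> P -> Prop)
    (g : P -> nat) (w : fam M -> nat) : uniq S ->
  (forall U, X U -> exists2 m, m \in S & ty U m) ->
  (forall U m n, ty U m -> ty U n -> m = n) ->
  (forall U m, X U -> ty U m -> w U = g m) ->
  (forall U, ~ X U -> w U = 0%N) ->
  (\sum_(m <- S) g m * cnt (fun U => X U /\ ty U m) =
   \sum_(F : bfam M) w (ext F))%N.
Proof.
move=> uS ex un wg w0.
under eq_bigr => m _ do rewrite cnt_sum big_distrr /=.
rewrite exchange_big; apply: eq_bigr => F _ /=.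
case: (pselect (X (ext F))) => XF; last first.
  rewrite w0 // big1 // => m _; rewrite (_ : `[< _ >] = false) ?muln0 //.
  by apply/asboolP => -[].
have [m mS tm] := ex _ XF; rewrite (bigD1_seq m) //= big1 => [|n nm].
  by rewrite (wg _ _ XF tm) (_ : `[< _ >] = true) ?muln1 ?addn0 //; apply/asboolP.
rewrite (_ : `[< _ >] = false) ?muln0 //; apply/asboolP => -[_ tn].
by move: nm; rewrite (un _ _ _ tm tn) eqxx.
Qed.

End Counting.

(** * Hall numbers over a finite field *)

Section Boxes.

Lemma R_gt0 (s : seq posroot) a p q : a \in s -> spans a p q -> (0 < R s p q)%N.
Proof. by move=> sa apq; rewrite -has_count; apply/hasP; exists a. Qed.

Lemma R_bound (s : seq posroot) : exists B, forall p q, (B <= q)%N -> R s p q = 0%N.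
Proof.
elim: s => [|a s [B sB]]; first by exists 0%N.
exists (maxn (val a).2.+1 B) => p q; rewrite geq_max => /andP[aq Bq].
by rewrite /R /= -/(R s p q) sB // /spans [X in [&& _, _ & X]]leqNgt aq !andbF.
Qed.

Lemma size_R (s : seq posroot) B : (forall a, a \in s -> (val a).2 < B)%N ->
  (size s <= \sum_(p < B) R s p p)%N.
Proof.
elim: s => [|a s IHs] sB; first by [].
have sE p : R (a :: s) p p = (spans a p p + R s p p)%N by [].
under eq_bigr => p _ do rewrite sE.
rewrite big_split /= -add1n; apply: leq_add; last first.
  by apply: IHs => b bs; apply: sB; rewrite inE bs orbT.
have aB : ((val a).2 < B)%N by apply: sB; rewrite mem_head.
by rewrite (bigD1 (Ordinal aB)) //= /spans leqnn (valP a).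
Qed.

Fixpoint words (rs : seq posroot) n : seq (seq posroot) :=
  if n is n'.+1 then [::] :: [seq a :: s | a <- rs, s <- words rs n'] else [:: [::]].

Lemma mem_words rs n s : (size s <= n)%N -> {subset s <= rs} -> s \in words rs n.
Proof.
elim: n s => [|n IHn] [|a s] //= sn srs; rewrite inE; apply/orP; right.
apply/allpairsP; exists (a, s); split=> //=; first by apply: srs; rewrite mem_head.
by apply: IHn => // b bs; apply: srs; rewrite inE bs orbT.
Qed.

(** A finite range for all sums over types. The size of m is at most its total dimension, and its
    roots end below the bound of l, so m is a word of bounded length in finitely many letters. *)
Lemma box_ex (l : P) : exists2 S : seq P, uniq S &
  forall m : P, (forall p, R m p p <= R l p p)%N -> m \in S.
Proof.
have [B lB] := R_bound l.
pose rs : seq posroot :=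
  pmap insub [seq (i, j) | i <- iota 0 B, j <- iota 0 B].
exists (undup [seq seq_mset s | s <- words rs (\sum_(p < B) R l p p)%N]) => [|m lm].
  exact: undup_uniq.
rewrite mem_undup; apply/mapP; exists (m : seq posroot); last first.
  by rewrite seq_mset_id.
have mB a : a \in (m : seq posroot) -> ((val a).2 < B)%N.
  move=> am; rewrite ltnNge; apply/negP => /lB l0; have := lm (val a).2.
  rewrite l0 leqNgt (R_gt0 am) // /spans leqnn andbT /= (valP a) //.
apply: mem_words.
  by apply: leq_trans (size_R mB) _; apply: leq_sum => p _; apply: lm.
move=> a am; rewrite mem_pmap; apply/mapP; exists (val a); last by rewrite valK.
apply/allpairsP; exists (val a); rewrite !mem_iota /= !add0n; split.
- exact: leq_ltn_trans (valP a) (mB _ am).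
- exact: mB.
- by case: (val a).
Qed.

End Boxes.

Section HallNumbers.
Variable k : finFieldType.
Implicit Types M N Q : rep k.

Definition typ M (U V : fam M) (s : P) :=
  forall p q, (p <= q)%N -> rkS U V p q = R s p q.

Definition hallset M (a b : P) (U : fam M) :=
  [/\ stable U, typ U (@zfam _ M) b & typ (@ffam _ M) U a].

Definition hall (a b l : P) := cnt (@hallset (Mrep k l) a b).

Definition pref M N (h : forall p, 'Hom('rV[k]_(rdim M p), 'rV[k]_(rdim N p)))
  (W : fam N) : fam M := fun p => (h p @^-1: W p)%VS.

Lemma imf_pref M N h (W : fam N) : (forall p, W p <= limg (h p))%VS ->
  imf h (@pref M N h W) = W.
Proof.
by move=> Wh; apply: functional_extensionality_dep => p; rewrite /imf /pref lpreimK ?Wh.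
Qed.

Lemma pref_imf M N h (W : fam M) : (forall p, lker (h p) <= W p)%VS ->
  pref h (@imf _ M N h W) = W.
Proof.
move=> Wh; apply: functional_extensionality_dep => p; apply/vspaceP => v.
rewrite /pref -memv_preim; apply/memv_imgP/idP => [[w wW vw]|vW]; last by exists v.
have : v - w \in lker (h p) by rewrite memv_ker linearB /= vw subrr.
by move=> /(subvP (Wh p)) vw'; rewrite -(subrK w v) memvD.
Qed.

Lemma stable_pref M N h (W : fam N) : @rhom _ M N h ->
  (forall p, W p <= limg (h p))%VS -> stable (pref h W) <-> stable W.
Proof.
move=> hh Wh; split=> sW p q; last first.
  apply/subvP => _ /memv_imgP[v vW ->]; rewrite -memv_preim hh.
  by apply: (subvP (sW p q)); rewrite memv_img // memv_preim.
by rewrite -(imf_pref Wh) imf_T // limgS.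
Qed.

(** The correspondence theorem: subspaces of the image of h match subspaces containing its kernel.
    Injective h serves for subrepresentations of a subrepresentation, surjective h for those of a
    quotient. *)
Lemma cnt_hom M N h (A : fam N -> Prop) (B : fam M -> Prop) :
  (forall W, A W -> forall p, W p <= limg (h p))%VS ->
  (forall W, B W -> forall p, lker (h p) <= W p)%VS ->
  (forall W, (forall p, W p <= limg (h p))%VS -> A W <-> B (@pref M N h W)) ->
  cnt A = cnt B.
Proof.
move=> Ah Bh AB; apply: (cnt_bij (f := pref h) (g := imf h)).
- by move=> U AU; apply/AB => //; apply: Ah.
- move=> V BV; apply/AB; last by rewrite pref_imf //; apply: Bh.
  by move=> p; rewrite /imf limgS ?subvf.
- by move=> U /Ah; apply: imf_pref.
- by move=> V /Bh; apply: pref_imf.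
Qed.

Definition chain M (a b c : P) (U V : fam M) :=
  [/\ stable U /\ stable V, (forall p, V p <= U p)%VS, typ V (@zfam _ M) c,
      typ U V b & typ (@ffam _ M) U a].

Lemma cnt_chain_sub M (a b c m : P) (U : fam M) :
  stable U -> typ (@ffam _ M) U a -> typ U (@zfam _ M) m ->
  cnt (chain a b c U) = hall b c m.
Proof.
move=> sU fU tU.
have /subrep_isomE[h hh [kh Uh]] : subrep_isom U (Mrep k m).
  by apply/subrepP => // p q pq; rewrite rk_Mrep tU.
apply: (cnt_hom (h := h)).
- by move=> W [_ WU _ _ _] p; rewrite (subv_trans (WU p)) // Uh.
- by move=> W _ p; rewrite kh sub0v.
move=> W Wh; have sWE := stable_pref hh Wh; rewrite /chain /hallset.
have E1 p q : rkS W (@zfam _ M) p q = rkS (pref h W) (@zfam _ _) p q.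
  rewrite -(rkS_imf _ _ hh) ?kh ?sub0v // imf_pref //.
  by apply: eq_rkS => //; rewrite /imf limg0.
have E2 p q : rkS U W p q = rkS (@ffam _ _) (pref h W) p q.
  rewrite -(rkS_imf _ _ hh) ?kh ?sub0v // imf_pref //; exact: eq_rkS.
split=> [[[_ sW] WU tW tUW _]|[sW tW tUW]].
  by split=> [|p q pq|p q pq]; [apply/sWE | rewrite -E1 tW | rewrite -E2 tUW].
split=> //; [by split=> //; apply/sWE | by move=> p; rewrite Uh | |].
- by move=> p q pq; rewrite E1 tW.
- by move=> p q pq; rewrite E2 tUW.
Qed.

Lemma cnt_chain_quo M (a b c n : P) (V : fam M) :
  stable V -> typ V (@zfam _ M) c -> typ (@ffam _ M) V n ->
  cnt (fun U => chain a b c U V) = hall a b n.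
Proof.
move=> sV zV tV.
have /quotient_isomE[h hh [fh Vh]] : quotient_isom V (Mrep k n).
  by apply/quotientP => // p q pq; rewrite rk_Mrep tV.
apply/esym/(cnt_hom (h := h)).
- by move=> W _ p; rewrite fh subvf.
- by move=> W [_ VW _ _ _] p; rewrite -Vh VW.
move=> W Wh; have sWE := stable_pref hh Wh; rewrite /chain /hallset.
have kW p : (lker (h p) <= pref h W p)%VS by rewrite -lpreim0 lpreimS ?sub0v.
have E1 p q : rkS W (@zfam _ _) p q = rkS (pref h W) V p q.
  rewrite -(rkS_imf _ _ hh) ?Vh // imf_pref //.
  by apply: eq_rkS => //; apply/esym/eqP; rewrite /imf Vh -lkerE.
have E2 p q : rkS (@ffam _ _) W p q = rkS (@ffam _ _) (pref h W) p q.
  rewrite -[RHS](rkS_imf _ _ hh) // imf_pref //; apply: eq_rkS => //.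
  by rewrite /imf fh.
split=> [[sW tW tUW]|[[sW _] WU _ tW tUW]].
  split=> //; [by split=> //; apply/sWE | by move=> p; rewrite Vh kW | |].
  - by move=> p q pq; rewrite -E1 tW.
  - by move=> p q pq; rewrite -E2 tUW.
by split=> [|p q pq|p q pq]; [apply/sWE | rewrite E1 tW | rewrite E2 tUW].
Qed.

Lemma typ_inj M (U V : fam M) (m n : P) : typ U V m -> typ U V n -> m = n.
Proof. by move=> tm tn; apply: R_inj => p q pq; rewrite -tm // tn. Qed.

Lemma typ_sub M (U : fam M) : stable U -> exists m, typ U (@zfam _ M) m.
Proof.
move=> sU; have [N iN] := sub_ex sU; have [m Nm] := rk_realized N.
by exists m => p q pq; rewrite (subrep_isom_rk iN) Nm.
Qed.

Lemma typ_quo M (U : fam M) : stable U -> exists m, typ (@ffam _ M) U m.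
Proof.
move=> sU; have [N iN] := quo_ex sU; have [m Nm] := rk_realized N.
by exists m => p q pq; rewrite (quotient_isom_rk iN) Nm.
Qed.

Lemma hall_neq0 (a b l : P) U : @hallset (Mrep k l) a b U -> hall a b l <> 0%N.
Proof.
move=> hU; suff : (0 < hall a b l)%N by case: (hall a b l).
rewrite -(@cnt1 k (Mrep k l) (fun V => V = U) U) //.
by apply: (@cnt_le k _ _ _ _ id id) => // V ->.
Qed.

Lemma hall_eq0 (a b l : P) : (forall U, ~ @hallset (Mrep k l) a b U) ->
  hall a b l = 0%N.
Proof. exact: cnt0. Qed.

Lemma hallP (a b l : P) : hall a b l <> 0%N -> exists U, @hallset (Mrep k l) a b U.
Proof.
move=> h0; apply: contrapT => nU; apply: h0; apply: cnt0 => U hU; apply: nU.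
by exists U.
Qed.

(** Both sides count the flags V <= U in M(l) with subquotients of types c, b, a. The left side
    groups them by the type m of U, the right side by the type n of M(l) / V. *)
Lemma hall_assoc (a b c l : P) (S S' : seq P) : uniq S -> uniq S' ->
  (forall m, hall a m l <> 0%N -> m \in S) ->
  (forall n, hall n c l <> 0%N -> n \in S') ->
  (\sum_(m <- S) hall b c m * hall a m l =
   \sum_(n <- S') hall a b n * hall n c l)%N.
Proof.
move=> uS uS' hS hS'; pose M := Mrep k l.
transitivity (\sum_(F : bfam M) cnt (chain a b c (ext F)))%N.
  rewrite -(@cnt_types _ _ S (fun U => stable U /\ typ (@ffam _ M) U a)
    (fun U m => typ U (@zfam _ M) m) (hall b c) (fun U => cnt (chain a b c U))) //.
  - apply: eq_bigr => m _; congr (_ * _)%N; apply: eq_cnt => U.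
    by split=> [[]|[[]]].
  - move=> U [sU fU]; have [m tm] := typ_sub sU; exists m => //.
    by apply: hS; apply: (@hall_neq0 a m l U).
  - by move=> U m n; apply: typ_inj.
  - by move=> U m [sU fU] tm; apply: cnt_chain_sub.
  - by move=> U nU; apply: cnt0 => V [[sU _] _ _ _ fU]; apply: nU.
rewrite cnt_exchange.
rewrite -(@cnt_types _ _ S' (fun V => stable V /\ typ V (@zfam _ M) c)
  (fun V n => typ (@ffam _ M) V n) (hall a b) (fun V => cnt (fun U => chain a b c U V))) //.
- apply: eq_bigr => m _; congr (_ * _)%N; apply: eq_cnt => U.
  by split=> [[[]]|[]].
- move=> V [sV zV]; have [n tn] := typ_quo sV; exists n => //.
  by apply: hS'; apply: (@hall_neq0 n c l V).
- by move=> U m n; apply: typ_inj.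
- by move=> V m [sV zV] tm; apply: cnt_chain_quo.
- by move=> V nV; apply: cnt0 => U [[_ sV] _ zV _ _]; apply: nV.
Qed.

End HallNumbers.

(** * The order on positive roots *)

Section RootOrder.
Implicit Types (a b c x : posroot) (l m : P).

Definition rlt x b :=
  ((val x).2 < (val b).2)%N || ((val x).2 == (val b).2) && ((val x).1 < (val b).1)%N.

Definition below b m := forall c, c \in m -> rlt c b.

Lemma mset_split c m : c \in m -> exists m', m = ([mset c] `+` m')%mset.
Proof. by move=> cm; exists (m `\ c)%mset; rewrite msetB1K. Qed.

Lemma R_eq0 m : (forall p, R m p p = 0%N) -> m = mset0.
Proof.
move=> m0; apply/msetP => c; rewrite mset0E; apply/mset_eq0P/negP => cm.
have := @R_gt0 m c (val c).1 (val c).1 cm.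
by rewrite m0 /spans leqnn (valP c) => /(_ isT).
Qed.

Lemma R_le_diag m p q : (p <= q)%N -> (R m p q <= R m q q)%N.
Proof.
move=> pq; apply: sub_count => c; rewrite /spans => /and3P[cp _ qc].
by rewrite leqnn qc (leq_trans cp).
Qed.

Lemma R_span m p q : (0 < R m p q)%N -> exists2 c, c \in m & spans c p q.
Proof. by rewrite -has_count => /hasP[c cm cpq]; exists c. Qed.

(** A root of m that covers b is supported where b is, hence equals b, and no dimension is left for
    a second root. *)
Lemma mset_root b m : (forall p, R m p p = spans b p p) ->
  (0 < R m (val b).1 (val b).2)%N -> m = [mset b]%mset.
Proof.
move=> mb /R_span[c cm /and3P[c1 _ c2]].
have c12 := valP c.
have b1 : spans b (val c).1 (val c).1.
  have : (0 < R m (val c).1 (val c).1)%N.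
    by apply: (R_gt0 cm); rewrite /spans !leqnn c12.
  by rewrite mb lt0b.
have b2 : spans b (val c).2 (val c).2.
  have : (0 < R m (val c).2 (val c).2)%N.
    by apply: (R_gt0 cm); rewrite /spans !leqnn c12.
  by rewrite mb lt0b.
have cb : c = b.
  apply: val_inj; move: b1 b2 c1 c2; rewrite /spans.
  by case: (val c) => ? ?; case: (val b) => ? ? /=; move=> *; congr pair; lia.
subst c; have [m' mE] := mset_split cm; rewrite mE (_ : m' = mset0) ?msetD0 //.
apply: R_eq0 => p; have := mb p; rewrite mE R_msetD R_mset1.
by move/eqP; rewrite -[X in _ == X]addn0 eqn_add2l => /eqP.
Qed.

(** For b = [i, j] the two conditions say that nothing lives past j and that the map from vertex i -
    1 to vertex j is onto: every root ending at j starts before i. In this form the property passes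
    to extensions. *)
Lemma belowP b m : below b m <->
  (forall q, ((val b).2 < q)%N -> R m q q = 0%N) /\
  (R m (val b).2 (val b).2 = (0 < (val b).1) * R m (val b).1.-1 (val b).2)%N.
Proof.
split=> [bm|[mq mj] c cm]; last first.
  have c12 := valP c; have b12 := valP b.
  have cq q : ((val c).1 <= q <= (val c).2)%N -> (0 < R m q q)%N.
    by move=> /andP[cq qc]; apply: (R_gt0 cm); rewrite /spans cq qc leqnn.
  have c2 : ((val c).2 <= (val b).2)%N.
    rewrite leqNgt; apply/negP => bc; have := cq (val c).2.
    by rewrite mq // leqnn c12 => /(_ isT).
  rewrite /rlt; case: ltngtP c2 => //= cb _; rewrite ltnNge; apply/negP => bc1.
  have [m' mE] := mset_split cm; move: mj; rewrite mE !R_msetD !R_mset1.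
  have -> : spans c (val b).2 (val b).2 = true by rewrite /spans cb leqnn -cb c12.
  case: (posnP (val b).1) => [//|b1]; rewrite mul1n.
  rewrite [spans c (val b).1.-1 _](_ : _ = false); last first.
    by rewrite /spans leqNgt (leq_trans _ bc1) // prednK.
  have := @R_le_diag m' (val b).1.-1 (val b).2; lia.
split=> [q bq|].
  apply/eqP; rewrite -leqn0 leqNgt; apply/negP => /R_span[c /bm].
  by rewrite /rlt /spans; lia.
case: posnP => [b0|b1].
  rewrite mul0n; apply/eqP; rewrite -leqn0 leqNgt; apply/negP => /R_span[c /bm].
  by rewrite /rlt /spans b0; lia.
rewrite mul1n; apply: eq_in_count => c /bm; have b12 := valP b.
by rewrite /rlt /spans; lia.
Qed.

(** If both roots end at the same vertex, the root of l covering x is x itself, and l is the direct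
    sum. Otherwise some root of l covers b: if b belongs to l, the rest is x; if not, the covering
    root starts before b and is the only one reaching the end of b, so that l is below b. *)
Lemma R_simple_ext (x b : posroot) l : rlt x b ->
  (forall p, R l p p = spans x p p + spans b p p)%N ->
  (forall p q, p <= q -> spans x p q + spans b p q <= R l p q)%N ->
  l = ([mset x] `+` [mset b])%mset \/ below b l.
Proof.
move=> xb ld lr; have x12 := valP x; have b12 := valP b.
have main c d : c \in l -> c != d -> (forall p, R l p p = spans c p p + spans d p p)%N ->
    (forall p q, p <= q -> spans c p q + spans d p q <= R l p q)%N ->
    l = ([mset c] `+` [mset d])%mset.
  move=> cl cd lcd lcdr; have [m' mE] := mset_split cl.
  rewrite mE; congr (_ `+` _)%mset; apply: mset_root.
    by move=> p; have := lcd p; rewrite mE R_msetD R_mset1 => /addnI.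
  have := lcdr _ _ (valP d); rewrite mE R_msetD R_mset1 leq_add2l.
  by apply: leq_trans; rewrite /spans !leqnn (valP d).
have xnb : x != b by apply/eqP => xb'; move: xb; rewrite xb' /rlt !ltnn andbF.
case: (eqVneq (val x).2 (val b).2) => [x2|x2].
  left; have := lr _ _ x12; rewrite {1}/spans !leqnn x12 /=.
  move=> /(leq_trans (leq_addr _ _)) /R_span[c cl cx].
  suff cE : c = x by subst c; apply: main.
  have c12 := valP c.
  have cq q : ((val c).1 <= q <= (val c).2)%N -> (0 < R l q q)%N.
    by move=> /andP[cq qc]; apply: (R_gt0 cl); rewrite /spans cq qc leqnn.
  have := cq (val c).1; have := cq (val c).2; rewrite !ld !leqnn c12.
  move=> /(_ isT) h2 /(_ isT) h1.
  apply: val_inj; move: xb cx h1 h2 c12 x12 x2; rewrite /rlt /spans.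
  by rewrite /=; case: (sval c) => ? ?; case: (sval x) => ? ? /=; move=> *; congr pair; lia.
have xb2 : ((val x).2 < (val b).2)%N by move: xb x2; rewrite /rlt; lia.
case: (boolP (b \in l)) => bl.
  left; rewrite msetDC; apply: main => //; first by rewrite eq_sym.
    by move=> p; rewrite addnC.
  by move=> p q; rewrite addnC; apply: lr.
right => c cl; have c12 := valP c.
have := lr _ _ b12; rewrite {2}/spans !leqnn b12 /=.
move=> /(leq_trans (leq_addl _ _)) /R_span[d dl db].
have c2 : ((val c).2 <= (val b).2)%N.
  rewrite leqNgt; apply/negP => bc.
  have : (0 < R l (val c).2 (val c).2)%N by apply: (R_gt0 cl); rewrite /spans !leqnn c12.
  by rewrite ld /spans; lia.
rewrite /rlt; case: ltngtP c2 => //= cb _.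
have [l' lE] := mset_split dl.
have d2 : spans d (val b).2 (val b).2 by move: db b12; rewrite /spans /= => /and3P[d1 ij jd] _; rewrite leqnn jd (leq_trans d1 ij).
have l'0 : R l' (val b).2 (val b).2 = 0%N.
  have := ld (val b).2; rewrite lE R_msetD R_mset1 d2.
  by rewrite /spans; lia.
have cd : c = d.
  apply/eqP; move: cl; rewrite lE in_msetD in_mset1 => /orP[//|cl'].
  have : (0 < R l' (val b).2 (val b).2)%N by apply: (R_gt0 cl'); rewrite /spans cb leqnn -cb c12.
  by rewrite l'0.
subst d; move: db; rewrite /spans => /and3P[cb1 _ _].
rewrite ltn_neqAle cb1 andbT; apply: contra bl => /eqP c1.
suff -> : b = c by [].
apply: val_inj; move: c1 cb => /=; case: (sval c) => ? ?; case: (sval b) => ? ? /=.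
by move=> -> ->.
Qed.

End RootOrder.

(** * Indecomposable quotients *)

Section Extensions.
Variable k : fieldType.
Implicit Types M : rep k.

Lemma dim_rV n : \dim (fullv : {vspace 'rV[k]_n}) = n.
Proof. by rewrite dimvf /dim /= mul1n. Qed.

Lemma rkS_sub M (U : fam M) p q : rkS U (@zfam _ M) p q = \dim (T M p q @: U p).
Proof. by rewrite /rkS addv0 dimv0 subn0. Qed.

Lemma rkS_quo M (U : fam M) p q :
  rkS (@ffam _ M) U p q = (\dim (limg (T M p q) + U q) - \dim (U q))%N.
Proof. by []. Qed.

Lemma rk_dim M p q : rk M p q = \dim (limg (T M p q)).
Proof. by rewrite dim_mulv. Qed.

(** The rank of M exceeds that of the quotient by the dimension of [limg (T M p q) :&: U q], which
    contains the image of [U p]. Equality of these two spaces is the hypothesis of [rk_ext_eq]. *)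
Lemma rk_ext_le M (U : fam M) p q : stable U ->
  (rkS (@ffam _ M) U p q + rkS U (@zfam _ M) p q <= rk M p q)%N.
Proof.
move=> sU; rewrite rkS_sub rk_dim rkS_quo -(leq_add2r (\dim (U q))).
rewrite addnAC subnK ?dimvS ?addvSr // -[X in (_ <= X)%N]dimv_sum_cap leq_add2l.
by apply: dimvS; rewrite subv_cap limgS ?subvf //=.
Qed.

Lemma rk_ext_eq M (U : fam M) p q :
  (limg (T M p q) :&: U q <= T M p q @: U p)%VS -> stable U ->
  rk M p q = (rkS (@ffam _ M) U p q + rkS U (@zfam _ M) p q)%N.
Proof.
move=> le sU; apply/eqP; rewrite eqn_leq rk_ext_le // andbT.
rewrite rkS_sub rk_dim rkS_quo -(leq_add2r (\dim (U q))).
by rewrite addnAC subnK ?dimvS ?addvSr // -[X in (X <= _)%N]dimv_sum_cap leq_add2l dimvS.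
Qed.

Lemma T_id M p : T M p p = \1%VF.
Proof. by apply/lfunP => v; rewrite mulvE pth_id mulmx1 lfunE. Qed.

Lemma rk_ext_diag M (U : fam M) p : stable U ->
  rk M p p = (rkS (@ffam _ M) U p p + rkS U (@zfam _ M) p p)%N.
Proof. by move=> sU; apply: rk_ext_eq => //; rewrite T_id !lim1g capfv. Qed.

Lemma rkS_diag M (U : fam M) p :
  rkS (@ffam _ M) U p p = (rdim M p - \dim (U p))%N.
Proof. by rewrite rkS_quo T_id lim1g (addv_idPl (subvf _)) dim_rV. Qed.

Lemma dim_fam M (U : fam M) p : (\dim (U p) <= rdim M p)%N.
Proof. by apply: leq_trans (dimvS (subvf _)) _; rewrite dim_rV. Qed.

Lemma typ_full M (U : fam M) p : rkS (@ffam _ M) U p p = 0%N -> U p = fullv.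
Proof.
move=> r0; apply/eqP; rewrite eqEdim subvf /= dim_rV.
by move: r0; rewrite rkS_diag => /eqP; rewrite subn_eq0.
Qed.

Lemma T_comp M p q t v : (p <= q)%N -> (q <= t)%N -> T M q t (T M p q v) = T M p t v.
Proof. by move=> pq qt; rewrite !mulvE -mulmxA pthM. Qed.

(* A map from M to M(x), x = [i, j], is determined by its component phi at the vertex j, which
   must vanish on the images of the vertices before i; its kernel is cut phi. *)
Definition cut M j (phi : 'cV[k]_(rdim M j)) : fam M :=
  fun p => lker (mulv (pth M p j *m phi)).

(** The second clause makes the map to M(x) surjective: nonzero at the first vertex of x, it is
    nonzero at all of them. *)
Definition good M (x : posroot) (phi : 'cV[k]_(rdim M (val x).2)) :=
  (forall p, (p < (val x).1)%N -> pth M p (val x).2 *m phi = 0) /\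
  pth M (val x).1 (val x).2 *m phi != 0.

Lemma mem_cut M j (phi : 'cV[k]_(rdim M j)) p v :
  (v \in cut phi p) = (v *m (pth M p j *m phi) == 0).
Proof. by rewrite memv_ker mulvE. Qed.

Lemma mem_cutT M j (phi : 'cV[k]_(rdim M j)) p q v : (p <= q)%N -> (q <= j)%N ->
  (T M p q v \in cut phi q) = (v \in cut phi p).
Proof. by move=> pq qj; rewrite !mem_cut mulvE -mulmxA (mulmxA (pth M p q)) pthM. Qed.

Lemma cut_stable M j (phi : 'cV[k]_(rdim M j)) : stable (cut phi).
Proof.
move=> p q; apply/subvP => _ /memv_imgP[v vU ->].
case: (leqP p q) => [pq|qp]; last by rewrite mulvE pth_gt // mulmx0 mem0v.
case: (leqP q j) => [qj|jq]; first by rewrite mem_cutT.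
by rewrite mem_cut pth_gt // mul0mx mulmx0.
Qed.

Lemma rkS_cut M j (phi : 'cV[k]_(rdim M j)) p q : (p <= q)%N ->
  rkS (@ffam _ M) (cut phi) p q = ((q <= j)%N && (pth M p j *m phi != 0)).
Proof.
move=> pq; rewrite rkS_quo.
set h := mulv (pth M q j *m phi).
rewrite -[X in (_ - X)%N](dim_img_ker (f := h) (subvv _)).
have -> : (h @: cut phi q = 0)%VS by apply/eqP; rewrite -lkerE.
rewrite dimv0 add0n -(dim_img_ker (f := h) (U := (_ + _)%VS)) ?addvSr // addnK.
rewrite limgD.
have -> : (h @: cut phi q = 0)%VS by apply/eqP; rewrite -lkerE.
rewrite addv0 -limg_comp -mulv_comp dim_mulv mulmxA.
case: leqP => [qj|jq] /=; last by rewrite (pth_gt M jq) mulmx0 mul0mx mxrank0.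
rewrite pthM //; case: (eqVneq (pth M p j *m phi) 0) => [->|n0] /=; first by rewrite mxrank0.
by apply/eqP; rewrite eqn_leq rank_leq_col lt0n mxrank_eq0.
Qed.

Lemma good_pth M x phi p : @good M x phi -> (p <= (val x).2)%N ->
  (pth M p (val x).2 *m phi != 0) = ((val x).1 <= p)%N.
Proof.
move=> [g0 g1] px; case: ltnP => [/g0 ->|xp]; first by rewrite eqxx.
apply: contra g1 => /eqP p0; rewrite -(@pthM _ _ (val x).1 p) //.
by rewrite -mulmxA p0 mulmx0.
Qed.

Lemma rkS_good M x phi p q : @good M x phi -> (p <= q)%N ->
  rkS (@ffam _ M) (cut phi) p q = spans x p q.
Proof.
move=> g pq; rewrite rkS_cut // /spans pq /=.
case: leqP => [qx|] /=; last by rewrite andbF.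
by rewrite good_pth ?(leq_trans pq) // andbT.
Qed.

Lemma hyperplane_ker n (U : {vspace 'rV[k]_n}) : (\dim U < n)%N ->
  exists2 phi : 'cV[k]_n, phi != 0 & (U <= lker (mulv phi))%VS.
Proof.
move=> Un; have : cokermx (vmx U) != 0.
  by rewrite -mxrank_eq0 mxrank_coker (eqP (vmx_free U)) -lt0n subn_gt0.
move=> /matrix0Pn[i [j Cij]]; exists (col j (cokermx (vmx U))).
  by apply/cV0Pn; exists i; rewrite mxE.
apply/subvP => v /vmxP[w ->]; rewrite memv_ker mulvE colE.
by rewrite -mulmxA (mulmxA (vmx U)) mulmx_coker mul0mx mulmx0.
Qed.

Lemma dim_ker n (phi : 'cV[k]_n) : phi != 0 -> (\dim (lker (mulv phi))).+1 = n.
Proof.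
move=> phi0; have := dim_img_ker (f := mulv phi) (subvf _).
rewrite dim_mulv dim_rV => E; rewrite -[RHS]E.
suff -> : \rank phi = 1%N by [].
by apply/eqP; rewrite eqn_leq rank_leq_col lt0n mxrank_eq0.
Qed.

(** At the last vertex of x the space U is a hyperplane, which provides phi; the ranks of the
    quotient say that phi is good. Stability puts U inside [cut phi], and the dimensions agree. *)
Lemma cutP M (x : posroot) (U : fam M) : stable U ->
  (forall p q, (p <= q)%N -> rkS (@ffam _ M) U p q = spans x p q) ->
  exists phi, @good M x phi /\ U = cut phi.
Proof.
move=> sU tU; have x12 := valP x; pose j := (val x).2.
have rE p q : (p <= q)%N -> (limg (T M p q) <= U q)%VS = ~~ spans x p q.
  move=> pq; have := tU p q pq; rewrite rkS_quo; case: (spans x p q) => /= e.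
    by apply/negP => /addv_idPr; move=> E; move: e; rewrite E subnn.
  apply/addv_idPr/eqP; rewrite eq_sym eqEdim addvSr /= -subn_eq0; exact/eqP.
have dU p : (\dim (U p) + spans x p p)%N = rdim M p.
  by rewrite -(tU p p) // rkS_diag subnKC ?dim_fam.
have E : (\dim (U j)).+1 = rdim M j.
  by rewrite -[RHS](dU j) /spans leqnn x12 /= addn1.
have Uj1 : (\dim (U j) < rdim M j)%N.
  by move: (leqnn (\dim (U j)).+1); rewrite [X in (_ <= X)%N]E.
have [phi phi0 Uphi] := hyperplane_ker Uj1.
have Uj : U j = lker (mulv phi).
  by apply/eqP; rewrite eqEdim Uphi -ltnS E /= -[X in (_ < X)%N](dim_ker phi0).
have imE p : (limg (T M p j) <= U j)%VS = (pth M p j *m phi == 0).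
  rewrite Uj lkerE -limg_comp -mulv_comp.
  by rewrite -dimv_eq0 dim_mulv mxrank_eq0.
have g : @good M x phi.
  split=> [p px|].
    by apply/eqP; rewrite -imE rE ?(leq_trans (ltnW px)) // /spans leqNgt px.
  by rewrite -imE rE // /spans !leqnn x12.
exists phi; split=> //; apply: functional_extensionality_dep => p.
apply/eqP; rewrite eqEdim; apply/andP; split.
  apply/subvP => v vU; rewrite mem_cut.
  case: (leqP p j) => [pj|jp]; last by rewrite pth_gt // mul0mx mulmx0.
  have : T M p j v \in U j by apply: (subvP (sU p j)); rewrite memv_img.
  by rewrite Uj memv_ker !mulvE mulmxA.
have := rkS_good g (leqnn p); rewrite rkS_diag => e.
by rewrite -(leq_add2r (spans x p p)) dU -e subnKC ?dim_fam.
Qed.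

Lemma cut_inj M (x : posroot) phi psi : @good M x phi -> good psi ->
  cut phi = cut psi -> exists2 c, c != 0 & psi = c *: phi.
Proof.
move=> [_ g] [_ g'] /(congr1 (fun U => U (val x).2)); rewrite /cut pth_id !mul1mx => E.
have phi0 : phi != 0 by apply: contra g => /eqP ->; rewrite mulmx0.
have psi0 : psi != 0 by apply: contra g' => /eqP ->; rewrite mulmx0.
have /cV0Pn[i phii] := phi0.
pose v := delta_mx 0 i : 'rV[k]_(rdim M (val x).2).
have psiE : psi = (psi i 0 / phi i 0) *: phi.
  apply/matrixP => a b; rewrite !mxE (ord1 b).
  pose w := delta_mx 0 a - (phi a 0 / phi i 0) *: delta_mx 0 i : 'rV[k]_(rdim M (val x).2).
  have dE c (xi : 'cV[k]_(rdim M (val x).2)) : delta_mx 0 c *m xi = (xi c 0)%:M.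
    by rewrite -rowE; apply/matrixP => u v0; rewrite !ord1 !mxE.
  have : w \in lker (mulv phi).
    rewrite memv_ker mulvE mulmxBl -scalemxAl !dE scale_scalar_mx divfK //.
    by rewrite subrr.
  rewrite E memv_ker mulvE mulmxBl -scalemxAl !dE scale_scalar_mx subr_eq0.
  move=> /eqP/matrixP/(_ 0 0); rewrite !mxE !mulr1n => ->.
  by rewrite mulrAC [RHS]mulrAC (mulrC (phi a 0)).
exists (psi i 0 / phi i 0) => //; apply: contra psi0 => /eqP c0.
by rewrite psiE c0 scale0r.
Qed.

End Extensions.

(** * Counting functionals *)

Section Functionals.
Variable k : finFieldType.

Lemma card_ann n (W : {vspace 'rV[k]_n}) :
  #|[set phi : 'cV[k]_n | (W <= lker (mulv phi))%VS]| = (#|k| ^ (n - \dim W))%N.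
Proof.
pose K := kermx (vmx W)^T; pose f (w : 'rV[k]_(\rank K)) := (w *m row_base K)^T.
have rK : \rank K = (n - \dim W)%N.
  by rewrite mxrank_ker mxrank_tr (eqP (vmx_free W)).
have f_inj : injective f.
  by move=> u v /trmx_inj; apply/row_free_inj/row_base_free.
have -> : [set phi : 'cV[k]_n | (W <= lker (mulv phi))%VS] = [set f w | w in [set: 'rV[k]_(\rank K)]].
  apply/setP => phi; rewrite inE; apply/idP/imsetP => [Wphi|[w _ ->]].
    have : vmx W *m phi = 0.
      apply/row_matrixP => i; rewrite row_mul row0.
      have : row i (vmx W) \in W by apply/vmxP; exists (delta_mx 0 i); rewrite -rowE.
      by move=> /(subvP Wphi); rewrite memv_ker mulvE => /eqP.
    move=> /(congr1 trmx); rewrite trmx_mul trmx0 => /sub_kermxP.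
    rewrite -/K -(eq_row_base K) => /submxP[w E]; exists w => //.
    by apply: trmx_inj; rewrite [LHS]E /f trmxK.
  have H : row_base K *m (vmx W)^T = 0 by apply/sub_kermxP; rewrite eq_row_base.
  apply/subvP => _ /vmxP[v ->]; rewrite memv_ker mulvE /f.
  by rewrite -(trmxK (vmx W)) -mulmxA -trmx_mul -mulmxA H mulmx0 trmx0 mulmx0.
by rewrite card_imset // cardsT card_mx rK mul1n.
Qed.

Lemma card_ann_diff n (W W' : {vspace 'rV[k]_n}) : (W <= W')%VS ->
  #|[set phi : 'cV[k]_n | (W <= lker (mulv phi))%VS && ~~ (W' <= lker (mulv phi))%VS]|
  = (#|k| ^ (n - \dim W) - #|k| ^ (n - \dim W'))%N.
Proof.
move=> WW'; rewrite -!card_ann -cardsDS; last first.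
  by apply/fintype.subsetP => phi; rewrite !inE; apply: subv_trans.
by apply: eq_card => phi; rewrite !inE andbC.
Qed.

(** The quantum integer [a]_q = (q^a - 1) / (q - 1). *)
Definition qn (q a : nat) := (\sum_(t < a) q ^ t)%N.

Lemma qnE q a : (0 < q)%N -> (q.-1 * qn q a = q ^ a - 1)%N.
Proof. by move=> q0; rewrite -predn_exp subn1. Qed.

Lemma card_k1 : (1 < #|k|)%N.
Proof. exact: card_finRing_gt1. Qed.

Implicit Types M : rep k.

Lemma img_ker M p j (phi : 'cV[k]_(rdim M j)) :
  (limg (T M p j) <= lker (mulv phi))%VS = (pth M p j *m phi == 0).
Proof. by rewrite lkerE -limg_comp -mulv_comp -dimv_eq0 dim_mulv mxrank_eq0. Qed.

(** The space on which a good functional must vanish: the image of all vertices before x, which is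
    the image of the last of them, or 0 if x starts at the first vertex of the quiver. *)
Definition W0 M (x : posroot) : {vspace 'rV[k]_(rdim M (val x).2)} :=
  if (0 < (val x).1)%N then limg (T M (val x).1.-1 (val x).2) else 0%VS.

Lemma dim_W0 M x : \dim (W0 M x) = ((0 < (val x).1) * rk M (val x).1.-1 (val x).2)%N.
Proof. by rewrite /W0; case: ltnP => _; rewrite ?dimv0 // mul1n rk_dim. Qed.

Lemma goodE M x phi : @good k M x phi <->
  (W0 M x <= lker (mulv phi))%VS &&
  ~~ (limg (T M (val x).1 (val x).2) <= lker (mulv phi))%VS.
Proof.
rewrite img_ker /good; have x12 := valP x.
suff H : (forall p, (p < (val x).1)%N -> pth M p (val x).2 *m phi = 0) <->
    (W0 M x <= lker (mulv phi))%VS.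
  by split=> [[/H -> ->]|/andP[/H]].
rewrite /W0; case: posnP => [->|x1]; first by rewrite sub0v.
rewrite img_ker; split=> [H|/eqP H p px]; first by rewrite H // ltn_predL.
rewrite -(@pthM _ _ _ (val x).1.-1) ?(leq_trans (leq_pred _)) //; last by rewrite -ltnS prednK.
by rewrite -mulmxA H mulmx0.
Qed.

(** The fibres of phi |-> [cut phi] on good functionals consist of the nonzero multiples of one
    functional. *)
Lemma cnt_cut M (x : posroot) (X : fam M -> Prop) :
  (#|k|.-1 * cnt (fun U => [/\ stable U, typ (@ffam _ M) U [mset x]%mset & X U]) =
   #|[set phi : 'cV[k]_(rdim M (val x).2) | `[< good phi /\ X (cut phi) >]]|)%N.
Proof.
set A := [set phi | _].
have memA psi : psi \in A <-> good psi /\ X (cut psi) by rewrite /A !inE.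
rewrite cnt_sum big_distrr /= -[RHS]sum1_card.
rewrite [RHS](partition_big (fun phi => res (cut phi)) xpredT) //=.
apply: eq_bigr => F _; rewrite sum1_card.
case: (pselect [/\ stable (ext F), typ (@ffam _ M) (ext F) [mset x]%mset & X (ext F)]) => [XF|nX].
  rewrite (_ : `[< _ >] = true) ?muln1; last exact/asboolP.
  have [sF tF xF] := XF.
  have [phi [g E]] : exists phi, @good k M x phi /\ ext F = cut phi.
    by apply: cutP => // p q pq; rewrite tF // R_mset1.
  rewrite -(cardsC1 (0 : k)) -(card_imset (f := fun c => c *: phi)); last first.
    move=> c d /eqP; rewrite -subr_eq0 -scalerBl scaler_eq0 subr_eq0.
    case/orP => [/eqP //|/eqP p0]; case: g => _.
    by rewrite p0 mulmx0 eqxx.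
  apply/esym/eq_card => psi; apply/idP/imsetP => [/andP[]|[c]].
    move=> /memA[g' _] /eqP/(congr1 (@ext _ M)); rewrite resK E => E'.
    by have [c c0 ->] := cut_inj g g' (esym E'); exists c; rewrite ?inE.
  rewrite !inE => c0 ->.
  have E' : cut (c *: phi) = ext F.
    rewrite E; apply: functional_extensionality_dep => p; apply/vspaceP => v.
    by rewrite !mem_cut -!scalemxAr scaler_eq0 (negPf c0).
  apply/andP; split; last by rewrite /= E' extK.
  apply/memA; rewrite E'; split=> //; case: g => g0 g1; split=> [p /g0 p0|].
    by rewrite -scalemxAr p0 scaler0.
  by rewrite -scalemxAr scaler_eq0 negb_or c0.
rewrite (_ : `[< _ >] = false) ?muln0; last exact/asboolP.
apply/esym/eq_card0 => psi; apply/negbTE/negP => /andP[/memA[g xg] /eqP E].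
apply: nX; rewrite -E resK; split=> //; first exact: cut_stable.
by move=> p q pq; rewrite rkS_good // R_mset1.
Qed.

(* The factor #|k| - 1 is the order of the automorphism group of M(x). *)
Lemma hall_cut (x : posroot) (b l : P) :
  (#|k|.-1 * hall k [mset x]%mset b l =
   #|[set phi : 'cV[k]_(rdim (Mrep k l) (val x).2) |
       `[< good phi /\ typ (cut phi) (@zfam _ _) b >]]|)%N.
Proof.
rewrite -(@cnt_cut (Mrep k l) x (fun U => typ U (@zfam _ _) b)).
congr (_ * _)%N; apply: eq_cnt => U.
by split=> [[]|[]].
Qed.

Lemma hallset_R (a b l : P) U : @hallset k (Mrep k l) a b U ->
  (forall p, R l p p = R a p p + R b p p)%N /\
  (forall p q, p <= q -> R a p q + R b p q <= R l p q)%N.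
Proof.
move=> [sU tb ta]; split=> [p|p q pq].
  by rewrite -(rk_Mrep k l) (rk_ext_diag p sU) ta // tb.
by rewrite -(rk_Mrep k l) -ta // -tb //; apply: rk_ext_le.
Qed.

Lemma hall_R (a b l : P) : hall k a b l <> 0%N ->
  (forall p, R l p p = R a p p + R b p p)%N /\
  (forall p q, p <= q -> R a p q + R b p q <= R l p q)%N.
Proof. by move=> /hallP[U]; apply: hallset_R. Qed.

Lemma hall0l (b l : P) : hall k mset0 b l = (b == l).
Proof.
case: eqVneq => [<-|bl].
  apply: (@cnt1 _ _ _ (@ffam _ _)) => [|U [_ _ tU]]; last first.
    apply: functional_extensionality_dep => p; apply: typ_full.
    by rewrite tU // R_mset0.
  split=> [p q|p q pq|p q pq]; first exact: subvf.
    by rewrite rkS_full rk_Mrep.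
  by rewrite R_mset0 rkS_quo addvC (addv_idPl (subvf _)) subnn.
apply: hall_eq0 => U [sU tb t0].
have UE : U = @ffam _ _.
  apply: functional_extensionality_dep => p; apply: typ_full.
  by rewrite t0 // R_mset0.
case/eqP: bl; apply: R_inj => p q pq.
by rewrite -tb // UE rkS_full rk_Mrep.
Qed.

Lemma hall0r (a l : P) : hall k a mset0 l = (a == l).
Proof.
have z0 p q : rkS (@zfam _ (Mrep k l)) (@zfam _ _) p q = 0%N.
  by rewrite rkS_sub limg0 dimv0.
have UE (U : fam (Mrep k l)) : typ U (@zfam _ _) mset0 -> U = @zfam _ _.
  move=> tb; apply: functional_extensionality_dep => p.
  by apply/eqP; rewrite -dimv_eq0; move: (tb p p (leqnn p)); rewrite rkS_sub T_id lim1g R_mset0 => ->.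
case: eqVneq => [->|bl].
  apply: (@cnt1 _ _ _ (@zfam _ _)) => [|U [_ tU _]]; last exact: UE.
  split=> [p q|p q pq|p q pq]; first by rewrite limg0 subvv.
    by rewrite z0 R_mset0.
  by rewrite rkS_full rk_Mrep.
apply: hall_eq0 => U [sU tb ta]; case/eqP: bl; apply: R_inj => p q pq.
by rewrite -ta // (UE _ tb) rkS_full rk_Mrep.
Qed.

End Functionals.

(** * Products of basis elements *)

Section Structure.
Variable k : finFieldType.
Local Notation hall := (hall k).

(** In the form of [belowP]: dimensions add up, ranks are superadditive, and the rank into the last
    vertex of c is at most the dimension there. *)
Lemma hall_below (a b l : P) c : below c a -> below c b -> hall a b l <> 0%N ->
  below c l.
Proof.
move=> /belowP[a0 aj] /belowP[b0 bj] /hall_R[ld lr]; apply/belowP.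
split=> [q cq|]; first by rewrite ld a0 ?b0.
apply/eqP; rewrite eqn_leq; apply/andP; split.
  rewrite ld aj bj -mulnDr leq_mul2l; case: posnP => //= c1.
  by rewrite lr // (leq_trans (leq_pred _)) ?(valP c).
case: posnP => // c1; rewrite mul1n R_le_diag //.
by rewrite (leq_trans (leq_pred _)) ?(valP c).
Qed.

Definition beloweq b (m : P) := forall c, c \in m -> (c == b) || rlt c b.

(** With b = [i, j], the roots of m that reach j end there and start at i at the latest. Those
    starting before i are counted by the rank from i - 1 to j; the others are copies of b. *)
Lemma beloweqP b (m : P) : beloweq b m ->
  [/\ forall q, ((val b).2 < q)%N -> R m q q = 0%N,
      R m (val b).1 (val b).2 = R m (val b).2 (val b).2 &
      (m b + (0 < (val b).1) * R m (val b).1.-1 (val b).2)%N = R m (val b).2 (val b).2].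
Proof.
move=> bm; have b12 : ((sval b).1 <= (sval b).2)%N := valP b; split=> [q /= bq||].
- apply/eqP; rewrite -leqn0 leqNgt; apply/negP => /R_span[c /bm].
  by case/orP => [/eqP->|]; rewrite /rlt /spans /=; lia.
- apply: eq_in_count => c /bm; case/orP => [/eqP->|]; rewrite /rlt /spans /=; lia.
have := count_root b m; rewrite /= !count_mem_mset.
have -> : R m (sval b).1.-1 (sval b).2.+1 = 0%N.
  apply/eqP; rewrite -leqn0 leqNgt; apply/negP => /R_span[c /bm].
  by case/orP => [/eqP->|]; rewrite /rlt /spans /=; lia.
have -> : R m (sval b).1 (sval b).2.+1 = 0%N.
  apply/eqP; rewrite -leqn0 leqNgt; apply/negP => /R_span[c /bm].
  by case/orP => [/eqP->|]; rewrite /rlt /spans /=; lia.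
rewrite addn0 muln0 addn0 => ->.
by apply: eq_in_count => c /bm; case/orP => [/eqP->|]; rewrite /rlt /spans /=; lia.
Qed.

(* Past the vertex j of the root b = [i, j] everything vanishes, so the extension is as split as
   ranks can see. *)
Lemma rk_cut_top M (b : posroot) phi p q : @good k M b phi -> (p <= q)%N ->
  (forall t, ((val b).2 < t)%N -> rdim M t = 0%N) ->
  rk M p q = (spans b p q + rkS (cut phi) (@zfam _ M) p q)%N.
Proof.
move=> g pq M0; rewrite -(rkS_good g pq); apply: rk_ext_eq; last exact: cut_stable.
apply/subvP => w; rewrite memv_cap => /andP[/memv_imgP[v _ ->]].
case: (leqP q (val b).2) => [qb|bq].
  by rewrite mem_cutT // => vp; rewrite memv_img.
suff -> : T M p q v = 0 by move=> _; apply: mem0v.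
by apply/rowP => -[x xq]; exfalso; move: xq; rewrite (M0 _ bq).
Qed.

Lemma hall_top (b : posroot) (m l : P) : beloweq b m -> hall [mset b]%mset m l <> 0%N ->
  l = ([mset b] `+` m)%mset.
Proof.
move=> bm h0; have [ld _] := hall_R h0; have [m0 _ _] := beloweqP bm.
have [U [sU tm tb]] := hallP h0.
have [phi [g UE]] : exists phi, @good k (Mrep k l) b phi /\ U = cut phi.
  by apply: cutP => // p q pq; rewrite tb // R_mset1.
apply: R_inj => p q pq; rewrite R_msetD R_mset1 -(rk_Mrep k l) (rk_cut_top g pq).
  by rewrite -UE tm.
by move=> t bt; rewrite -rk_id rk_Mrep ld m0 // R_mset1 /spans [X in [&& _, _ & X]]leqNgt bt !andbF.
Qed.

Lemma hall_card (n : nat) (x : posroot) (b l : P) :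
  #|[set phi : 'cV[k]_(rdim (Mrep k l) (val x).2) |
       `[< good phi /\ typ (cut phi) (@zfam _ _) b >]]| = (#|k|.-1 * n)%N ->
  hall [mset x]%mset b l = n.
Proof.
rewrite -hall_cut => /eqP; rewrite eqn_pmul2l; first by move/eqP.
by have := card_k1 k; case: #|k| => [|[]].
Qed.

(** Every good functional has a kernel of type m, by [rk_cut_top]. At the last vertex j of b =
    [i, j], the image of vertex i is everything and [W0] has codimension m(b) + 1, which leaves
    q^(m(b) + 1) - 1 functionals. *)
Lemma hall_top_eq (b : posroot) (m : P) : beloweq b m ->
  hall [mset b]%mset m ([mset b] `+` m)%mset = qn #|k| (m b).+1.
Proof.
move=> bm; set l := ([mset b] `+` m)%mset.
have bl : beloweq b l.
  by move=> c; rewrite in_msetD in_mset1 => /orP[->//|/bm].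
have [l0 l1 l2] := beloweqP bl.
apply: hall_card; rewrite qnE ?(ltnW (card_k1 k)) //.
set A := [set phi | _].
have -> : A = [set phi | (W0 (Mrep k l) b <= lker (mulv phi))%VS &&
    ~~ (limg (T (Mrep k l) (val b).1 (val b).2) <= lker (mulv phi))%VS].
  apply/setP => phi; rewrite /A !inE; apply/asboolP/idP => [[/goodE]//|/goodE g].
  split=> // p q pq; apply/eqP; rewrite -(eqn_add2l (spans b p q)).
  rewrite -(rk_cut_top g pq) ?rk_Mrep ?R_msetD ?R_mset1 // => t bt.
  by rewrite -rk_id rk_Mrep l0.
rewrite card_ann_diff; last first.
  rewrite /W0; case: posnP => _; first exact: sub0v.
  have b12 := valP b.
  apply/subvP => _ /memv_imgP[v _ ->].
  by rewrite -(@T_comp _ _ (val b).1.-1 (val b).1) ?leq_pred // memv_img ?memvf.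
rewrite dim_W0 -rk_dim !rk_Mrep l1 -l2 -(rk_id (Mrep k l)) rk_Mrep -l2.
rewrite addnK subnn expn0; congr (_ ^ _ - _)%N.
by rewrite /l msetE2 msetnxx.
Qed.

Lemma hall_ext (x b : posroot) (l : P) : rlt x b ->
  hall [mset x]%mset [mset b]%mset l <> 0%N ->
  l = ([mset x] `+` [mset b])%mset \/ below b l.
Proof.
move=> xb /hall_R[ld lr]; apply: R_simple_ext => //.
  by move=> p; rewrite ld !R_mset1.
by move=> p q pq; have := lr p q pq; rewrite !R_mset1.
Qed.

Lemma typ_root M (U : fam M) (b : posroot) : @stable k M U ->
  (forall p, rkS U (@zfam _ M) p p = spans b p p) ->
  typ U (@zfam _ M) [mset b]%mset <-> (0 < rkS U (@zfam _ M) (val b).1 (val b).2)%N.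
Proof.
move=> sU dU; have b12 := valP b; split=> [->//|U0].
  by rewrite R_mset1 /spans !leqnn b12.
have [m tm] := typ_sub sU; suff <- : m = [mset b]%mset by [].
by apply: mset_root => [p|]; rewrite -tm // dU.
Qed.

(** The common shape of the counts below: the relevant functionals annihilate W but not W', and each
    subrepresentation accounts for q - 1 of them. *)
Lemma hall_cut_diff (x : posroot) (b l : P) (W W' : {vspace 'rV[k]_(rdim (Mrep k l) (val x).2)}) n :
  (W <= W')%VS ->
  (forall phi, @good k _ x phi /\ typ (cut phi) (@zfam _ _) b <->
    (W <= lker (mulv phi))%VS && ~~ (W' <= lker (mulv phi))%VS) ->
  (#|k| ^ (R l (val x).2 (val x).2 - \dim W) - #|k| ^ (R l (val x).2 (val x).2 - \dim W')
    = #|k|.-1 * n)%N ->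
  hall [mset x]%mset b l = n.
Proof.
move=> WW' WP E; apply: hall_card; rewrite -E -(rk_Mrep k) rk_id -card_ann_diff //.
by apply: eq_card => phi; rewrite !inE; apply/asboolP/idP => /WP.
Qed.

Lemma W0_sub M x : (W0 M x <= limg (@T k M (val x).1 (val x).2))%VS.
Proof.
rewrite /W0; case: posnP => _; first exact: sub0v.
apply/subvP => _ /memv_imgP[v _ ->].
by rewrite -(@T_comp _ _ (val x).1.-1 (val x).1) ?leq_pred ?(valP x) // memv_img ?memvf.
Qed.

Lemma cut_root_diag (x b : posroot) (l : P) phi :
  (forall p, R l p p = spans x p p + spans b p p)%N ->
  @good k (Mrep k l) x phi ->
  forall p, rkS (cut phi) (@zfam _ _) p p = spans b p p.
Proof.
move=> ld g p; apply/eqP; rewrite -(eqn_add2l (spans x p p)) -ld -(rk_Mrep k).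
by rewrite -(rkS_good g (leqnn p)) -(rk_ext_diag p (cut_stable _)).
Qed.

Lemma hall_bracket_simple (a x b : posroot) :
  (val x).1 = (val a).1 -> (val x).2 = (val a).1 -> (val b).1 = (val a).1.+1 ->
  (val b).2 = (val a).2 -> hall [mset x]%mset [mset b]%mset [mset a]%mset = 1%N.
Proof.
move=> x1 x2 b1 b2; have b12 := valP b; have a12 := valP a.
have ld p : R ([mset a] : P)%mset p p = (spans x p p + spans b p p)%N.
  by rewrite R_mset1; move: b12 a12 x1 x2 b1 b2; rewrite /spans /=; lia.
apply: (@hall_cut_diff x _ _ _ _ 1%N (W0_sub _ _)).
  move=> phi; split=> [[/goodE]//|/goodE g]; split=> //.
  apply/typ_root; [exact: cut_stable | exact: cut_root_diag g |].
  have cf : cut phi (val b).1 = fullv.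
    by apply: typ_full; rewrite (rkS_good g) // /spans x2 b1 ltnn !andbF.
  rewrite rkS_sub cf -rk_dim rk_Mrep R_mset1.
  by move: b12 b1 b2; rewrite /spans /=; lia.
rewrite dim_W0 -rk_dim !rk_Mrep !R_mset1 x1 x2 /spans !leqnn a12.
case: posnP => [a0|a1]; first by rewrite !mul0n muln1 subn1.
by rewrite mul1n [((val a).1 <= _)%N]leqNgt ltn_predL a1 muln1 subn1.
Qed.

(** The subrepresentations counted are the graphs of the homomorphisms M(b) -> M(x), which for x < b
    form a space of dimension 1 or 0 according to the condition. *)
Lemma hall_pair (x b : posroot) : rlt x b ->
  hall [mset x]%mset [mset b]%mset ([mset x] `+` [mset b])%mset =
  (if ((val x).1 <= (val b).1 <= (val x).2)%N then #|k| else 1)%N.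
Proof.
move=> xb; set l := (_ `+` _)%mset.
have x12 : ((sval x).1 <= (sval x).2)%N := valP x.
have b12 : ((sval b).1 <= (sval b).2)%N := valP b.
have lE p q : R l p q = (spans x p q + spans b p q)%N by rewrite R_msetD !R_mset1.
have tC phi : @good k (Mrep k l) x phi -> typ (cut phi) (@zfam _ _) [mset b]%mset <->
    ~~ (cut phi (val b).1 <= lker (T (Mrep k l) (val b).1 (val b).2))%VS.
  move=> g; rewrite lkerE -dimv_eq0 -lt0n -rkS_sub.
  by apply: typ_root; [exact: cut_stable | exact: cut_root_diag g].
case: ifP => Bx; last first.
  apply: (@hall_cut_diff x _ _ _ _ 1%N (W0_sub _ _)).
    move=> phi; split=> [[/goodE]//|/goodE g]; split=> //; apply/tC => //.
    have -> : cut phi (val b).1 = fullv.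
      by apply: typ_full; rewrite (rkS_good g) //; move: Bx; rewrite /spans /=; lia.
    rewrite lkerE -dimv_eq0 -lt0n -rk_dim rk_Mrep lE.
    by rewrite /spans !leqnn b12 addn1.
  rewrite dim_W0 -rk_dim !rk_Mrep !lE muln1.
  rewrite (_ : (_ - (0 < _) * _)%N = 1%N).
    rewrite (_ : (_ + _ - _)%N = 0%N) ?expn1 ?subn1 //.
    by move: xb Bx; rewrite /rlt /spans /=; lia.
  by case: posnP; move: xb Bx; rewrite /rlt /spans /= ?mul0n ?mul1n; lia.
have [i'i ij'] := andP Bx.
have dj : R l (val x).2 (val x).2 = 2%N.
  by rewrite lE; move: xb i'i ij'; rewrite /rlt /spans /=; lia.
have W00 : W0 (Mrep k l) x = 0%VS.
  apply/eqP; rewrite -dimv_eq0 dim_W0 rk_Mrep lE; apply/eqP.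
  by case: posnP; move: xb i'i ij'; rewrite /rlt /spans /= ?mul0n ?mul1n; lia.
have rij' : R l (val b).1 (val x).2 = 2%N.
  by rewrite lE; move: xb i'i ij'; rewrite /rlt /spans /=; lia.
have di : R l (val b).1 (val b).1 = 2%N.
  by rewrite lE; move: xb i'i ij'; rewrite /rlt /spans /=; lia.
(* If both roots end at the same vertex, the map from the first to the last vertex of b is injective
   on a plane, and every good functional has a kernel of type b. *)
case: (eqVneq (val x).2 (val b).2) => x2.
  have x1 : ((sval x).1 < (sval b).1)%N by move: xb x2; rewrite /rlt /=; lia.
  apply: (@hall_cut_diff x _ _ 0%VS (limg (T (Mrep k l) (val x).1 (val x).2))).
  - exact: sub0v.
  - move=> phi; split=> [[/goodE]|H]; first by rewrite W00.
    have g : @good k (Mrep k l) x phi by apply/goodE; rewrite W00.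
    split=> //; apply/tC => //.
    have -> : lker (T (Mrep k l) (val b).1 (val b).2) = 0%VS.
      apply/eqP; rewrite -dimv_eq0 -(eqn_add2r (\dim (limg (T (Mrep k l) (val b).1 (val b).2)))).
      rewrite -{1}[lker _]capfv limg_ker_dim dim_rV add0n -rk_dim -rk_id !rk_Mrep.
      by rewrite -x2 rij' di.
    rewrite subv0 -dimv_eq0; have := rkS_good g (leqnn (val b).1).
    rewrite rkS_diag -[X in (X - _)%N]rk_id rk_Mrep di.
    by case: (\dim _) => //; case: (spans _ _ _).
  rewrite -rk_dim rk_Mrep dimv0 dj lE.
  rewrite (_ : (_ + _)%N = 1%N).
    by rewrite subn0 -mulnn expn1 -{3}[#|k|]mul1n -mulnBl subn1.
  by move: xb x1; rewrite /rlt /spans /=; lia.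
have x2' : ((sval x).2 < (sval b).2)%N by move: xb x2; rewrite /rlt /=; lia.
(* The line that M(x) contributes at its last vertex, where M is two-dimensional. The kernel of phi
   has type b exactly if phi does not vanish on this line. *)
pose W1 := lker (T (Mrep k l) (val x).2 (val b).2).
have dW1 : \dim W1 = 1%N.
  apply/eqP; rewrite -(eqn_add2r (\dim (limg (T (Mrep k l) (val x).2 (val b).2)))).
  rewrite -{1}[W1]capfv limg_ker_dim dim_rV -rk_dim -rk_id !rk_Mrep dj lE.
  by apply/eqP; move: ij' x2'; rewrite /rlt /spans /=; lia.
have W1im : (W1 <= limg (T (Mrep k l) (val x).1 (val x).2))%VS.
  case: (eqVneq (val x).1 (val b).1) => x1.
    suff -> : limg (T (Mrep k l) (val x).1 (val x).2) = fullv by apply: subvf.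
    apply/eqP; rewrite eqEdim subvf dim_rV -rk_dim -rk_id !rk_Mrep /=.
    by rewrite x1 rij' dj.
  suff -> : limg (T (Mrep k l) (val x).1 (val x).2) = W1 by apply: subvv.
  apply/eqP; rewrite eqEdim dW1 -rk_dim rk_Mrep lE; apply/andP; split; last first.
    by rewrite /spans !leqnn x12.
  rewrite lkerE -limg_comp -dimv_eq0.
  have -> : (T (Mrep k l) (val x).2 (val b).2 \o T (Mrep k l) (val x).1 (val x).2)%VF =
      T (Mrep k l) (val x).1 (val b).2.
    by apply/lfunP => v; rewrite comp_lfunE T_comp // ltnW.
  rewrite -rk_dim rk_Mrep lE; apply/eqP.
  by move: x1 i'i x2'; rewrite /spans /=; lia.
have dker (phi : 'cV[k]_(rdim (Mrep k l) (val x).2)) : ~~ (W1 <= lker (mulv phi))%VS || (phi != 0) -> \dim (lker (mulv phi)) = 1%N.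
  move=> H; have phi0 : phi != 0.
    case/orP: H => //; apply: contra => /eqP ->.
    by apply/subvP => v _; rewrite memv_ker mulvE mulmx0.
  by have := dim_ker phi0; rewrite -[RHS]rk_id rk_Mrep dj => -[].
have cutj (phi : 'cV[k]_(rdim (Mrep k l) (val x).2)) v :
    (v \in lker (mulv phi)) = (v \in cut phi (val x).2).
  by rewrite memv_ker mulvE [RHS](mem_cut phi) pth_id mul1mx.
apply: (@hall_cut_diff x _ _ 0%VS W1).
- exact: sub0v.
- move=> phi; rewrite sub0v /=; split=> [[g /(tC _ g)]|H].
    apply: contra => W1k; have phi0 : phi != 0.
      by case: g => _; apply: contra => /eqP ->; rewrite mulmx0.
    have E : W1 = lker (mulv phi).
      by apply/eqP; rewrite eqEdim W1k dker ?phi0 ?orbT // dW1.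
    apply/subvP => v vc; rewrite memv_ker -(@T_comp _ _ _ (val x).2) //; last exact: ltnW.
    by rewrite -memv_ker -/W1 E cutj mem_cutT.
  have g : @good k (Mrep k l) x phi.
    apply/goodE; rewrite W00 sub0v /=; apply: contra H; exact: subv_trans.
  split=> //; apply/tC => //; apply: contra H => cW.
  suff -> : W1 = lker (mulv phi) by apply: subvv.
  case: (boolP (W1 <= lker (mulv phi))%VS) => H.
    apply/eqP; rewrite eqEdim H dker ?dW1 //.
    by apply/orP; right; case: g => _; apply: contra => /eqP ->; rewrite mulmx0.
  apply/esym/eqP; rewrite eqEdim dker ?H // dW1 leqnn andbT.
  apply/subvP => w wk.
  have : w \in limg (T (Mrep k l) (val b).1 (val x).2).
    suff -> : limg (T (Mrep k l) (val b).1 (val x).2) = fullv by apply: memvf.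
    apply/eqP; rewrite eqEdim subvf dim_rV -rk_dim -rk_id !rk_Mrep /=.
    by rewrite rij' dj.
  move=> /memv_imgP[v _ wE]; move: wk; rewrite wE cutj mem_cutT // => /(subvP cW).
  by rewrite !memv_ker T_comp // ltnW.
rewrite dimv0 dW1 dj.
by rewrite subn0 -mulnn expn1 -{3}[#|k|]mul1n -mulnBl subn1.
Qed.

End Structure.

(** * Quotients with simple top *)

Section Generators.
Variable k : finFieldType.
Local Notation hall := (hall k).

(** Here x = [i, i], b = [i + 1, j] and a = [i, j]. A nonsplit extension is below b and has a root
    covering b, which must then start at i and be a. *)
Lemma hall_bracket (a x b : posroot) (l : P) :
  (val x).1 = (val a).1 -> (val x).2 = (val a).1 -> (val b).1 = (val a).1.+1 ->
  (val b).2 = (val a).2 -> hall [mset x]%mset [mset b]%mset l =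
  ((l == [mset a]%mset) + (l == [mset b] `+` [mset x])%mset)%N.
Proof.
move=> x1 x2 b1 b2.
have b12 : ((sval b).1 <= (sval b).2)%N := valP b.
have a12 : ((sval a).1 <= (sval a).2)%N := valP a.
have xb : rlt x b by move: x2 b1 b12; rewrite /rlt /=; lia.
have axb : ([mset a] != [mset b] `+` [mset x] :> P)%mset.
  apply/eqP => /(congr1 (fun l : P => size l)).
  have /perm_size -> : perm_eq (([mset b] `+` [mset x] : P)%mset) [:: b; x].
    by apply/allP => c _ /=; rewrite count_mem_mset msetE2 !msetnE !(eq_sym c) addn0; case: eqP; case: eqP.
  by rewrite enum_msetn.
case: eqVneq => [->|la].
  by rewrite (hall_bracket_simple _ x1 x2 b1 b2) (negPf axb).
case: eqVneq => [->|lxb].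
  rewrite msetDC hall_pair // x2 b1 ltnn andbF //.
apply/eqP; apply: contraT => /eqP/[dup] h0 /(hall_ext xb)[lE|bl].
  by move: lxb; rewrite lE msetDC eqxx.
have [ld lr] := hall_R h0; have := lr _ _ b12.
rewrite !R_mset1 {2}/spans !leqnn b12 /= => /(leq_trans (leq_addl _ _)) /R_span[c cl cb].
case/eqP: la; apply: mset_root => [p|].
  by rewrite ld !R_mset1; move: b12 a12 x1 x2 b1 b2; rewrite /spans /=; lia.
apply: (R_gt0 cl); move: (bl _ cl) cb b1 b2 a12.
by rewrite /rlt /spans /=; lia.
Qed.

Lemma hall_bracket_rev (a x b : posroot) (l : P) :
  (val x).1 = (val a).1 -> (val x).2 = (val a).1 -> (val b).1 = (val a).1.+1 ->
  (val b).2 = (val a).2 -> hall [mset b]%mset [mset x]%mset l =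
  (l == [mset b] `+` [mset x])%mset.
Proof.
move=> x1 x2 b1 b2; have b12 : ((sval b).1 <= (sval b).2)%N := valP b.
have xb : rlt x b by move: x2 b1 b12; rewrite /rlt /=; lia.
have bx : beloweq b [mset x]%mset by move=> c; rewrite in_mset1 => /eqP ->; rewrite xb orbT.
case: eqVneq => [->|lxb].
  rewrite hall_top_eq // msetnE (_ : b == x = false) ?/qn ?big_ord1 //.
  by apply/eqP => E; move: xb; rewrite E /rlt !ltnn andbF.
by apply/eqP; apply: contraT => /eqP/(hall_top bx) lE; case/eqP: lxb.
Qed.

(** If the kernel of f is not contained in the hyperplane, the two together span everything and the
    hyperplane already has the full image; otherwise the image loses one dimension. *)
Lemma dim_img_hyper n m (f : 'Hom('rV[k]_n, 'rV[k]_m)) (phi : 'cV[k]_n) : phi != 0 ->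
  (\dim (f @: lker (mulv phi)) + (lker f <= lker (mulv phi))%VS)%N = \dim (limg f).
Proof.
move=> phi0; have dk := dim_ker phi0; set H := lker (mulv phi) in dk *.
have := limg_ker_dim f fullv; rewrite capfv dim_rV => dF.
have := limg_ker_dim f H => dH; case: (boolP (lker f <= H)%VS) => [fH|nfH].
  move: dH; rewrite (capv_idPr fH) => dH; apply: (@addnI (\dim (lker f))).
  by rewrite addnA dH dF addn1.
have HfE : (H + lker f)%VS = fullv.
  apply/eqP; rewrite eqEdim subvf dim_rV -[X in (X <= _)%N]dk ltn_neqAle dimvS ?addvSl // andbT.
  apply: contra nfH => /eqP E; apply/addv_idPl/eqP.
  by rewrite eq_sym eqEdim addvSl /= -E.
have := dimv_sum_cap H (lker f); rewrite HfE dim_rV -[X in (X + _)%N]dk addSn -addnS.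
move=> /addnI E; rewrite addn0; apply: (@addnI (\dim (lker f))).
by rewrite [RHS]dF -[RHS]dk -[X in (X + _)%N]E addSn dH.
Qed.

Section SimpleTop.
Variables (x : posroot) (b l : P).
Hypothesis x12 : (val x).1 = (val x).2.
Local Notation i := (val x).2.
Local Notation M := (Mrep k l).

Lemma rkS_cut_simple phi p q : @good k M x phi -> (p <= q)%N ->
  (rkS (cut phi) (@zfam _ M) p q +
    ((p == i) && (lker (T M i q) <= lker (mulv phi))%VS))%N = R l p q.
Proof.
move=> g pq; rewrite -(rk_Mrep k) rk_dim rkS_sub; case: eqVneq => [pi|npi] /=.
  have c : cut phi i = lker (mulv phi) by rewrite /cut pth_id mul1mx.
  rewrite {}pi c dim_img_hyper //.
  by case: g => _; apply: contra => /eqP ->; rewrite mulmx0.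
rewrite addn0 typ_full // (rkS_good g) // /spans x12.
by rewrite leqnn /= -eqn_leq eq_sym (negPf npi).
Qed.

Lemma typ_cut_simple phi : @good k M x phi ->
  typ (cut phi) (@zfam _ M) b <-> forall p q, (p <= q)%N ->
   R l p q = (R b p q + ((p == i) && (lker (T M i q) <= lker (mulv phi))%VS))%N.
Proof.
move=> g; split=> H p q pq; have := rkS_cut_simple g pq; first by rewrite H.
by rewrite H // => /addIn.
Qed.

(* The subrepresentation cut out by a functional phi on the vertex i of S_i differs from M at the
   vertex i only, so its type depends on phi through the kernels of M_i -> M_q, q <= n, that phi
   contains. *)
Definition drops n := (i <= n)%N /\
  forall p q, (p <= q)%N -> R l p q = (R b p q + ((p == i) && (q <= n)%N))%N.

(** The number of roots of l that start at i and reach n. By [dim_topker] it is, for i <= n, also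
    the dimension of the functionals on M_i that vanish on the image of M_(i - 1) and on the kernel
    of M_i -> M_n. *)
Definition mult_top n := (R l i n - (0 < i) * R l i.-1 n)%N.

Lemma lkerT_sub m n : (i <= m)%N -> (m <= n)%N -> (lker (T M i m) <= lker (T M i n))%VS.
Proof.
move=> im mn; apply/subvP => v; rewrite !memv_ker => /eqP v0.
by rewrite -(T_comp _ im mn) v0 linear0.
Qed.

(** n is the last vertex for which phi vanishes on the kernel of M_i -> M_n. It exists because for
    large n this kernel is all of M_i, while phi is not zero. *)
Lemma hall_simple_drops : hall [mset x]%mset b l <> 0%N -> exists n, drops n.
Proof.
move=> /hallP[U [sU tb tx]].
have [phi [g UE]] : exists phi, @good k M x phi /\ U = cut phi.
  by apply: cutP => // p q pq; rewrite tx // R_mset1.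
have phi0 : phi != 0 by case: g => _; apply: contra => /eqP ->; rewrite mulmx0.
pose K n := (i <= n)%N && (lker (T M i n) <= lker (mulv phi))%VS.
have Ki : exists n, K n.
  exists i; rewrite /K leqnn /=; apply/subvP => v.
  by rewrite !memv_ker T_id id_lfunE => /eqP ->; rewrite linear0.
have [B lB] := R_bound l.
have KB n : K n -> (n <= B)%N.
  move=> /andP[_ Kn]; rewrite leqNgt; apply: contra phi0 => Bn.
  have : (fullv <= lker (mulv phi))%VS.
    apply: subv_trans Kn; rewrite lkerE -dimv_eq0 -rk_dim rk_Mrep lB //; exact: ltnW.
  by rewrite lkerE -dimv_eq0 dim_mulv mxrank_eq0.
have [n Kn nmax] := ex_maxnP Ki KB; exists n; split; first by case/andP: Kn.
move: tb; rewrite UE => /(typ_cut_simple g) H p q pq; rewrite H //; congr (_ + nat_of_bool _)%N.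
case: eqVneq => //= pi; rewrite {}pi in pq *; apply/idP/idP => [Kq|qn].
  by apply: nmax; rewrite /K pq.
by case/andP: Kn => _; apply/subv_trans/lkerT_sub.
Qed.

Lemma dim_topker n : (i <= n)%N ->
  (R l i i - \dim (W0 M x + lker (T M i n)))%N = mult_top n.
Proof.
move=> im; have := limg_ker_dim (T M i n) (W0 M x + lker (T M i n)).
rewrite (capv_idPr (addvSr _ _)) limgD.
have -> : (T M i n @: lker (T M i n) = 0)%VS by apply/eqP; rewrite -lkerE.
rewrite addv0.
have -> : \dim (T M i n @: W0 M x) = ((0 < i) * R l i.-1 n)%N.
  rewrite /W0 x12; case: posnP => [i0|i1]; first by rewrite limg0 dimv0.
  rewrite mul1n -(rk_Mrep k) rk_dim -limg_comp; congr (\dim (limg _)).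
  by apply/lfunP => v; rewrite comp_lfunE T_comp // leq_pred.
have := limg_ker_dim (T M i n) fullv; rewrite capfv dim_rV -rk_dim => E1 E2.
rewrite -[X in (X - _)%N](rk_Mrep k) rk_id -[X in (X - _)%N]E1 -[X in (_ - X)%N]E2.
by rewrite subnDl rk_Mrep.
Qed.

(** The functionals wanted are those vanishing on [W n] but not on [W n.+1]: the second condition
    makes n the last vertex at which the rank drops. *)
Lemma hall_simple_val n : drops n ->
  (hall [mset x]%mset b l + qn #|k| (mult_top n.+1) = qn #|k| (mult_top n))%N.
Proof.
move=> [i_n dn]; pose W m := (W0 M x + lker (T M i m))%VS.
have WS : (W n <= W n.+1)%VS by apply: addvS => //; apply: lkerT_sub.
have q0 : (0 < #|k|)%N by apply: ltnW (card_k1 k).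
have le : (mult_top n.+1 <= mult_top n)%N.
  by rewrite -!dim_topker ?(leqW i_n) // leq_sub2l // dimvS.
have leq : (qn #|k| (mult_top n.+1) <= qn #|k| (mult_top n))%N.
  by rewrite -(@leq_pmul2l #|k|.-1) ?qnE ?leq_sub2r ?leq_pexp2l //; have := card_k1 k; case: #|k| => [|[]].
suff -> : hall [mset x]%mset b l = (qn #|k| (mult_top n) - qn #|k| (mult_top n.+1))%N.
  by rewrite subnK.
apply: (hall_cut_diff WS); last first.
  rewrite !dim_topker ?(leqW i_n) // mulnBr !qnE //.
  by rewrite subnBA ?expn_gt0 ?q0 // subnK ?expn_gt0 ?q0.
move=> phi; rewrite !subv_add; split=> [[g /(typ_cut_simple g) H]|].
  have /goodE/andP[-> _] := g; rewrite /=.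
  have := H i n i_n; rewrite dn // eqxx leqnn /= => /addnI.
  have := H i n.+1 (leqW i_n); rewrite dn ?(leqW i_n) // eqxx ltnn /= => /addnI.
  by case: (_ <= _)%VS => //; case: (_ <= _)%VS.
move=> /andP[/andP[w0 kn]]; rewrite w0 /= => kn1.
have phi0 : phi != 0.
  by apply: contra kn1 => /eqP ->; apply/subvP => v _; rewrite memv_ker mulvE mulmx0.
have g : @good k M x phi.
  apply/goodE; rewrite w0 /= x12 img_ker pth_id mul1mx //.
split=> //; apply/(typ_cut_simple g) => p q pq; rewrite dn //; congr (_ + nat_of_bool _)%N.
case: eqVneq => //= pi; rewrite {}pi in pq *; apply/idP/idP => [qn|].
  by apply: subv_trans kn; apply: lkerT_sub.
rewrite leqNgt; apply: contraL => nq; apply: contra kn1.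
by apply: subv_trans; apply: lkerT_sub => //; apply: leqW.
Qed.

End SimpleTop.

End Generators.

(** * Hall polynomials *)

Section IntPoly.
Import Order.TTheory Num.Theory.
Implicit Types (F r : {poly int}).

Definition qp n : {poly int} := \sum_(t < n) 'X^t.

Lemma horner_qp (q n : nat) : (qp n).[q%:R] = (qn q n)%:R.
Proof.
rewrite /qp /qn horner_sum natr_sum; apply: eq_bigr => t _.
by rewrite hornerXn natrX.
Qed.

Lemma qp_monic n : qp n.+1 \is monic /\ size (qp n.+1) = n.+1.
Proof.
have E : qp n.+1 = \poly_(t < n.+1) 1.
  by rewrite /qp poly_def; apply: eq_bigr => t _; rewrite scale1r.
have s : size (qp n.+1) = n.+1 by rewrite E size_poly_eq ?oner_eq0.
by split=> //; rewrite monicE /lead_coef s E coef_poly ltnSn.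
Qed.

(** Primes are the cardinalities of the fields ['F_p]. A prime above the sum of the absolute values
    of the roots collected so far is a new root. *)
Lemma poly_zero_primes F : (forall p : nat, prime p -> F.[p%:R] = 0) -> F = 0.
Proof.
move=> F0; apply/eqP; apply: contraT => nF.
suff [s [us ss rs]] : exists s : seq int, [/\ uniq s, size s = size F & all (root F) s].
  by have := max_poly_roots nF rs us; rewrite ss ltnn.
elim: (size F) => [|n [s [us ss rs]]]; first by exists [::].
have [p pl pp] := prime_above (\sum_(x <- s) `|x|%N)%N.
exists ((p%:R : int) :: s); rewrite /= us ss rs rootE F0 // eqxx !andbT; split=> //.
apply/negP => ps; move: pl; rewrite ltnNge => /negP; apply.
by rewrite (big_rem _ ps) /= natz absz_nat leq_addr.
Qed.

Lemma poly_bound r : exists N : nat, forall q : nat, (N < q)%N ->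
  (`|r.[q%:R]| < q ^ size r)%N.
Proof.
exists (\sum_(t < size r) `|(r`_t)%R|)%N => q Nq.
have q0 : (0 < q)%N by apply: leq_ltn_trans Nq.
case: (posnP (size r)) => [s0|s0].
  by move/eqP: (s0); rewrite size_poly_eq0 => /eqP ->; rewrite horner0 absz0 expn_gt0 q0.
rewrite horner_coef.
apply: (@leq_ltn_trans ((\sum_(t < size r) `|(r`_t)%R|) * q ^ (size r).-1)%N); last first.
  by rewrite -[X in (_ < _ ^ X)%N](prednK s0) expnS ltn_pmul2r ?expn_gt0 ?q0.
rewrite big_distrl /=.
apply: (@leq_trans (\sum_(t < size r) `|(r`_t * q%:R ^+ t)%R|)%N).
  apply: (big_ind2 (fun (x : int) (y : nat) => `|x| <= y)%N) => //.
  move=> x1 x2 y1 y2 le1 le2; apply: leq_trans (leq_add le1 le2).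
  by rewrite -lez_nat PoszD !abszE ler_normD.
apply: leq_sum => t _; rewrite abszM abszX leq_mul2l; apply/orP; right.
by rewrite natz absz_nat leq_pexp2l // -ltnS prednK.
Qed.

End IntPoly.

Section Uniform.
Import Order.TTheory Num.Theory.

(** The values are natural numbers but the coefficients may be negative, as differences of counts
    occur. *)
Definition uniform (f : finFieldType -> nat) :=
  exists F : {poly int}, forall k, (f k)%:R = F.[#|k|%:R].

Lemma eq_uniform f g : f =1 g -> uniform g -> uniform f.
Proof. by move=> fg [F FP]; exists F => k; rewrite fg. Qed.

Lemma uniform_cst n : uniform (fun=> n).
Proof. by exists n%:R%:P => k; rewrite hornerC. Qed.

Lemma uniform_sum (I : Type) (s : seq I) (f : I -> finFieldType -> nat) :
  (forall x, uniform (f x)) -> uniform (fun k => \sum_(x <- s) f x k)%N.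
Proof.
move=> uf; elim: s => [|x s [F FP]].
  by apply: eq_uniform (uniform_cst 0) => k; rewrite big_nil.
have [G GP] := uf x; exists (G + F) => k.
by rewrite big_cons natrD GP FP hornerD.
Qed.

Lemma uniform_mul f g : uniform f -> uniform g -> uniform (fun k => f k * g k)%N.
Proof.
by move=> [F FP] [G GP]; exists (F * G) => k; rewrite natrM FP GP hornerM.
Qed.

Lemma uniform_sub f g h : (forall k, f k + g k = h k)%N -> uniform g -> uniform h ->
  uniform f.
Proof.
move=> E [G GP] [H HP]; exists (H - G) => k.
by rewrite hornerD hornerN -GP -HP -E natrD addrK.
Qed.

(* Division by the monic polynomial [n+1]_x leaves a remainder whose values are, for large q,
   multiples of [n+1]_q too small to be nonzero. *)
Lemma uniform_div f n : uniform (fun k => qn #|k| n.+1 * f k)%N -> uniform f.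
Proof.
move=> [G GP]; have [mon sz] := qp_monic n.
pose Q := Pdiv.Ring.rdivp G (qp n.+1); pose r := Pdiv.Ring.rmodp G (qp n.+1).
have GE : G = Q * qp n.+1 + r by apply: Pdiv.RingMonic.rdivp_eq.
have sr : (size r <= n)%N.
  by rewrite -ltnS -[X in (_ < X)%N]sz Pdiv.Ring.ltn_rmodpN0 ?monic_neq0.
have rE (k : finFieldType) : r.[#|k|%:R] = ((f k)%:R - Q.[#|k|%:R]) * (qn #|k| n.+1)%:R.
  rewrite mulrBl -natrM mulnC GP {1}GE hornerD hornerM horner_qp.
  by rewrite addrAC subrr add0r.
have [N rN] := poly_bound r.
have r0 : r = 0.
  (* The estimate for r holds beyond N only; h vanishes at 0, ..., N, so that [r * h] vanishes at
     every prime. *)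
  pose h := \prod_(t < N.+1) ('X - (t%:R)%:P) : {poly int}.
  suff /eqP : r * h = 0.
    rewrite mulf_eq0 => /orP[/eqP //|/eqP h0]; exfalso; move/eqP: h0.
    by rewrite prodf_seq_eq0 => /hasP[t _]; rewrite polyXsubC_eq0.
  apply: poly_zero_primes => p pp; rewrite hornerM.
  case: (leqP p N) => pN.
    apply/eqP; rewrite mulf_eq0; apply/orP; right.
    rewrite horner_prod; apply/prodf_eq0; have pN' : (p < N.+1)%N by [].
    by exists (Ordinal pN') => //; rewrite hornerXsubC subrr.
  have := rE 'F_p; rewrite card_Fp // => E; rewrite E.
  have := rN p pN; rewrite E abszM.
  case: (eqVneq ((f 'F_p)%:R - Q.[p%:R]) 0) => [->|nz]; first by rewrite !mul0r.
  move=> lt; exfalso; move: lt; rewrite ltnNge => /negP; apply.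
  apply: leq_trans (_ : qn p n.+1 <= _)%N.
    rewrite /qn big_ord_recr /=; apply: leq_trans (leq_addl _ _).
    by rewrite leq_pexp2l // prime_gt0.
  by rewrite [X in (_ <= _ * `|X|)%N]natz absz_nat leq_pmull // absz_gt0.
exists Q => k; have := rE k; rewrite r0 horner0 => /esym/eqP; rewrite mulf_eq0.
case/orP => [|/eqP q0]; first by rewrite subr_eq0 => /eqP.
exfalso; move: q0; rewrite /qn big_ord_recl expn0 => /eqP.
by rewrite pnatr_eq0.
Qed.

End Uniform.

Section HallPolynomials.
Import Order.TTheory Num.Theory.
Implicit Types (a b l : P).

Lemma hall_box l : exists2 S : seq P, uniq S & forall k a b,
  hall k a b l <> 0%N -> (a \in S) /\ (b \in S).
Proof.
have [S uS SP] := box_ex l; exists S => // k a b /hall_R[ld _].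
by split; apply: SP => p; rewrite ld ?leq_addr ?leq_addl.
Qed.

Lemma hall_assoc_box l (S : seq P) : uniq S ->
  (forall k a b, hall k a b l <> 0%N -> (a \in S) /\ (b \in S)) ->
  forall k a b c, (\sum_(m <- S) hall k b c m * hall k a m l =
    \sum_(n <- S) hall k a b n * hall k n c l)%N.
Proof. by move=> uS SP k a b c; apply: hall_assoc => // m /SP[]. Qed.

Lemma sum_delta (S : seq P) (n : P) (g : P -> nat) : uniq S -> (g n <> 0%N -> n \in S) ->
  (\sum_(m <- S) (m == n) * g m = g n)%N.
Proof.
move=> uS gS; case: (boolP (n \in S)) => [nS|nS].
  rewrite (bigD1_seq n) //= eqxx mul1n big1 ?addn0 // => m /negPf ->.
  by rewrite mul0n.
have -> : g n = 0%N by case: (g n) gS nS => [//|?] /(_ _) -> //.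
rewrite big1_seq // => m /= mS; case: eqVneq => // E.
by rewrite E (negPf nS) in mS.
Qed.

(** [drops] and [mult_top] refer to roots and not to a field, so one case distinction and one
    formula serve all fields. *)
Lemma uniform_simple (x : posroot) b l : (val x).1 = (val x).2 ->
  uniform (fun k => hall k [mset x]%mset b l).
Proof.
move=> x12; case: (pselect (exists n, drops x b l n)) => [[n dn]|nd].
  apply: (@uniform_sub _ (fun k => qn #|k| (mult_top x l n.+1))
    (fun k => qn #|k| (mult_top x l n))) => [k||].
  - exact: hall_simple_val.
  - by exists (qp (mult_top x l n.+1)) => k; rewrite horner_qp.
  - by exists (qp (mult_top x l n)) => k; rewrite horner_qp.
apply: eq_uniform (uniform_cst 0) => k; apply/eqP; apply: contraT => /eqP h0.
by case: nd; apply: hall_simple_drops h0.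
Qed.

Lemma uniform_root (a : posroot) b l : uniform (fun k => hall k [mset a]%mset b l).
Proof.
have [d] := ubnP ((val a).2 - (val a).1); elim: d a b l => // d IHd a b l; rewrite ltnS => ad.
have := valP a; rewrite leq_eqVlt => /orP[/eqP|a12]; first exact: uniform_simple.
pose x : posroot := exist (fun p => (p.1 <= p.2)%N) ((val a).1, (val a).1) (leqnn _).
pose b' : posroot := exist (fun p => (p.1 <= p.2)%N) ((val a).1.+1, (val a).2) a12.
have [S uS SP] := hall_box l; have assoc := hall_assoc_box uS SP.
have ux c m : uniform (fun k => hall k [mset x]%mset c m) by apply: uniform_simple.
have ub c m : uniform (fun k => hall k [mset b']%mset c m).
  by apply: IHd; apply: leq_trans ad; rewrite /= subnS ltn_predL subn_gt0.
(* The coefficient of u_l in u_a u_b = u_x (u_b' u_b) - u_b' (u_x u_b), for the product without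
   powers of s. The roots x and b' are shorter than a, and x is simple. *)
apply: (@uniform_sub _
  (fun k => \sum_(m <- S) hall k [mset x]%mset b m * hall k [mset b']%mset m l)%N
  (fun k => \sum_(m <- S) hall k [mset b']%mset b m * hall k [mset x]%mset m l)%N).
- move=> k.
  have D (n : P) : (\sum_(m <- S) (m == n) * hall k m b l = hall k n b l)%N.
    by apply: (@sum_delta S n (fun m => hall k m b l)) => // /SP[].
  rewrite (assoc k _ _ b) (assoc k _ _ b) -(D [mset a]%mset).
  have -> : (\sum_(n <- S) hall k [mset b']%mset [mset x]%mset n * hall k n b l =
      hall k ([mset b'] `+` [mset x])%mset b l)%N.
    rewrite -D; apply: eq_bigr => n _; congr (_ * _)%N.
    exact: (@hall_bracket_rev k a x b' n).
  rewrite -(D ([mset b'] `+` [mset x])%mset) -big_split.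
  apply: eq_bigr => n _; rewrite (@hall_bracket k a x b' n) //.
  exact/esym/mulnDl.
- by apply: uniform_sum => m; apply: uniform_mul.
- by apply: uniform_sum => m; apply: uniform_mul.
Qed.

Lemma rlt_total (x y : posroot) : [|| x == y, rlt x y | rlt y x].
Proof.
suff : x = y \/ rlt x y \/ rlt y x by move=> [->|[->|->]]; rewrite ?eqxx ?orbT.
case: (ltngtP (val x).2 (val y).2) => h2; rewrite /rlt ?h2 ?ltnn ?eqxx /=; try by auto.
case: (ltngtP (val x).1 (val y).1) => h1; try by auto.
left; apply: val_inj; move: h1 h2 => /=; case: (sval x) => ? ?; case: (sval y) => ? ? /=.
by move=> -> ->.
Qed.

Lemma rlt_trans : transitive rlt.
Proof. by move=> y x z; rewrite /rlt; lia. Qed.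

Lemma rlt_irr x : rlt x x = false.
Proof. by rewrite /rlt !ltnn andbF. Qed.

Lemma max_root (s : seq posroot) : s != [::] ->
  exists2 b : posroot, b \in s & forall c, c \in s -> (c == b) || rlt c b.
Proof.
elim: s => // a [|a' s] IHs _; first by exists a => [|c]; rewrite inE // => ->.
have [//|b bs bP] := IHs; case/or3P: (rlt_total a b) => [/eqP ab|ab|ba].
- exists b => [|c]; first by rewrite inE bs orbT.
  by rewrite inE => /orP[/eqP ->|/bP //]; rewrite ab eqxx.
- exists b => [|c]; first by rewrite inE bs orbT.
  by rewrite inE => /orP[/eqP ->|/bP //]; rewrite ab orbT.
- exists a => [|c]; first exact: mem_head.
  rewrite inE => /orP[->//|/bP/orP[/eqP ->|cb]]; first by rewrite ba orbT.
  by rewrite (rlt_trans cb ba) orbT.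
Qed.

(** Induction by removal of a largest root; [beloweq] is the condition under which u_b u_m has a
    single term. *)
Lemma mset_max_ind (Q : P -> Prop) : Q mset0 ->
  (forall (b : posroot) m, beloweq b m -> Q m -> Q ([mset b] `+` m)%mset) -> forall l, Q l.
Proof.
move=> Q0 QS l; have [n] := ubnP (size l); elim: n l => // n IHn l; rewrite ltnS => ln.
case: (eqVneq (l : seq posroot) [::]) => [l0|/max_root[b bl bP]].
  suff -> : l = mset0 by [].
  by apply/msetP => c; rewrite -count_mem_mset l0 mset0E.
have [m lE] := mset_split bl; rewrite lE; apply: QS.
  by move=> c cm; apply: bP; rewrite lE in_msetD cm orbT.
apply: IHn; apply: leq_trans ln; rewrite lE.
have /perm_size -> : perm_eq ([mset b] `+` m)%mset (b :: m).
  apply/allP => c _ /=; rewrite !count_mem_mset msetE2 msetnE (eq_sym b).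
  by case: eqP.
by [].
Qed.

(* By hall_top, u_r u_a = [a(r) + 1] u_(r + a) when no root of a exceeds r, so associativity gives
   the case of r + a up to the factor [a(r) + 1]. *)
Lemma hall_uniform a b l : uniform (fun k => hall k a b l).
Proof.
elim/mset_max_ind: a b l => [|r a ra IHa] b l.
  by apply: eq_uniform (uniform_cst (b == l)) => k; rewrite hall0l.
apply: (@uniform_div _ (a r)).
have [S uS SP] := hall_box l; have assoc := hall_assoc_box uS SP.
apply: (@eq_uniform _ (fun k => \sum_(m <- S) hall k a b m * hall k [mset r]%mset m l)%N).
  move=> k; rewrite assoc -(@hall_top_eq k r a ra).
  rewrite -(@sum_delta S ([mset r] `+` a)%mset (fun n => hall k [mset r]%mset a n * hall k n b l)%N uS).
    apply: eq_bigr => n _; case: eqVneq => [->|nra]; first by rewrite mul1n.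
    rewrite mul0n; apply/esym/eqP; rewrite muln_eq0; apply/orP; left; apply: contraT => /eqP.
    by move/(hall_top ra) => nE; case/eqP: nra.
  by move=> h0; have [] := SP k ([mset r] `+` a)%mset b; first by move=> E; rewrite E muln0 in h0.
by apply: uniform_sum => m; apply: uniform_mul; [apply: IHa | apply: uniform_root].
Qed.

Lemma hallsetP (k : finFieldType) a b l U :
  [/\ @is_subrep k (Mrep k l) U, subrep_isom U (Mrep k b) & quotient_isom U (Mrep k a)]
  <-> @hallset k (Mrep k l) a b U.
Proof.
split=> [[/stableP sU /(subrepP _ sU) tb /(quotientP _ sU) ta]|[sU tb ta]].
  by split=> // p q pq; rewrite ?tb ?ta // rk_Mrep.
split; first exact/stableP.
  by apply/(subrepP _ sU) => p q pq; rewrite tb // rk_Mrep.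
by apply/(quotientP _ sU) => p q pq; rewrite ta // rk_Mrep.
Qed.

Lemma hall_set_card (k : finFieldType) a b l :
  ([set U | [/\ @is_subrep k (Mrep k l) U, subrep_isom U (Mrep k b)
               & quotient_isom U (Mrep k a)]] #= `I_(hall k a b l))%classic%card.
Proof.
pose B := [set F : bfam (Mrep k l) | `[< hallset a b (ext F) >]].
have memB U : (res U \in B) <-> hallset a b U by rewrite !inE resK.
apply/card_set_bijP; exists (fun U => index (res U) (enum B)); split.
- move=> U /= /hallsetP/memB UB.
  by rewrite /hall /cnt -/B cardE index_mem mem_enum.
- move=> U V; rewrite !inE => /hallsetP/memB UB /hallsetP/memB VB E.
  rewrite -(resK U) -(resK V) -(nth_index (res U) (_ : res U \in enum B)) ?mem_enum //.
  by rewrite E nth_index ?mem_enum.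
- move=> n /=; rewrite /hall /cnt -/B cardE => nB.
  pose F := nth (res (@zfam _ _)) (enum B) n.
  have FB : F \in B by rewrite -mem_enum mem_nth.
  exists (ext F); last by rewrite extK index_uniq // enum_uniq.
  by apply/hallsetP/memB; rewrite extK.
Qed.

(** [hall_uniform] supplies the existence that the choice made by [xget] requires; from here on Hall
    polynomials can be evaluated. *)
Lemma hall_polyE (k : finFieldType) a b l : (hall_poly a b l).[#|k|%:R] = (hall k a b l)%:R.
Proof.
have [F FP] := hall_uniform a b l.
have : is_hall_poly a b l (hall_poly a b l).
  apply: (@xgetPex _ _ [set F | is_hall_poly a b l F]%classic); exists F => /= k'.
  by exists (hall k' a b l); [rewrite FP | apply: hall_set_card].
move=> /(_ k)[n -> cn]; congr (_%:R); apply/card_eq_II.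
by apply: card_eq_trans (hall_set_card k a b l); rewrite card_eq_sym.
Qed.

End HallPolynomials.

Section PolyIdentities.
Import Order.TTheory Num.Theory.
Implicit Types (a b l m : P).

Lemma poly_eq_primes (F G : {poly int}) :
  (forall k : finFieldType, F.[#|k|%:R] = G.[#|k|%:R]) -> F = G.
Proof.
move=> FG; apply/eqP; rewrite -subr_eq0; apply/eqP/poly_zero_primes => p pp.
by have := FG 'F_p; rewrite card_Fp // hornerD hornerN => ->; rewrite subrr.
Qed.

Lemma hall_poly_eq a b l F : (forall k : finFieldType, (hall k a b l)%:R = F.[#|k|%:R]) ->
  hall_poly a b l = F.
Proof. by move=> H; apply: poly_eq_primes => k; rewrite hall_polyE. Qed.

Lemma hall_poly_neq0 a b l : hall_poly a b l != 0 -> exists k, hall k a b l <> 0%N.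
Proof.
move=> h0; apply: contrapT => nk; case/eqP: h0; apply: hall_poly_eq => k.
rewrite horner0; apply/eqP; rewrite pnatr_eq0; apply: contraT => /eqP hk.
by case: nk; exists k.
Qed.

Lemma hall_poly_box l (S : seq P) :
  (forall k a b, hall k a b l <> 0%N -> (a \in S) /\ (b \in S)) ->
  forall a b, hall_poly a b l != 0 -> (a \in S) /\ (b \in S).
Proof. by move=> SP a b /hall_poly_neq0[k]; apply: SP. Qed.

Lemma hall_poly_assoc l (S : seq P) : uniq S ->
  (forall k a b, hall k a b l <> 0%N -> (a \in S) /\ (b \in S)) ->
  forall a b (c : P), \sum_(m <- S) hall_poly b c m * hall_poly a m l =
    \sum_(m <- S) hall_poly a b m * hall_poly m c l.
Proof.
move=> uS SP a b c; apply: poly_eq_primes => k.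
rewrite !horner_sum; under eq_bigr => m _ do rewrite hornerM !hall_polyE -natrM.
under [RHS]eq_bigr => m _ do rewrite hornerM !hall_polyE -natrM.
by rewrite -!natr_sum (hall_assoc_box uS SP).
Qed.

Lemma hall_poly0l b l : hall_poly mset0 b l = (b == l)%:R.
Proof.
apply: hall_poly_eq => k; rewrite hall0l; by case: eqP; rewrite ?hornerC.
Qed.

Lemma hall_poly0r a l : hall_poly a mset0 l = (a == l)%:R.
Proof.
apply: hall_poly_eq => k; rewrite hall0r; by case: eqP; rewrite ?hornerC.
Qed.

Lemma hall_poly_diag a b l : hall_poly a b l != 0 ->
  forall p, R l p p = (R a p p + R b p p)%N.
Proof. by move=> /hall_poly_neq0[k /hall_R[]]. Qed.

Lemma hall_poly_below a b l (c : posroot) : below c a -> below c b -> hall_poly a b l != 0 -> below c l.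
Proof. by move=> ca cb /hall_poly_neq0[k]; apply: hall_below. Qed.

Lemma hall_poly_top (b : posroot) m l : beloweq b m ->
  hall_poly [mset b]%mset m l = if l == ([mset b] `+` m)%mset then qp (m b).+1 else 0.
Proof.
move=> bm; case: eqVneq => [->|lbm]; apply: hall_poly_eq => k.
  by rewrite hall_top_eq // horner_qp.
rewrite horner0; apply/eqP; rewrite pnatr_eq0; apply: contraT => /eqP.
by move/(hall_top bm) => E; case/eqP: lbm.
Qed.

Lemma hall_poly_pair (x b : posroot) : rlt x b ->
  hall_poly [mset x]%mset [mset b]%mset ([mset x] `+` [mset b])%mset =
  'X^((val x).1 <= (val b).1 <= (val x).2)%N.
Proof.
move=> xb; apply: hall_poly_eq => k; rewrite hall_pair // hornerXn.
by case: ifP.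
Qed.

Lemma hall_poly_ext (x b : posroot) l : rlt x b ->
  hall_poly [mset x]%mset [mset b]%mset l != 0 ->
  l = ([mset x] `+` [mset b])%mset \/ below b l.
Proof. by move=> xb /hall_poly_neq0[k]; apply: hall_ext. Qed.

End PolyIdentities.

(** * The Euler form *)

Section Euler.
Import Order.TTheory Num.Theory.
Variable k : fieldType.
Implicit Types (a b c l m : P).

Definition eulN a b N : int :=
  \sum_(i < N) ((R a i i)%:Z * (R b i i)%:Z - (R a i i)%:Z * (R b i.+1 i.+1)%:Z).

Lemma rdim_Mrep a i : rdim (Mrep k a) i = R a i i.
Proof. by rewrite -rk_id rk_Mrep. Qed.

(** Kernel and cokernel of the coboundary have the dimensions of its source and target minus its
    rank; the rank cancels, and only dimension vectors remain. *)
Lemma euler_eulN a b : euler k a b = eulN a b (rbound (Mrep k a)).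
Proof.
rewrite /euler /dim_Hom /dim_Ext1 mxrank_ker mxrank_coker.
set A := lin1_mx _; set n := rbound (Mrep k a) in A *.
have r1 : (\rank A <= \sum_(i < n.+1) rdim (Mrep k a) i * rdim (Mrep k b) i)%N := rank_leq_row A.
have r2 : (\rank A <= \sum_(i < n) rdim (Mrep k a) i * rdim (Mrep k b) i.+1)%N := rank_leq_col A.
rewrite -!subzn // opprB addrA subrK big_ord_recr /= rdim_eq0 // mul0n addn0.
have E (F : nat -> nat) : (\sum_(i < n) F i)%N%:Z = \sum_(i < n) (F i)%:Z.
  by rewrite (big_morph Posz PoszD (erefl _)).
rewrite (E (fun i => rdim (Mrep k a) i * rdim (Mrep k b) i)%N).
rewrite (E (fun i => rdim (Mrep k a) i * rdim (Mrep k b) i.+1)%N).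
rewrite /eulN sumrB.
by congr (_ - _); apply: eq_bigr => i _; rewrite !rdim_Mrep PoszM.
Qed.

Lemma eulN_ge a b N : (rbound (Mrep k a) <= N)%N -> eulN a b N = euler k a b.
Proof.
move=> aN; rewrite euler_eulN /eulN.
rewrite -!(big_mkord xpredT (fun i => (R a i i)%:Z * (R b i i)%:Z - (R a i i)%:Z * (R b i.+1 i.+1)%:Z)).
rewrite [LHS](@big_cat_nat _ _ _ (rbound (Mrep k a))) //=.
rewrite [X in _ + X]big1_seq ?addr0 // => i /andP[_].
by rewrite mem_index_iota -rdim_Mrep => /andP[/rdim_eq0 -> _]; rewrite !mul0r subrr.
Qed.

Lemma eulerDl a a' b c : (forall p, R c p p = R a p p + R a' p p)%N ->
  euler k c b = euler k a b + euler k a' b.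
Proof.
move=> cE; pose N := maxn (rbound (Mrep k c)) (maxn (rbound (Mrep k a)) (rbound (Mrep k a'))).
rewrite -!(@eulN_ge _ _ N) ?leq_max ?leqnn ?orbT // /eulN -big_split.
by apply: eq_bigr => i _; rewrite cE PoszD !mulrDl opprD addrACA.
Qed.

Lemma eulerDr a b b' c : (forall p, R c p p = R b p p + R b' p p)%N ->
  euler k a c = euler k a b + euler k a b'.
Proof.
move=> cE; rewrite !euler_eulN /eulN -big_split.
by apply: eq_bigr => i _; rewrite !cE !PoszD !mulrDr opprD addrACA.
Qed.

Lemma euler0l b : euler k mset0 b = 0.
Proof.
by rewrite euler_eulN /eulN big1 // => i _; rewrite R_mset0 !mul0r subrr.
Qed.

Lemma euler0r a : euler k a mset0 = 0.
Proof.
by rewrite euler_eulN /eulN big1 // => i _; rewrite !R_mset0 !mulr0 subrr.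
Qed.

(** M(b) has dimension 1 at each vertex of b and 0 elsewhere, so the sum telescopes. *)
Lemma euler_root (b : posroot) m :
  euler k [mset b]%mset m = (R m (val b).1 (val b).1)%:Z - (R m (val b).2.+1 (val b).2.+1)%:Z.
Proof.
have b12 := valP b.
pose B := [mset b]%mset : P; pose N := maxn (val b).2.+1 (rbound (Mrep k B)).
rewrite -(@eulN_ge _ _ N) ?leq_maxr // /eulN.
pose F i := (R m i i)%:Z - (R m i.+1 i.+1)%:Z.
transitivity (\sum_(0 <= i < N | spans b i i) F i).
  rewrite big_mkord [RHS]big_mkcond; apply: eq_bigr => i _; rewrite -mulrBr R_mset1.
  by case: (spans b i i); rewrite ?mul1r ?mul0r.
have bN : ((val b).2.+1 <= N)%N by apply: leq_maxl.
rewrite (@big_cat_nat _ _ _ (val b).1) //=; last by rewrite (leq_trans b12) // ltnW.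
rewrite big1_seq ?add0r; last first.
  move=> i /andP[/and3P[bi _ _]]; rewrite mem_index_iota => /andP[_].
  by rewrite ltnNge bi.
rewrite (@big_cat_nat _ _ _ (val b).2.+1) //=; last exact: leqW.
rewrite [X in _ + X]big1_seq ?addr0; last first.
  move=> i /andP[/and3P[_ _ ib]]; rewrite mem_index_iota => /andP[].
  by rewrite ltnNge ib.
have -> : \sum_((val b).1 <= i < (val b).2.+1 | spans b i i) F i =
    \sum_((val b).1 <= i < (val b).2.+1) F i.
  rewrite [RHS]big_nat [LHS]big_nat_cond; apply: eq_bigl => i.
  by rewrite /spans leqnn /= ltnS; apply: andbb.
have -> : \sum_((val b).1 <= i < (val b).2.+1) F i =
    - \sum_((val b).1 <= i < (val b).2.+1) ((R m i.+1 i.+1)%:Z - (R m i i)%:Z).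
  by rewrite -sumrN; apply: eq_bigr => i _; rewrite opprB.
by rewrite (telescope_sumr (fun i => (R m i i)%:Z)) ?leqW // opprB.
Qed.

End Euler.

(** * The Hall algebra *)

Section LinearExtension.
Variables (K : fieldType) (I : choiceType) (W : lmodType K).
Implicit Types (x y : {malg K[I]}) (f : I -> W).

Definition lext f x : W := \sum_(a <- msupp x) x@_a *: f a.

Lemma lext_seq f x (S : seq I) : uniq S ->
  (forall a, x@_a != 0 -> f a != 0 -> a \in S) ->
  lext f x = \sum_(a <- S) x@_a *: f a.
Proof.
move=> uS xS; rewrite /lext (bigID (fun a => a \in S)) /= addrC big1_seq ?add0r.
  rewrite -big_filter [RHS](bigID (fun a => a \in msupp x)) /= [X in _ = _ + X]big1 ?addr0.
    rewrite -[RHS]big_filter; apply: perm_big.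
    apply: uniq_perm; rewrite ?filter_uniq ?fset_uniq // => a.
    by rewrite !mem_filter andbC.
  by move=> a; rewrite -mcoeff_eq0 => /eqP ->; rewrite scale0r.
move=> a /andP[aS ax]; apply/eqP; rewrite scaler_eq0; apply/orP.
case: (eqVneq x@_a 0) => [|xa]; [by left | right].
by apply: contraNT aS; apply: xS.
Qed.

Lemma lextP f c x y : lext f (c *: x + y) = c *: lext f x + lext f y.
Proof.
pose S := undup (enum_fset (msupp (c *: x + y)) ++ enum_fset (msupp x) ++ enum_fset (msupp y)).
have E z : {subset msupp z <= S} -> lext f z = \sum_(a <- S) z@_a *: f a.
  move=> zS; apply: lext_seq; first exact: undup_uniq.
  by move=> a; rewrite mcoeff_neq0 => /zS.
rewrite !E; last 3 first.
- by move=> a ax; rewrite mem_undup !mem_cat ax !orbT.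
- by move=> a ax; rewrite mem_undup !mem_cat ax !orbT.
- by move=> a ax; rewrite mem_undup !mem_cat ax.
rewrite scaler_sumr -big_split; apply: eq_bigr => a _.
by rewrite mcoeffD mcoeffZ scalerDl scalerA.
Qed.

Lemma lextU f a : lext f << a >> = f a.
Proof.
rewrite (@lext_seq _ _ [:: a]) //; last first.
  by move=> b; rewrite mcoeffU inE; case: (eqVneq a b) => // _; rewrite mulr0n eqxx.
by rewrite big_seq1 mcoeffU eqxx scale1r.
Qed.

Lemma lext_lin f g c x : lext (fun a => c *: f a + g a) x = c *: lext f x + lext g x.
Proof.
rewrite /lext scaler_sumr -big_split; apply: eq_bigr => a _ /=.
by rewrite scalerDr !scalerA mulrC.
Qed.

Lemma eq_lext f g x : (forall a, x@_a != 0 -> f a = g a) -> lext f x = lext g x.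
Proof.
by move=> fg; apply: eq_big_seq => a; rewrite -mcoeff_neq0 => /fg ->.
Qed.

Lemma lext0 f : lext f 0 = 0.
Proof. by rewrite /lext msupp0 big_nil. Qed.

Lemma lextZ f c x : lext f (c *: x) = c *: lext f x.
Proof. by have := lextP f c x 0; rewrite lext0 !addr0. Qed.

End LinearExtension.

Section MalgInduction.
Variables (K : fieldType) (I : choiceType).
Implicit Types (x y : {malg K[I]}).

Lemma lext_id x : lext (fun a : I => << a >> : {malg K[I]}) x = x.
Proof.
rewrite [RHS]monalgE; apply: eq_bigr => a _; apply/malgP => b.
by rewrite mcoeffZ !mcoeffU mulr_natr.
Qed.

Lemma malg_ind (Q : {malg K[I]} -> Prop) x : Q 0 ->
  (forall c a y, x@_a != 0 -> Q y -> Q (c *: << a >> + y)) -> Q x.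
Proof.
move=> Q0 QS; rewrite -[X in Q X]lext_id /lext.
suff sQ (s : seq I) : {subset s <= msupp x} -> Q (\sum_(a <- s) x@_a *: << a >>) by apply: sQ.
elim: s => [|a s IHs] sx; first by rewrite big_nil.
rewrite big_cons; apply: QS; first by rewrite mcoeff_neq0 sx ?mem_head.
by apply: IHs => b bs; apply: sx; rewrite inE bs orbT.
Qed.

Lemma mcoeff_lext (J : choiceType) (f : J -> {malg K[I]}) (x : {malg K[J]}) l :
  (lext f x)@_l = \sum_(a <- msupp x) x@_a * (f a)@_l.
Proof.
rewrite /lext raddf_sum; apply: eq_bigr => a _; exact: mcoeffZ.
Qed.

End MalgInduction.

Section Evaluation.

Definition qrs : Qrs := rvar / svar.

Lemma svar_neq0 : svar != 0.
Proof. by rewrite /svar tofrac_eq0 polyX_eq0. Qed.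

Lemma rvar_neq0 : rvar != 0.
Proof. by rewrite /rvar tofrac_eq0 polyC_eq0 polyX_eq0. Qed.

Lemma qrs_neq0 : qrs != 0.
Proof. exact: mulf_neq0 rvar_neq0 (invr_neq0 svar_neq0). Qed.

Definition ev (F : {poly int}) : Qrs := (map_poly intr F).[qrs].

Lemma evD F G : ev (F + G) = ev F + ev G.
Proof. by rewrite /ev rmorphD hornerD. Qed.

Lemma evM F G : ev (F * G) = ev F * ev G.
Proof. by rewrite /ev rmorphM hornerM. Qed.

Lemma ev0 : ev 0 = 0.
Proof. by rewrite /ev rmorph0 horner0. Qed.

Lemma ev1 : ev 1 = 1.
Proof. by rewrite /ev rmorph1 hornerC. Qed.

Lemma ev_sum (J : Type) (s : seq J) (F : J -> {poly int}) :
  ev (\sum_(j <- s) F j) = \sum_(j <- s) ev (F j).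
Proof. exact: (big_morph ev evD ev0). Qed.

Lemma evXn n : ev 'X^n = qrs ^+ n.
Proof. by rewrite /ev map_polyXn hornerXn. Qed.

(** If [n + 1] vanished at r / s, then r^(n + 1) = s^(n + 1). As polynomials in s, the left side is
    constant and the right side is not. *)
Lemma ev_qp_neq0 n : ev (qp n.+1) != 0.
Proof.
rewrite /qp ev_sum; under eq_bigr => t _ do rewrite evXn.
apply/negP => /eqP s0; have := subrX1 qrs n.+1.
rewrite s0 mulr0 => /eqP; rewrite subr_eq0 expr_div_n.
move=> /eqP/(canRL (divfK (expf_neq0 _ svar_neq0))); rewrite mul1r /rvar /svar -!tofracXn.
move=> /eqP; rewrite tofrac_eq -rmorphXn => /eqP/(congr1 (fun F : {poly {poly rat}} => size F)).
by rewrite size_polyXn size_polyC; case: (_ == _).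
Qed.

End Evaluation.

(* Locked copies: conversion problems between basis elements or products would otherwise be
   attacked by unfolding. *)
HB.lock Definition hb (a : P) : hall_alg := u a.
HB.lock Definition sc (k : fieldType) (a b l : P) : Qrs :=
  svar ^ (- euler k a b) * ev (hall_poly a b l).
HB.lock Definition pr (k : fieldType) (a b : P) : hall_alg :=
  (\sum_(l \in [set: P]) sc k a b l *: u l)%classic.
HB.lock Definition hmul (k : fieldType) (x y : hall_alg) : hall_alg := hall_mul k x y.

Section HallAlgebra.
Variable k : fieldType.
Local Notation V := hall_alg.
Local Notation mul := (hmul k).
Local Notation e := (euler k).
Local Notation sc := (sc k).
Local Notation pr := (pr k).
Implicit Types (x y z : V) (a b l m : P).

Lemma sc_neq0 a b l : sc a b l != 0 -> hall_poly a b l != 0.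
Proof. by rewrite sc.unlock; apply: contraNneq => h0; rewrite h0 ev0 mulr0. Qed.

Lemma mcoeff_hb a b : (hb a)@_b = (a == b)%:R.
Proof. by rewrite hb.unlock /u mcoeffU. Qed.

(** The sum over all types is finite: a nonzero coefficient forces the dimension vector of a + b,
    hence membership in a box. *)
Lemma mcoeff_pr a b l : (pr a b)@_l = sc a b l.
Proof.
have [S uS SP] := box_ex (a `+` b)%mset.
have S0 m : m \notin S -> sc a b m = 0.
  move=> mS; apply/eqP; apply: contraNT mS => /sc_neq0/hall_poly_diag ld.
  by apply: SP => p; rewrite ld R_msetD.
rewrite pr.unlock (fsbigE S) //; last by move=> m _ /S0 ->; rewrite scale0r.
under eq_bigl => m do rewrite in_setT.
rewrite raddf_sum /=.
under eq_bigr => m _ do rewrite mcoeffZ -[u]hb.unlock mcoeff_hb.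
case: (boolP (l \in S)) => lS.
  rewrite (bigD1_seq l) //= eqxx mulr1 big1 ?addr0 // => m /negPf ->.
  by rewrite mulr0.
rewrite S0 // big1_seq // => m /= mS; case: eqVneq => [E|]; last by rewrite mulr0.
by rewrite E (negPf lS) in mS.
Qed.

Lemma hall_mulE x y : mul x y = lext (fun a => lext (pr a) y) x.
Proof.
rewrite hmul.unlock pr.unlock sc.unlock.
apply: eq_bigr => a _; rewrite scaler_sumr; apply: eq_bigr => b _.
exact: esym (scalerA _ _ _).
Qed.

Lemma lext_hb (W : lmodType Qrs) (f : P -> W) a : lext f (hb a) = f a.
Proof. by rewrite hb.unlock; apply: lextU. Qed.

Lemma lext_hb_id x : lext hb x = x.
Proof. by rewrite hb.unlock; apply: lext_id. Qed.

Lemma hb_ind (Q : V -> Prop) x : Q 0 ->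
  (forall c a y, x@_a != 0 -> Q y -> Q (c *: hb a + y)) -> Q x.
Proof. by rewrite hb.unlock; apply: malg_ind. Qed.

Lemma mul_linl c x y z : mul (c *: x + y) z = c *: mul x z + mul y z.
Proof. by rewrite !hall_mulE; apply: lextP. Qed.

Lemma mul_linr c x y z : mul z (c *: x + y) = c *: mul z x + mul z y.
Proof.
rewrite !hall_mulE; apply: etrans (lext_lin _ _ _ _); apply: eq_lext => a _; exact: lextP.
Qed.

Lemma mul0 x : mul 0 x = 0.
Proof. by rewrite hall_mulE lext0. Qed.

Lemma mulx0 x : mul x 0 = 0.
Proof. by have := mul_linr (-1) 0 0 x; rewrite scaler0 addr0 scaleN1r addNr. Qed.

Lemma mul_ux a y : mul (hb a) y = lext (pr a) y.
Proof. by rewrite hall_mulE; apply: lext_hb. Qed.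

Lemma mul_uu a b : mul (hb a) (hb b) = pr a b.
Proof. by rewrite mul_ux; apply: lext_hb. Qed.

Lemma mul_xu x b : mul x (hb b) = lext (fun a => pr a b) x.
Proof. by rewrite hall_mulE; apply: eq_lext => a _; apply: lext_hb. Qed.

Lemma pr0l b : pr mset0 b = hb b.
Proof.
apply/malgP => l; rewrite mcoeff_pr sc.unlock euler0l oppr0 expr0z mul1r hall_poly0l mcoeff_hb.
by case: eqP; rewrite ?ev1 ?ev0.
Qed.

Lemma pr0r a : pr a mset0 = hb a.
Proof.
apply/malgP => l; rewrite mcoeff_pr sc.unlock euler0r oppr0 expr0z mul1r hall_poly0r mcoeff_hb.
by case: eqP; rewrite ?ev1 ?ev0.
Qed.

Lemma mul_1l x : mul (hb mset0) x = x.
Proof.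
by rewrite mul_ux; apply: etrans (lext_hb_id x); apply: eq_lext => b _; rewrite pr0l.
Qed.

Lemma mul_1r x : mul x (hb mset0) = x.
Proof.
by rewrite mul_xu; apply: etrans (lext_hb_id x); apply: eq_lext => b _; rewrite pr0r.
Qed.

Lemma mcoeff_lext_seq (f : P -> V) x l (S : seq P) : uniq S ->
  (forall a, x@_a != 0 -> (f a)@_l != 0 -> a \in S) ->
  (lext f x)@_l = \sum_(a <- S) x@_a * (f a)@_l.
Proof.
move=> uS xS; rewrite mcoeff_lext.
exact: (@lext_seq _ _ (Qrs^o)%type (fun a => (f a)@_l) x S uS xS).
Qed.

Lemma mul_assoc_u a b (c : P) : mul (hb a) (mul (hb b) (hb c)) = mul (mul (hb a) (hb b)) (hb c).
Proof.
rewrite (mul_uu b c).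
rewrite (mul_uu a b).
rewrite (mul_ux a).
rewrite (mul_xu _ c).
apply/malgP => l.
have [S uS SP] := hall_box l; have bS := hall_poly_box SP.
have EL : (lext (pr a) (pr b c))@_l = \sum_(m <- S) (pr b c)@_m * (pr a m)@_l.
  apply: mcoeff_lext_seq uS _ => m _.
  rewrite mcoeff_pr.
  by move=> /sc_neq0/bS[].
have ER : (lext (pr^~ c) (pr a b))@_l = \sum_(m <- S) (pr a b)@_m * (pr m c)@_l.
  apply: mcoeff_lext_seq uS _ => m _.
  by rewrite mcoeff_pr => /sc_neq0/bS[].
apply: (etrans EL).
apply: (etrans _ (esym ER)).
(* Biadditivity of the Euler form gives both bracketings this same power of s, whatever the middle
   type m with a nonzero Hall polynomial. *)
pose E := svar ^ (- (e a b + e a c + e b c)).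
transitivity (E * ev (\sum_(m <- S) hall_poly b c m * hall_poly a m l)).
  rewrite ev_sum mulr_sumr; apply: eq_bigr => m _; rewrite !mcoeff_pr sc.unlock evM.
  case: (eqVneq (hall_poly b c m) 0) => [->|bcm]; first by rewrite ev0 !(mulr0, mul0r).
  rewrite mulrACA -expfzDr ?svar_neq0 // (eulerDr k a (hall_poly_diag bcm)).
  by rewrite -opprD /E [e b c + _]addrC mulrA.
rewrite (hall_poly_assoc uS SP).
rewrite ev_sum mulr_sumr; apply: eq_bigr => m _; rewrite !mcoeff_pr sc.unlock evM.
case: (eqVneq (hall_poly a b m) 0) => [->|abm]; first by rewrite ev0 !(mulr0, mul0r).
rewrite [RHS]mulrACA -expfzDr ?svar_neq0 // (eulerDl k c (hall_poly_diag abm)).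
by rewrite -opprD (addrA (e a b)) /E.
Qed.

Lemma mul_assoc : associative mul.
Proof.
move=> x y z.
apply: (@hb_ind (fun x => mul x (mul y z) = mul (mul x y) z) x); first by rewrite !mul0.
move=> ca a x' _ IHx.
rewrite (mul_linl ca (hb a) x' (mul y z)).
rewrite (mul_linl ca (hb a) x' y).
rewrite (mul_linl ca (mul (hb a) y) (mul x' y) z).
rewrite IHx.
suff -> : mul (hb a) (mul y z) = mul (mul (hb a) y) z by [].
apply: (@hb_ind (fun y => mul (hb a) (mul y z) = mul (mul (hb a) y) z) y).
  by rewrite mul0 !mulx0 mul0.
move=> cb b y' _ IHy.
rewrite (mul_linl cb (hb b) y' z).
rewrite (mul_linr cb (mul (hb b) z)).
rewrite (mul_linr cb (hb b)).
rewrite (mul_linl cb (mul (hb a) (hb b))).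
rewrite IHy.
suff -> : mul (hb a) (mul (hb b) z) = mul (mul (hb a) (hb b)) z by [].
apply: (@hb_ind (fun z => mul (hb a) (mul (hb b) z) = mul (mul (hb a) (hb b)) z) z).
  by rewrite !mulx0.
move=> cc c z' _ IHz.
rewrite (mul_linr cc (hb c) z' (hb b)).
rewrite (mul_linr cc (mul (hb b) (hb c))).
rewrite (mul_linr cc (hb c)).
rewrite IHz.
suff -> : mul (hb a) (mul (hb b) (hb c)) = mul (mul (hb a) (hb b)) (hb c) by [].
exact: mul_assoc_u.
Qed.

Lemma hall_is_algebra : is_algebra mul (hb mset0).
Proof.
split; [exact: mul_assoc | exact: mul_1l | exact: mul_1r | exact: mul_linl |].
by move=> c x y z; apply: mul_linr.
Qed.

End HallAlgebra.

(** * Ore extensions *)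

Section OreCriterion.
Variables (K : fieldType) (V : lmodType K) (mul : V -> V -> V) (one : V).
Hypothesis alg : is_algebra mul one.
Local Open Scope classical_set_scope.

Let mulA : associative mul. Proof. by case: alg. Qed.
Let mul1 : left_id one mul. Proof. by case: alg. Qed.
Let mulr1 : right_id one mul. Proof. by case: alg. Qed.
Let mull c x y z : mul (c *: x + y) z = c *: mul x z + mul y z. Proof. by case: alg. Qed.
Let mulr c x y z : mul z (c *: x + y) = c *: mul z x + mul z y. Proof. by case: alg. Qed.

Lemma alg_mulDl x y z : mul (x + y) z = mul x z + mul y z.
Proof. by have := mull 1 x y z; rewrite !scale1r. Qed.

Lemma alg_mulDr x y z : mul z (x + y) = mul z x + mul z y.
Proof. by have := mulr 1 x y z; rewrite !scale1r. Qed.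

Lemma alg_mul0l z : mul 0 z = 0.
Proof. by have := mull (-1) 0 0 z; rewrite scaler0 addr0 scaleN1r addNr. Qed.

Lemma alg_mul0r z : mul z 0 = 0.
Proof. by have := mulr (-1) 0 0 z; rewrite scaler0 addr0 scaleN1r addNr. Qed.

Lemma alg_mulZl c x z : mul (c *: x) z = c *: mul x z.
Proof. by rewrite -[c *: x]addr0 mull alg_mul0l addr0. Qed.

Lemma alg_mulZr c x z : mul z (c *: x) = c *: mul z x.
Proof. by rewrite -[c *: x]addr0 mulr alg_mul0r addr0. Qed.

Lemma alg_mulNl x z : mul (- x) z = - mul x z.
Proof. by rewrite -scaleN1r alg_mulZl scaleN1r. Qed.

Lemma alg_mulNr x z : mul z (- x) = - mul z x.
Proof. by rewrite -scaleN1r alg_mulZr scaleN1r. Qed.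

Lemma alg_mulr_sum (I : Type) (s : seq I) (F : I -> V) z :
  mul z (\sum_(i <- s) F i) = \sum_(i <- s) mul z (F i).
Proof. exact: (big_morph (mul z) (fun x y => alg_mulDr x y z) (alg_mul0r z)). Qed.

Lemma alg_mull_sum (I : Type) (s : seq I) (F : I -> V) z :
  mul (\sum_(i <- s) F i) z = \sum_(i <- s) mul (F i) z.
Proof. exact: (big_morph (mul^~ z) (fun x y => alg_mulDl x y z) (alg_mul0l z)). Qed.

Lemma alg_comm_scale c c' t x z :
  mul (c *: x) (c' *: z) - mul (c' *: (t *: z)) (c *: x) =
  (c * c') *: (mul x z - t *: mul z x).
Proof.
rewrite !alg_mulZl !alg_mulZr scalerBr !scalerA.
by rewrite -!mulrA [c' * (t * c)]mulrA [c' * t * c]mulrC.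
Qed.

(** With l(y), l(z) for y', z', this is the Leibniz rule for d(y) = x y - l(y) x, valid for every
    multiplicative l. *)
Lemma alg_twisted_leibniz x y z y' z' :
  mul x (mul y z) - mul (mul y' z') x =
  mul y' (mul x z - mul z' x) + mul (mul x y - mul y' x) z.
Proof.
rewrite !(alg_mulDr, alg_mulDl, alg_mulNr, alg_mulNl) !mulA.
by rewrite [RHS]addrC addrA addrNK.
Qed.

Lemma alg_twisted_linear x c y z y' z' :
  mul x (c *: y + z) - mul (c *: y' + z') x =
  c *: (mul x y - mul y' x) + (mul x z - mul z' x).
Proof. by rewrite mulr mull scalerBr opprD addrACA. Qed.

Section Subalgebra.
Variable A : set V.
Hypothesis sA : subalgebra mul one A.

Lemma sub_one : A one. Proof. by case: sA. Qed.
Lemma sub_mul x y : A x -> A y -> A (mul x y).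
Proof. by case: sA => _ _; apply. Qed.
Lemma sub_zero : A 0.
Proof. by case: sA => A1 Al _; have := Al (-1) _ _ A1 A1; rewrite scaleN1r addNr. Qed.
Lemma sub_scale c x : A x -> A (c *: x).
Proof. by case: sA => _ Al _ Ax; have := Al c _ _ Ax sub_zero; rewrite addr0. Qed.
Lemma sub_add x y : A x -> A y -> A (x + y).
Proof. by case: sA => _ Al _ Ax Ay; have := Al 1 _ _ Ax Ay; rewrite scale1r. Qed.
Lemma sub_opp x : A x -> A (- x).
Proof. by move=> Ax; rewrite -scaleN1r; apply: sub_scale. Qed.
Lemma sub_sum n (F : nat -> V) : (forall i, A (F i)) -> A (\sum_(i < n) F i).
Proof.
move=> AF; elim: n => [|n IHn]; first by rewrite big_ord0; apply: sub_zero.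
by rewrite big_ord_recr; apply: sub_add.
Qed.
End Subalgebra.

Variables (A B : set V) (x : V) (l l' : V -> V).
Hypotheses (sA : subalgebra mul one A) (sB : subalgebra mul one B).
Hypotheses (AB : A `<=` B) (Bx : B x).
Hypotheses (l_lin : forall c y z, l (c *: y + z) = c *: l y + l z)
  (l_mul : forall y z, l (mul y z) = mul (l y) (l z)) (l_one : l one = one)
  (lK : forall y, l' (l y) = y) (l'K : forall y, l (l' y) = y)
  (lA : forall y, A y -> A (l y)) (l'A : forall y, A y -> A (l' y)).

Let d y := mul x y - mul (l y) x.
Let xp i := iter i (mul x) one.

Hypothesis dA : forall y, A y -> A (d y).
Hypothesis gen : forall y, B y -> exists n (c : nat -> V), (forall i, A (c i)) /\
  y = \sum_(i < n) mul (xp i) (c i).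
Hypothesis free : forall n (c : nat -> V), (forall i, A (c i)) -> \sum_(i < n) mul (xp i) (c i) = 0 ->
  forall i, (i < n)%N -> c i = 0.

Let dE y : mul x y = mul (l y) x + d y.
Proof. by rewrite /d addrC subrK. Qed.

Let xpS i : xp i.+1 = mul (xp i) x.
Proof.
elim: i => [|i IHi]; first by rewrite /xp /= mulr1 mul1.
by rewrite -[LHS]/(mul x (xp i.+1)) {1}IHi mulA.
Qed.

Let l_zero : l 0 = 0.
Proof. by have := l_lin (-1) 0 0; rewrite scaler0 addr0 scaleN1r addNr. Qed.

Let left y := exists n c, (forall i, A (c i)) /\ y = lcomb mul one n c x.
Let right n y := exists c : nat -> V, (forall i, A (c i)) /\ y = \sum_(i < n) mul (xp i) (c i).

Let pad (F : nat -> V) n N : (n <= N)%N ->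
  \sum_(i < N) (if (i < n)%N then F i else 0) = \sum_(i < n) F i.
Proof.
move=> nN; rewrite (big_ord_widen N F nN) [RHS]big_mkcond.
by apply: eq_bigr.
Qed.

Let left_add y z : left y -> left z -> left (y + z).
Proof.
move=> [n [c [Ac ->]]] [m [c' [Ac' ->]]].
exists (maxn n m), (fun i => (if (i < n)%N then c i else 0) + (if (i < m)%N then c' i else 0)).
have A0 := sub_zero sA.
split=> [i|]; first by apply: sub_add => //; case: ifP.
rewrite /lcomb -(pad (fun i => mul (c i) (xp i)) (leq_maxl n m)).
rewrite -(pad (fun i => mul (c' i) (xp i)) (leq_maxr n m)) -big_split.
apply: eq_bigr => i _; rewrite alg_mulDl.
by case: ifP; case: ifP; rewrite ?alg_mul0l.
Qed.

Let left_mulx y : left y -> left (mul x y).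
Proof.
move=> [n [c [Ac ->]]]; rewrite /lcomb alg_mulr_sum.
have -> : \sum_(i < n) mul x (mul (c i) (iter i (mul x) one)) =
    \sum_(i < n) mul (l (c i)) (xp i.+1) + \sum_(i < n) mul (d (c i)) (xp i).
  rewrite -big_split; apply: eq_bigr => i _ /=.
  by rewrite mulA dE alg_mulDl -mulA.
apply: left_add; last by exists n, (fun i => d (c i)); split=> // i; apply: dA.
exists n.+1, (fun i => if i is i'.+1 then l (c i') else 0); split.
  by case=> [|i]; [apply: sub_zero | apply: lA].
by rewrite /lcomb big_ord_recl alg_mul0l add0r.
Qed.

Let left_gen y : B y -> left y.
Proof.
move=> /gen[n [c [Ac ->]]].
have lc i : left (mul (xp i) (c i)).
  have : left (c i).
    exists 1, (fun=> c i); split=> //.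
    by rewrite /lcomb big_ord_recl big_ord0 addr0 /= mulr1.
  move: (c i) => a La; elim: i => [|i IHi]; first by rewrite /xp /= mul1.
  by rewrite [xp _]/= -mulA; apply: left_mulx.
elim: n => [|n IHn].
  rewrite big_ord0; exists 0, (fun=> 0); split; first by move=> _; apply: sub_zero.
  by rewrite /lcomb big_ord0.
by rewrite big_ord_recr; apply: left_add.
Qed.

Let xmul a : mul a x = mul x (l' a) - d (l' a).
Proof. by rewrite dE l'K addrK. Qed.

Let right_mono n m y : (n <= m)%N -> right n y -> right m y.
Proof.
move=> nm [c [Ac ->]]; exists (fun i => if (i < n)%N then c i else 0); split.
  by move=> i; case: ifP => // _; apply: sub_zero.
rewrite -(pad (fun i => mul (xp i) (c i)) nm); apply: eq_bigr => i _.
by case: ifP; rewrite ?alg_mul0r.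
Qed.

Let right_add n y z : right n y -> right n z -> right n (y + z).
Proof.
move=> [c [Ac ->]] [c' [Ac' ->]]; exists (fun i => c i + c' i); split.
  by move=> i; apply: sub_add.
by rewrite -big_split; apply: eq_bigr => i _; rewrite alg_mulDr.
Qed.

Let right_mulx n y : right n y -> right n.+1 (mul y x).
Proof.
move=> [c [Ac ->]]; rewrite alg_mull_sum.
have -> : \sum_(i < n) mul (mul (xp i) (c i)) x =
    \sum_(i < n) mul (xp i.+1) (l' (c i)) + \sum_(i < n) mul (xp i) (- d (l' (c i))).
  rewrite -big_split; apply: eq_bigr => i _.
  by rewrite -mulA xmul alg_mulDr mulA xpS.
apply: right_add.
  exists (fun i => if i is i'.+1 then l' (c i') else 0); split.
    by case=> [|i]; [apply: sub_zero | apply: l'A].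
  by rewrite big_ord_recl alg_mul0r add0r.
apply: (right_mono (leqnSn n)); exists (fun i => - d (l' (c i))); split=> // i.
by apply: sub_opp => //; apply/dA/l'A.
Qed.

(* The leading term: a x^n = x^n l'^n(a) modulo lower powers of x. *)
Let move_right n a : A a -> right n (mul a (xp n) - mul (xp n) (iter n l' a)).
Proof.
elim: n a => [|n IHn] a Aa.
  exists (fun=> 0); split; first by move=> _; apply: sub_zero.
  by rewrite big_ord0 /xp /= mulr1 mul1 subrr.
have Ai : A (iter n l' a) by elim: (n) => //= m; apply: l'A.
have -> : mul a (xp n.+1) - mul (xp n.+1) (iter n.+1 l' a) =
    mul (mul a (xp n) - mul (xp n) (iter n l' a)) x + mul (xp n) (- d (l' (iter n l' a))).
  rewrite alg_mulDl alg_mulNl xpS mulA -addrA; congr (_ + _).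
  by rewrite -[mul (mul (xp n) (iter n l' a)) x]mulA (xmul (iter n l' a)) alg_mulDr opprD addrNK mulA.
apply: right_add; first exact/right_mulx/IHn.
exists (fun i => if i == n then - d (l' (iter n l' a)) else 0); split.
  by move=> i; case: ifP => _; [apply/(sub_opp sA)/dA/l'A | apply: sub_zero].
rewrite big_ord_recr /= eqxx big1 ?add0r // => i _.
by rewrite ltn_eqF // alg_mul0r.
Qed.

(** Rewritten with the powers of x on the left, the combination has leading coefficient l'^n(c_n).
    It vanishes by [free], and applying l repeatedly gives c_n = 0. *)
Let left_free n c : (forall i, A (c i)) -> lcomb mul one n c x = 0 ->
  forall i, (i < n)%N -> c i = 0.
Proof.
move=> Ac; elim: n => [//|n IHn] l0.
have Ai m a : A a -> A (iter m l' a) by move=> Aa; elim: m => //= m; apply: l'A.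
have lr m : right m (lcomb mul one m c x).
  elim: m => [|m IHm].
    by exists (fun=> 0); split; [move=> _; apply: sub_zero | rewrite /lcomb !big_ord0].
  rewrite /lcomb big_ord_recr /=; apply: right_add; first exact: (right_mono (leqnSn m)).
  rewrite -/(xp m) -[mul _ _](subrK (mul (xp m) (iter m l' (c m)))).
  apply: right_add; first exact/(right_mono (leqnSn m))/move_right.
  exists (fun i => if i == m then iter m l' (c m) else 0); split.
    by move=> i; case: ifP => _; [apply: Ai | apply: sub_zero].
  rewrite big_ord_recr /= eqxx big1 ?add0r // => i _.
  by rewrite ltn_eqF // alg_mul0r.
have [r [Ar E]] : right n (- mul (xp n) (iter n l' (c n))).
  have -> : - mul (xp n) (iter n l' (c n)) =
      lcomb mul one n c x + (mul (c n) (xp n) - mul (xp n) (iter n l' (c n))).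
    have E0 : lcomb mul one n c x + mul (c n) (xp n) = 0.
      by move: l0; rewrite /lcomb big_ord_recr.
    by rewrite addrA E0 sub0r.
  by apply: right_add; [apply: lr | apply: move_right].
have cn : c n = 0.
  pose r' i := if i == n then iter n l' (c n) else r i.
  have Ar' i : A (r' i) by rewrite /r'; case: ifP => // _; apply: Ai.
  have E' : \sum_(i < n.+1) mul (xp i) (r' i) = 0.
    rewrite big_ord_recr /= {2}/r' eqxx; apply/eqP; rewrite addr_eq0 E; apply/eqP.
    by apply: eq_bigr => i _; rewrite /r' ltn_eqF.
  have := free Ar' E' (ltnSn n); rewrite /r' eqxx.
  move: (c n) => a; elim: (n) => //= m IHm /(congr1 l); rewrite l'K l_zero.
  exact: IHm.
move=> i; rewrite ltnS leq_eqVlt => /orP[/eqP -> //|]; apply: IHn.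
by move: l0; rewrite /lcomb big_ord_recr /= cn alg_mul0l addr0.
Qed.

(** [gen] and [free] concern sums of x^i c_i. For generation, x is moved to the right by x y = l(y)
    x + d(y); for independence, it is moved back to the left with the inverse of l. *)
Lemma ore_criterion : ore_extension mul one A B x l d.
Proof.
split.
- split; [split | exact: l_one | by move=> *; apply: l_lin | by move=> *; apply: l_mul].
  + by move=> y; apply: lA.
  + by move=> y z _ _ /(congr1 l'); rewrite !lK.
  + by move=> y Ay; exists (l' y); [apply: l'A | apply: l'K].
- split=> [y|c y z _ _|y z _ _]; first exact: dA.
    by rewrite /d l_lin; apply: alg_twisted_linear.
  by rewrite /d l_mul; apply: alg_twisted_leibniz.
- by move=> y _; apply: dE.
- move=> y; split=> [/left_gen //|[n [c [Ac ->]]]].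
  apply: (@sub_sum B sB n (fun i => mul (c i) (xp i))) => i; apply: (sub_mul sB); first exact: AB.
  by elim: i => [|i IHi]; [apply: (sub_one sB) | apply: (sub_mul sB)].
- exact: left_free.
Qed.

End OreCriterion.

(** * The enumeration of the roots and the stages *)

Section Enumeration.

(** The triangular number j (j + 1) / 2, the number of roots that end before j. Hence [idx] gives
    the position of a root in the order [rlt]. *)
Definition tri j := (\sum_(i < j) i.+1)%N.

Definition idx (c : posroot) := (tri (val c).2 + (val c).1)%N.

Lemma triS j : tri j.+1 = (tri j + j.+1)%N.
Proof. by rewrite /tri big_ord_recr. Qed.

Lemma tri_mono i j : (i <= j)%N -> (tri i <= tri j)%N.
Proof.
elim: j => [|j IHj]; first by rewrite leqn0 => /eqP ->.
rewrite leq_eqVlt => /orP[/eqP -> //|ij]; rewrite triS.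
by apply: leq_trans (leq_addr _ _); apply: IHj.
Qed.

Lemma idx_rlt c b : rlt c b -> (idx c < idx b)%N.
Proof.
have c12 := valP c; rewrite /rlt /idx => /orP[c2|/andP[/eqP -> c1]]; last by rewrite ltn_add2l.
apply: leq_trans (leq_addr _ _); apply: leq_trans (tri_mono c2).
by rewrite triS -addnS leq_add2l ltnS.
Qed.

Lemma rltE c b : rlt c b = (idx c < idx b)%N.
Proof.
apply/idP/idP => [/idx_rlt//|lt]; case/or3P: (rlt_total c b) => [/eqP cb|//|/idx_rlt bc].
  by rewrite cb ltnn in lt.
by have := ltn_trans lt bc; rewrite ltnn.
Qed.

Lemma idx_inj : injective idx.
Proof.
move=> c b cb; case/or3P: (rlt_total c b) => [/eqP //||]; by rewrite rltE cb ltnn.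
Qed.

Fixpoint enum_root n : posroot :=
  if n is n'.+1 then
    match decP (@idP ((val (enum_root n')).1 < (val (enum_root n')).2)%N) with
    | left lt => exist (fun p => (p.1 <= p.2)%N)
                       ((val (enum_root n')).1.+1, (val (enum_root n')).2) lt
    | right _ => exist (fun p => (p.1 <= p.2)%N) (0, (val (enum_root n')).2.+1)%N isT
    end
  else exist (fun p => (p.1 <= p.2)%N) (0, 0)%N isT.

Lemma enum_rootK : cancel enum_root idx.
Proof.
elim=> [|n IHn]; first by rewrite /idx /tri /= big_ord0.
move: IHn => /=; case: (enum_root n) => -[i j] /= ij; rewrite /idx /=.
case: (decP _) => /= [lt <-|/negP ge <-]; first by rewrite addnS.
have -> : i = j by apply/eqP; rewrite eqn_leq ij leqNgt.
by rewrite triS addn0 addnS.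
Qed.

Lemma idxK : cancel idx enum_root.
Proof. by move=> c; apply: idx_inj; rewrite enum_rootK. Qed.

Lemma enum_root_bij : bijective enum_root.
Proof. exact: Bijective enum_rootK idxK. Qed.

Lemma below_idx n (m : P) : below (enum_root n) m <-> forall c, c \in m -> (idx c < n)%N.
Proof. by split=> H c /H; rewrite rltE enum_rootK. Qed.

Lemma beloweq_idx n (m : P) : beloweq (enum_root n) m <-> below (enum_root n.+1) m.
Proof.
split=> H c /H.
  by case/orP => [/eqP ->|]; rewrite !rltE !enum_rootK //; apply: leqW.
rewrite rltE enum_rootK ltnS leq_eqVlt => /orP[/eqP <-|lt]; first by rewrite idxK eqxx.
by rewrite rltE enum_rootK lt orbT.
Qed.

End Enumeration.

Section Products.
Variable k : fieldType.
Local Notation V := hall_alg.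
Local Notation mul := (hmul k).
Local Notation sc := (sc k).
Implicit Types (y z : V) (a m l : P) (b x : posroot).
Local Open Scope classical_set_scope.

Let halg := hall_is_algebra k.

Lemma below_msetD b a m : below b (a `+` m)%mset <-> below b a /\ below b m.
Proof.
split=> [H|[Ha Hm] c]; last by rewrite in_msetD => /orP[/Ha|/Hm].
by split=> c cm; apply: H; rewrite in_msetD cm ?orbT.
Qed.

Lemma below_eq b m : below b m -> beloweq b m.
Proof. by move=> H c /H ->; rewrite orbT. Qed.

Lemma below_mult b m : below b m -> m b = 0%N.
Proof.
by move=> H; apply/eqP; rewrite -leqn0 leqNgt mset_gt0; apply/negP => /H; rewrite rlt_irr.
Qed.

Lemma sc_top b m l : beloweq b m -> sc [mset b]%mset m l =
  if l == ([mset b] `+` m)%mset then sc [mset b]%mset m ([mset b] `+` m)%mset else 0.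
Proof.
move=> bm; case: eqP => [->//|nl]; rewrite sc.unlock hall_poly_top //.
by case: eqP => // _; rewrite ev0 mulr0.
Qed.

Lemma sc_top_neq0 b m : beloweq b m -> sc [mset b]%mset m ([mset b] `+` m)%mset != 0.
Proof.
move=> bm; rewrite sc.unlock hall_poly_top // eqxx mulf_neq0 ?ev_qp_neq0 //.
by rewrite expfz_neq0 ?svar_neq0.
Qed.

Lemma mul_top b m : beloweq b m -> mul (hb [mset b]%mset) (hb m) =
  sc [mset b]%mset m ([mset b] `+` m)%mset *: hb ([mset b] `+` m)%mset.
Proof.
move=> bm; rewrite mul_uu; apply/malgP => l; rewrite mcoeff_pr mcoeffZ mcoeff_hb.
rewrite (sc_top l bm) (eq_sym l ([mset b] `+` m)%mset).
by case: eqP => _; [rewrite mulr1 | rewrite mulr0].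
Qed.

(** An explicit span of basis elements, identified by [generatedE] with the subalgebra generated by
    the X_a, a < b. *)
Definition stg b : set V := [set y | forall m, y@_m != 0 -> below b m].

Lemma stg_hb b m : stg b (hb m) <-> below b m.
Proof.
split=> [H|H l]; first by apply: H; rewrite mcoeff_hb eqxx oner_eq0.
by rewrite mcoeff_hb; case: (eqVneq m l) => [<- //|_]; rewrite eqxx.
Qed.

Lemma stg_lin b c y z : stg b y -> stg b z -> stg b (c *: y + z).
Proof.
move=> by' bz m; rewrite mcoeffD mcoeffZ => nz.
case: (eqVneq z@_m 0) => [z0|/bz //]; case: (eqVneq y@_m 0) => [y0|/by' //].
by move: nz; rewrite z0 y0 mulr0 addr0 eqxx.
Qed.

Lemma stg_one b : stg b (hb mset0).
Proof. by apply/stg_hb => c; rewrite in_mset0. Qed.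

Lemma stg_zero b : stg b 0.
Proof. by move=> m; rewrite mcoeff0 eqxx. Qed.

Lemma stg_scale b c y : stg b y -> stg b (c *: y).
Proof. by move=> H; have := stg_lin (c := c) H (stg_zero b); rewrite addr0. Qed.

Lemma stg_mul b y z : stg b y -> stg b z -> stg b (mul y z).
Proof.
move=> yb zb.
have sum_stg (f : P -> V) w : (forall a, w@_a != 0 -> stg b (f a)) -> stg b (lext f w).
  move=> fw m nz; apply: contrapT => nm; case/eqP: nz; rewrite mcoeff_lext.
  rewrite big1_seq // => a /=; rewrite -mcoeff_neq0 => wa.
  by case: (eqVneq (f a)@_m 0) => [->|/(fw _ wa)/nm //]; rewrite mulr0.
rewrite hall_mulE; apply: (sum_stg) => a /yb ba; apply: (sum_stg) => a' /zb ba' m.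
by rewrite mcoeff_pr => /sc_neq0; apply: hall_poly_below.
Qed.

Lemma stg_sub b : subalgebra mul (hb mset0) (stg b).
Proof.
split; [exact: stg_one | by move=> c y z; apply: stg_lin | by move=> y z; apply: stg_mul].
Qed.

Lemma stgS n : stg (enum_root n) `<=` stg (enum_root n.+1).
Proof.
by move=> y yn m /yn/below_idx H; apply/below_idx => c /H; apply: leqW.
Qed.

Lemma stg_hb_root n b : (idx b < n)%N -> stg (enum_root n) (hb [mset b]%mset).
Proof. by move=> bn; apply/stg_hb/below_idx => c; rewrite in_mset1 => /eqP ->. Qed.

Lemma stg_exhaust y : exists n, stg (enum_root n) y.
Proof.
have mono n N z : (n <= N)%N -> stg (enum_root n) z -> stg (enum_root N) z.
  by move=> nN zn m /zn/below_idx H; apply/below_idx => c /H cn; apply: leq_trans nN.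
apply: (@hb_ind (fun y => exists n, stg (enum_root n) y)); first by exists 0; apply: stg_zero.
move=> c a z _ [n zn]; exists (maxn n (\sum_(d <- (a : seq posroot)) (idx d).+1)).
apply: stg_lin; last exact: mono (leq_maxl _ _) zn.
apply/stg_hb/below_idx => d da; rewrite leq_max; apply/orP; right.
by rewrite (big_rem _ da) /= leq_addr.
Qed.

Lemma stg0 y : stg (enum_root 0) y <-> exists c, y = c *: hb mset0.
Proof.
split=> [H|[c ->]]; last by apply: stg_scale; apply: stg_one.
exists y@_mset0; apply/malgP => m; rewrite mcoeffZ mcoeff_hb.
case: (eqVneq mset0 m) => [<-|m0]; first by rewrite mulr1.
rewrite mulr0; apply/eqP; apply: contraNT m0 => /H/below_idx m0.
by apply/eqP/msetP => c; rewrite mset0E; apply/esym/mset_eq0P/negP => /m0.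
Qed.

Definition gens n : set V := [set X k (enum_root i) | i in `I_n].

Lemma X_hb b : exists2 c, c != 0 & X k b = c *: hb [mset b]%mset.
Proof.
rewrite /X -[u]hb.unlock.
by eexists; [|reflexivity]; rewrite expfz_neq0 ?svar_neq0.
Qed.

Lemma gens_stg n : gens n `<=` stg (enum_root n).
Proof.
move=> _ [i /= i_n <-]; have [c _ ->] := X_hb (enum_root i).
by apply: stg_scale; apply: stg_hb_root; rewrite enum_rootK.
Qed.

(** If b is a largest root of b + m, then u_(b + m) is a nonzero multiple of u_b u_m. By induction
    every basis element of the stage is a product of generators up to a scalar. *)
Lemma stg_min n (A : set V) : subalgebra mul (hb mset0) A -> gens n `<=` A ->
  stg (enum_root n) `<=` A.
Proof.
move=> sA gA y; have A0 := sub_zero sA.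
have hA m : below (enum_root n) m -> A (hb m).
  elim/mset_max_ind: m => [_|b m bm IHm /below_msetD[bb bm']]; first exact: (sub_one sA).
  have Ab : A (hb [mset b]%mset).
    have /gA : gens n (X k b).
      exists (idx b); last by rewrite idxK.
      by apply: (proj1 (below_idx n _) bb); rewrite in_mset1.
    have [c c0 ->] := X_hb b => Ac.
    have := sub_scale sA c^-1 Ac.
    by rewrite scalerA mulVf // scale1r.
  have := sub_scale sA (sc [mset b]%mset m ([mset b] `+` m)%mset)^-1 (sub_mul sA Ab (IHm bm')).
  by rewrite mul_top // scalerA mulVf ?sc_top_neq0 // scale1r.
move=> yn; rewrite -[y]lext_hb_id /lext.
have : {subset msupp y <= msupp y} by [].
suff sA' (s : seq P) : {subset s <= msupp y} -> A (\sum_(a <- s) y@_a *: hb a) by apply: sA'.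
elim: s => [|a s IHs] sx; first by rewrite big_nil.
rewrite big_cons; apply: (sub_add sA); last first.
  by apply: IHs => c cs; apply: sx; rewrite inE cs orbT.
by apply/(sub_scale sA)/hA/yn; rewrite mcoeff_neq0 sx ?mem_head.
Qed.

Lemma generatedE n : generated mul (hb mset0) (gens n) = stg (enum_root n).
Proof.
rewrite /generated; apply/seteqP; split=> [y|y yn A [sA gA]]; last exact: (stg_min sA gA).
by apply; split; [apply: stg_sub | apply: gens_stg].
Qed.

End Products.

Section Powers.
Variables (F : fieldType) (s q : F).
Hypotheses (s0 : s != 0) (q0 : q != 0).
Implicit Types (i j : int).

Lemma expz2_neq0 i j : s ^ i * q ^ j != 0.
Proof. by rewrite mulf_neq0 ?expfz_neq0. Qed.

Lemma expz2D i j i' j' : s ^ (i + i') * q ^ (j + j') = (s ^ i * q ^ j) * (s ^ i' * q ^ j').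
Proof. by rewrite !expfzDr // mulrACA. Qed.

(** With i = <x, b> and j = <b, x>: the coefficient of u_(x + b) in u_b u_x equals chi(x) times its
    coefficient in u_x u_b. *)
Lemma expz2_commute i j (c : nat) : j = c ->
  s ^ (- j) * 1 = (s ^ (i - j) * q ^ (- j)) * (s ^ (- i) * q ^+ c).
Proof.
move=> ->; rewrite mulr1 mulrACA -expfzDr // addrAC addrN add0r.
by rewrite exprnP -expfzDr // addNr expr0z mulr1.
Qed.

End Powers.

(** * One step of the tower *)

Section Step.
Variables (k : fieldType) (n : nat).
Local Notation V := hall_alg.
Local Notation mul := (hmul k).
Local Notation e := (euler k).
Local Notation sc := (sc k).
Implicit Types (y z : V) (a m l : P).
Local Open Scope classical_set_scope.

Let halg := hall_is_algebra k.
Let b := enum_root n.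
Let rb : P := [mset b]%mset.
Let A := stg b.
Let B := stg (enum_root n.+1).

Lemma mcoeff_mul_seq y z m (S S' : seq P) : uniq S -> uniq S' ->
  (forall a, y@_a != 0 -> a \in S) -> (forall a, z@_a != 0 -> a \in S') ->
  (mul y z)@_m = \sum_(a <- S) y@_a * \sum_(c <- S') z@_c * sc a c m.
Proof.
move=> uS uS' yS zS; rewrite hall_mulE (@mcoeff_lext_seq _ y m S uS); last first.
  by move=> a /yS.
apply: eq_bigr => a _; congr (_ * _); rewrite (@mcoeff_lext_seq _ z m S' uS'); last first.
  by move=> c /zS.
by apply: eq_bigr => c _; rewrite mcoeff_pr.
Qed.

Definition twist (chi : P -> Qrs) y : V := lext (fun a => chi a *: hb a) y.

Lemma mcoeff_twist chi y m : (twist chi y)@_m = chi m * y@_m.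
Proof.
rewrite /twist (@mcoeff_lext_seq _ y m [:: m]) //; last first.
  move=> a _; rewrite mcoeffZ mcoeff_hb inE; case: (eqVneq a m) => // _.
  by rewrite mulr0 eqxx.
by rewrite big_seq1 mcoeffZ mcoeff_hb eqxx mulr1 mulrC.
Qed.

Lemma twist_lin chi c y z : twist chi (c *: y + z) = c *: twist chi y + twist chi z.
Proof. exact: lextP. Qed.

Lemma twist_mul chi y z : (forall a c m, sc a c m != 0 -> chi m = chi a * chi c) ->
  twist chi (mul y z) = mul (twist chi y) (twist chi z).
Proof.
move=> chiM; apply/malgP => m; rewrite mcoeff_twist.
have tw w a : (twist chi w)@_a != 0 -> a \in enum_fset (msupp w).
  by rewrite mcoeff_twist -mcoeff_neq0; apply: contraNneq => ->; rewrite mulr0.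
have ms (w : V) a : w@_a != 0 -> a \in enum_fset (msupp w) by rewrite mcoeff_neq0.
rewrite (mcoeff_mul_seq m (fset_uniq (msupp y)) (fset_uniq (msupp z)) (ms y) (ms z)).
rewrite (mcoeff_mul_seq m (fset_uniq (msupp y)) (fset_uniq (msupp z)) (tw y) (tw z)).
rewrite mulr_sumr; apply: eq_bigr => a _; rewrite mcoeff_twist.
rewrite !mulr_sumr; apply: eq_bigr => c _; rewrite mcoeff_twist.
case: (eqVneq (sc a c m) 0) => [->|/chiM ->]; first by rewrite !mulr0.
by rewrite mulrACA [chi c * (_ * _)]mulrA.
Qed.

Lemma twist_stg chi y : A y -> A (twist chi y).
Proof.
by move=> Ay m; rewrite mcoeff_twist => nz; apply: Ay; apply: contraNneq nz => ->; rewrite mulr0.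
Qed.

Lemma twistK chi chi' : (forall a, chi' a * chi a = 1) -> cancel (twist chi) (twist chi').
Proof.
by move=> chiK y; apply/malgP => m; rewrite !mcoeff_twist mulrA chiK mul1r.
Qed.

Lemma twist_hb chi a : twist chi (hb a) = chi a *: hb a.
Proof. exact: lext_hb. Qed.

(* Modulo lower terms u_b u_a is s^(- <b, a>) u_(a + b) and u_a u_b is
   s^(- <a, b>) (r / s)^<b, a> u_(a + b), for a single root a < b. *)
Definition chi a : Qrs := svar ^ (e a rb - e rb a) * qrs ^ (- e rb a).

Lemma chi_neq0 a : chi a != 0.
Proof. exact: expz2_neq0 svar_neq0 qrs_neq0 _ _. Qed.

Lemma chi0 : chi mset0 = 1.
Proof. by rewrite /chi euler0l euler0r; apply: mulr1. Qed.

(** The Euler form sees dimension vectors only, and these add up in every nonzero structure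
    constant. *)
Lemma chi_mul a c m : sc a c m != 0 -> chi m = chi a * chi c.
Proof.
move=> /sc_neq0/hall_poly_diag mE.
apply: etrans (expz2D svar_neq0 qrs_neq0 _ _ _ _).
by rewrite /chi (eulerDl k rb mE) (eulerDr k rb mE) !opprD addrACA.
Qed.

(** The only term of the two products that is not below b is u_(x + b), and chi(x) is the factor
    that cancels it. *)
Lemma root_commute (x : posroot) : rlt x b ->
  A (mul (hb rb) (hb [mset x]%mset) - chi [mset x]%mset *: mul (hb [mset x]%mset) (hb rb)).
Proof.
move=> xb; have bx : beloweq b [mset x]%mset.
  by move=> c; rewrite in_mset1 => /eqP ->; rewrite xb orbT.
set rx := [mset x]%mset; move=> l; rewrite !mul_uu mcoeffB mcoeffZ !mcoeff_pr (sc_top k l bx).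
have xb0 : rx b = 0%N.
  rewrite msetnE; case: eqP => // E; by rewrite E rlt_irr in xb.
(* Since x ends no later than b, the second term of [euler_root] vanishes, and <b, x> is the
   exponent found in [hall_poly_pair]. *)
have eE : e rb rx = ((val x).1 <= (val b).1 <= (val x).2)%N.
  rewrite euler_root !R_mset1 [X in _ - X](_ : _ = 0) ?subr0.
    by rewrite /spans leqnn.
  have := xb; rewrite /rlt /spans /=; case: (sval x) => ? ? /=; case: (sval b) => ? ? /= H.
  by case: andP => // -[_ ?]; exfalso; lia.
case: (eqVneq l (rb `+` rx)%mset) => [->|nl] nz; last first.
  have nz' : sc rx rb l != 0.
    by apply: contraNneq nz => ->; rewrite mulr0 subr0.
  have [E|//] := hall_poly_ext xb (sc_neq0 nz').
  by move: nl; rewrite E msetDC eqxx.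
exfalso; move/negP: nz; apply; rewrite subr_eq0; apply/eqP.
rewrite !sc.unlock hall_poly_top // xb0 eqxx [(rb `+` rx)%mset]msetDC hall_poly_pair //.
rewrite evXn.
have -> : ev (qp 1) = 1 by rewrite /qp big_ord1 expr0 ev1.
exact: expz2_commute svar_neq0 qrs_neq0 _ _ _ eE.
Qed.

Let Xb := X k b.
Let d y := mul Xb y - mul (twist chi y) Xb.

Lemma twist_scale_hb c a : twist chi (c *: hb a) = c *: (chi a *: hb a).
Proof. by rewrite -twist_hb; apply: lextZ. Qed.

Lemma d_root (x : posroot) : rlt x b -> A (d (X k x)).
Proof.
move=> xb; rewrite /d /Xb; have [c _ ->] := X_hb k b; have [c' _ ->] := X_hb k x.
rewrite twist_scale_hb (alg_comm_scale halg).
apply: stg_scale; exact: root_commute.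
Qed.

Lemma d_mul y z : d (mul y z) = mul (twist chi y) (d z) + mul (d y) z.
Proof.
rewrite /d twist_mul; last exact: chi_mul.
exact: alg_twisted_leibniz halg _ _ _ _ _.
Qed.

Lemma d_lin c y z : d (c *: y + z) = c *: d y + d z.
Proof. by rewrite /d twist_lin; apply: alg_twisted_linear halg _ _ _ _ _ _. Qed.

Lemma d_one : d (hb mset0) = 0.
Proof. by rewrite /d twist_hb chi0 scale1r mul_1l mul_1r subrr. Qed.

(** By linearity and the Leibniz rule, the elements of A that d maps into A form a subalgebra; it
    contains the generators. *)
Lemma d_stg y : A y -> A (d y).
Proof.
move=> Ay; have : [set y | A y /\ A (d y)] y; last by case.
apply: (stg_min (k := k) (n := n)) Ay => [|_ [i /= i_n <-]]; last first.
  split; first by apply: (gens_stg (k := k)); exists i.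
  by apply: d_root; rewrite rltE !enum_rootK.
have sA := stg_sub k b; split=> [|c y1 y2 [A1 d1] [A2 d2]|y1 y2 [A1 d1] [A2 d2]] /=.
- by rewrite d_one; split; [apply: stg_one | apply: stg_zero].
- by split; [exact: stg_lin A1 A2 | rewrite d_lin; exact: stg_lin d1 d2].
- split; first exact: stg_mul A1 A2.
  by rewrite d_mul; apply: (sub_add sA (stg_mul (twist_stg A1) d2) (stg_mul d1 A2)).
Qed.

(** The span of the u_m whose roots are at most b and in which b occurs exactly t times. Left
    multiplication by X_b maps it injectively into the next such space, so the terms of a sum of x^i
    c_i cannot interfere. *)
Let Et t y := forall m, y@_m != 0 -> beloweq b m /\ m b = t.

Lemma mset_addI (m m' : P) : (rb `+` m)%mset = (rb `+` m')%mset -> m = m'.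
Proof.
by move=> E; apply/msetP => c; have := congr1 (fun l : P => l c) E; rewrite !msetE2 => /addnI.
Qed.

Lemma mulrb_mcoeff t y m : Et t y ->
  (mul (hb rb) y)@_(rb `+` m)%mset = y@_m * sc rb m (rb `+` m)%mset.
Proof.
move=> Ey; rewrite mul_ux (@mcoeff_lext_seq _ y _ [:: m]) //; last first.
  move=> a /Ey[ba _]; rewrite mcoeff_pr (sc_top k _ ba) inE.
  case: (eqVneq (rb `+` m)%mset (rb `+` a)%mset) => [/mset_addI ->|_]; first by rewrite eqxx.
  by rewrite eqxx.
by rewrite big_seq1 mcoeff_pr.
Qed.

Lemma mulrb_supp t y l : Et t y -> (mul (hb rb) y)@_l != 0 ->
  exists2 m, l = (rb `+` m)%mset & y@_m != 0.
Proof.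
move=> Ey; rewrite mul_ux => nz; apply: contrapT => nl; case/eqP: nz.
rewrite mcoeff_lext big1_seq // => a /=; rewrite -mcoeff_neq0 => ya.
have [ba _] := Ey a ya; rewrite mcoeff_pr (sc_top k _ ba).
by case: eqP => [E|_]; [case: nl; exists a | rewrite mulr0].
Qed.

Lemma Et_scale t c y : Et t y -> Et t (c *: y).
Proof.
by move=> Ey m; rewrite mcoeffZ => nz; apply: Ey; apply: contraNneq nz => ->; rewrite mulr0.
Qed.

Lemma Et_mulX t y : Et t y -> Et t.+1 (mul Xb y).
Proof.
move=> Ey; rewrite /Xb; have [c _ ->] := X_hb k b; rewrite (alg_mulZl halg).
apply: Et_scale => l /(mulrb_supp Ey)[m -> /Ey[bm mt]]; split.
  by move=> x; rewrite in_msetD in_mset1 => /orP[->//|/bm].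
by rewrite msetE2 msetnxx mt.
Qed.

Lemma Et_mulX_inj t y : Et t y -> mul Xb y = 0 -> y = 0.
Proof.
move=> Ey; rewrite /Xb; have [c c0 ->] := X_hb k b; rewrite (alg_mulZl halg) => /eqP.
rewrite scaler_eq0 (negPf c0) /= => /eqP y0; apply/malgP => m; rewrite mcoeff0.
apply/eqP; apply: contraT => nz; have [bm _] := Ey m nz.
have := mulrb_mcoeff m Ey; rewrite y0 mcoeff0 => /esym/eqP; rewrite mulf_eq0.
by rewrite (negPf nz) (negPf (sc_top_neq0 k bm)).
Qed.

Let xp i := iter i (mul Xb) (hb mset0).

Lemma xpSl i y : mul (xp i.+1) y = mul Xb (mul (xp i) y).
Proof. by rewrite mul_assoc. Qed.

Lemma Et_xp i (a : V) : A a -> Et i (mul (xp i) a).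
Proof.
move=> Aa; elim: i => [|i IHi]; last by rewrite xpSl; apply: Et_mulX.
rewrite mul_1l => m /Aa bm; split; [exact: below_eq | exact: below_mult].
Qed.

Lemma xp_inj i (a : V) : A a -> mul (xp i) a = 0 -> a = 0.
Proof.
move=> Aa; elim: i => [|i IHi]; first by rewrite mul_1l.
by rewrite xpSl => /(Et_mulX_inj (Et_xp Aa))/IHi.
Qed.

Lemma xp_free N (c : nat -> V) : (forall i, A (c i)) ->
  \sum_(i < N) mul (xp i) (c i) = 0 -> forall i, (i < N)%N -> c i = 0.
Proof.
move=> Ac s0 i iN; apply: (xp_inj (i := i)) => //; apply/malgP => m; rewrite mcoeff0.
apply/eqP; apply: contraT => nz; have [_ mi] := Et_xp (Ac i) nz.
have := congr1 (mcoeff m) s0; rewrite mcoeff0 raddf_sum (bigD1 (Ordinal iN)) //= big1 ?addr0.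
  by move=> E; rewrite E eqxx in nz.
move=> j ji; apply/eqP; apply: contraT => nz'; have [_ mj] := Et_xp (Ac j) nz'.
by case/eqP: ji; apply: val_inj; rewrite /= -mj -mi.
Qed.

Let right y := exists N (c : nat -> V), (forall i, A (c i)) /\ y = \sum_(i < N) mul (xp i) (c i).

Lemma right_stg (a : V) : A a -> right a.
Proof.
by move=> Aa; exists 1, (fun=> a); split=> //; rewrite big_ord1 mul_1l.
Qed.

Lemma right_mulX y : right y -> right (mul Xb y).
Proof.
move=> [N [c [Ac ->]]]; exists N.+1, (fun i => if i is i'.+1 then c i' else 0); split.
  by case=> [|i] //; apply: stg_zero.
rewrite (alg_mulr_sum halg) big_ord_recl (alg_mul0r halg) add0r.
by apply: eq_bigr => i _; rewrite -xpSl.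
Qed.

Lemma right_lin c y z : right y -> right z -> right (c *: y + z).
Proof.
move=> [N [f [Af ->]]] [N' [g [Ag ->]]].
pose f' i := if (i < N)%N then f i else 0; pose g' i := if (i < N')%N then g i else 0.
exists (maxn N N'), (fun i => c *: f' i + g' i); split.
  have A0 : A 0 := stg_zero b.
  have A' (h : nat -> V) K i : (forall j, A (h j)) -> A (if (i < K)%N then h i else 0).
    by move=> Ah; case: (i < K)%N; [exact: Ah | exact: A0].
  move=> i; exact: stg_lin (A' f N i Af) (A' g N' i Ag).
have pad (h h' : nat -> V) K K' : (K <= K')%N -> h' =1 (fun i => if (i < K)%N then h i else 0) ->
    \sum_(i < K) mul (xp i) (h i) = \sum_(i < K') mul (xp i) (h' i).
  move=> KK' hE; rewrite (big_ord_widen K' (fun i => mul (xp i) (h i)) KK') big_mkcond.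
  by apply: eq_bigr => i _; rewrite hE; case: ifP => _ //; rewrite (alg_mul0r halg).
rewrite (pad f f' N (maxn N N')) ?leq_maxl // (pad g g' N' (maxn N N')) ?leq_maxr //.
by rewrite scaler_sumr -big_split; apply: eq_bigr => i _; rewrite mul_linr.
Qed.

Lemma right_scale c y : right y -> right (c *: y).
Proof.
by move=> ry; have := right_lin c ry (right_stg (stg_zero b)); rewrite addr0.
Qed.

(** Induction on the multiplicity of b: u_(b + m') is a nonzero multiple of X_b u_m', and without b
    the basis element lies in A. *)
Lemma right_hb m : beloweq b m -> right (hb m).
Proof.
have [t] := ubnP (m b); elim: t m => // t IHt m; rewrite ltnS => mt bm.
case: (boolP (b \in m)) => [/mset_split[m' mE]|nb]; last first.
  apply/right_stg/stg_hb => c cm; have := bm c cm; case/orP => // /eqP cb.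
  by move: nb; rewrite -cb cm.
have bm' : beloweq b m' by move=> c cm; apply: bm; rewrite mE in_msetD cm orbT.
have r' : right (hb m').
  by apply: IHt => //; apply: leq_trans mt; rewrite mE msetE2 msetnxx.
have [c c0 XE] := X_hb k b; have nz := mulf_neq0 c0 (sc_top_neq0 k bm').
have r : right ((c * sc rb m' (rb `+` m')%mset) *: hb (rb `+` m')%mset).
  have := right_mulX r'; rewrite /Xb XE (alg_mulZl halg) (mul_top k bm').
  by rewrite scalerA.
by have := right_scale ((c * sc rb m' (rb `+` m')%mset)^-1) r; rewrite (scalerK nz) mE.
Qed.

Lemma right_gen y : B y -> right y.
Proof.
move=> By; apply: (@hb_ind right y) => [|c a z ya rz].
  by apply: right_stg; apply: stg_zero.
by apply: right_lin => //; apply/right_hb/beloweq_idx/By.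
Qed.

Lemma stg_ore : ore_extension mul (hb mset0) A B Xb (twist chi) d.
Proof.
pose chi' a := (chi a)^-1.
apply: (@ore_criterion _ _ mul (hb mset0) halg A B Xb (twist chi) (twist chi')).
- exact: stg_sub.
- exact: stg_sub.
- exact: stgS.
- by apply: (gens_stg (k := k)); exists n => /=.
- exact: twist_lin.
- by move=> y z; apply/twist_mul/chi_mul.
- by rewrite twist_hb chi0 scale1r.
- by apply: twistK => a; rewrite mulVf ?chi_neq0.
- by apply: twistK => a; rewrite divff ?chi_neq0.
- by move=> y; apply: twist_stg.
- by move=> y; apply: twist_stg.
- exact: d_stg.
- exact: right_gen.
- exact: xp_free.
Qed.

End Step.

Theorem theorem2p6 (k : fieldType) :
  is_algebra (hall_mul k) hall_one /\
  exists b : nat -> posroot,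
    [/\ bijective b,
        (stage k b 0 = [set (c *: hall_one)%R | c in [set: Qrs]])%classic,
        forall x : hall_alg, exists j, stage k b j x &
        forall j, exists l d : hall_alg -> hall_alg,
          ore_extension (hall_mul k) hall_one
            (stage k b j) (stage k b j.+1) (X k (b j)) l d].
Proof.
have mulE : hmul k = hall_mul k by rewrite hmul.unlock.
have oneE : hb mset0 = hall_one by rewrite hb.unlock.
have stageE j : stage k enum_root j = stg (enum_root j).
  by rewrite -(generatedE k) /stage /gens mulE oneE.
rewrite -mulE -oneE; split; first exact: hall_is_algebra.
exists enum_root; split.
- exact: enum_root_bij.
- rewrite stageE; apply/seteqP; split=> [y /stg0[c ->]|_ [c _ <-]]; first by exists c.
  by apply/stg0; exists c.
- by move=> x; have [j xj] := stg_exhaust x; exists j; rewrite stageE.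
- move=> j; rewrite !stageE.
  by do 2!eexists; apply: stg_ore.
Qed.
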